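(* Let $k\geqslant 1$ and $n\geqslant1$. The dimension $\varphi^k_n$ of the space of indecomposable $\mathbb Q$-valued type $n$ invariants of the pure braid group $\mathcal P_k$ modulo type $n-1$ invariants is given by $$\varphi^k_n=\frac1n\sum_{m\mid n}\mu\left(n/m\right)\sum_{i=1}^{k-1}i^m,$$ where $\mu$ is the Möbius function of number theory.
   Context: $\mathcal P_k$ is the pure braid group on $k$ strands. All invariants are $\mathbb Q$-valued. A map $v\colon\mathcal P_k\to\mathbb Q$ is of type $n$ if its linear extension to $\mathbb Q\mathcal P_k$ vanishes on all singular pure braids with more than $n$ double points, where a double point is identified with (positive crossing) $-$ (negative crossing) in the group algebra; equivalently, the linear extension vanishes on $J^{n+1}\mathcal P_k$, the $(n+1)$-st power of the augmentation ideal of $\mathbb Q\mathcal P_k$. Let $\mathcal V^n_k$ be the $\mathbb Q$-vector space of type $n$ invariants of $\mathcal P_k$ (with $\mathcal V^{-1}_k=0$). Pointwise multiplication of invariants makes $\mathcal G=\bigoplus_{n\geqslant0}\mathcal V^n_k/\mathcal V^{n-1}_k$ a commutative graded algebra. With $I=\bigoplus_{n\geqslant1}\mathcal V^n_k/\mathcal V^{n-1}_k$ the ideal of positive-degree elements, the space of indecomposable elements is $I/I^2$, and $\varphi^k_n$ is the dimension over $\mathbb Q$ of its degree $n$ part. *)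

(* Defs.v *)
(* MathComp, with classical sets and function spaces from MathComp-Analysis. *)
From HB Require Import structures.
From mathcomp Require Import all_boot all_order all_algebra all_fingroup.
From mathcomp Require Import generic_quotient zify.
From mathcomp Require Import boolp classical_sets functions.

Set Implicit Arguments.
Unset Strict Implicit.
Unset Printing Implicit Defensive.

Import GRing.Theory.
Local Open Scope classical_set_scope.
Local Open Scope ring_scope.

(* The generator [sigma_i] exchanges positions [i] and [i + 1] (counted from 0);
   in a word, [(i, true)] stands for [sigma_i] and [(i, false)] for its
   inverse. *)
Definition braid_word (k : nat) := seq ('I_k.-1 * bool).

Inductive braid_equiv (k : nat) : braid_word k -> braid_word k -> Prop :=
| braid_equiv_refl u : braid_equiv u u
| braid_equiv_sym u v : braid_equiv u v -> braid_equiv v u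
| braid_equiv_trans u v w :
    braid_equiv u v -> braid_equiv v w -> braid_equiv u w
| braid_equiv_cat u u' v v' :
    braid_equiv u u' -> braid_equiv v v' -> braid_equiv (u ++ v) (u' ++ v')
| braid_equiv_cancel i b : braid_equiv [:: (i, b); (i, ~~ b)] [::]
| braid_equiv_far (i j : 'I_k.-1) : (i.+1 < j)%N ->
    braid_equiv [:: (i, true); (j, true)] [:: (j, true); (i, true)]
| braid_equiv_near (i j : 'I_k.-1) : j = i.+1 :> nat ->
    braid_equiv [:: (i, true); (j, true); (i, true)]
                [:: (j, true); (i, true); (j, true)].

Definition braid_eqb (k : nat) : rel (braid_word k) :=
  fun u v => `[< braid_equiv u v >].

Lemma braid_eqb_refl k : reflexive (@braid_eqb k).
Proof. by move=> u; apply/asboolP; constructor. Qed.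

Lemma braid_eqb_sym k : symmetric (@braid_eqb k).
Proof.
by move=> u v; apply/asboolP/asboolP => /braid_equiv_sym.
Qed.

Lemma braid_eqb_trans k : transitive (@braid_eqb k).
Proof.
move=> v u w /asboolP uv /asboolP vw; apply/asboolP.
exact: braid_equiv_trans uv vw.
Qed.

Canonical braid_equiv_rel k :=
  EquivRel (@braid_eqb k) (@braid_eqb_refl k) (@braid_eqb_sym k)
           (@braid_eqb_trans k).

Definition braid (k : nat) := {eq_quot (@braid_eqb k)}%qT.
HB.instance Definition _ k := Choice.on (braid k).

Definition braid_of (k : nat) (w : braid_word k) : braid k :=
  (\pi_({eq_quot (@braid_eqb k)}) w)%qT.
Definition braid_repr (k : nat) (b : braid k) : braid_word k :=
  generic_quotient.repr b.

Lemma braid_reprK k (b : braid k) : braid_of (braid_repr b) = b.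
Proof. exact: reprK. Qed.

Lemma braid_ofP k (u v : braid_word k) :
  braid_of u = braid_of v <-> braid_equiv u v.
Proof.
by split=> [/eqmodP/asboolP|uv] //; apply/eqmodP/asboolP.
Qed.

Lemma braid_ofK k (u : braid_word k) : braid_equiv (braid_repr (braid_of u)) u.
Proof. by apply/braid_ofP; rewrite braid_reprK. Qed.

Definition inv_word (k : nat) (w : braid_word k) : braid_word k :=
  rev [seq (l.1, ~~ l.2) | l <- w].

Lemma inv_wordK k : involutive (@inv_word k).
Proof.
move=> w; rewrite /inv_word map_rev revK -map_comp -[RHS]map_id.
by apply: eq_map => -[i b] /=; rewrite negbK.
Qed.

Lemma inv_word_cat k (u v : braid_word k) :
  inv_word (u ++ v) = inv_word v ++ inv_word u.
Proof. by rewrite /inv_word map_cat rev_cat. Qed.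

Lemma inv_wordV k (w : braid_word k) : braid_equiv (w ++ inv_word w) [::].
Proof.
elim: w => [|[i b] w IH]; first exact: braid_equiv_refl.
have -> : ((i, b) :: w) ++ inv_word ((i, b) :: w)
          = [:: (i, b)] ++ ((w ++ inv_word w) ++ [:: (i, ~~ b)]).
  by rewrite -[(i, b) :: w]cat1s inv_word_cat -!catA.
apply: braid_equiv_trans (braid_equiv_cancel i b).
have e := @braid_equiv_refl k.
exact: (braid_equiv_cat (e [:: (i, b)])
         (braid_equiv_cat IH (e [:: (i, ~~ b)]))).
Qed.

Lemma inv_word_equiv k (u v : braid_word k) :
  braid_equiv u v -> braid_equiv (inv_word u) (inv_word v).
Proof.
move=> uv; have e := @braid_equiv_refl k.
have h1 : braid_equiv (inv_word u ++ (v ++ inv_word v)) (inv_word u).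
  rewrite -[X in braid_equiv _ X]cats0.
  by apply: braid_equiv_cat (e _) (inv_wordV v).
have h2 : braid_equiv (inv_word u ++ (v ++ inv_word v)) (inv_word v).
  rewrite catA -[X in braid_equiv _ X]cat0s.
  apply: braid_equiv_cat (e _).
  apply: braid_equiv_trans (braid_equiv_cat (e _) (braid_equiv_sym uv)) _.
  by have := inv_wordV (inv_word u); rewrite inv_wordK.
exact: braid_equiv_trans (braid_equiv_sym h1) h2.
Qed.

Definition braid_one (k : nat) : braid k := braid_of [::].
Definition braid_mul (k : nat) (a b : braid k) : braid k :=
  braid_of (braid_repr a ++ braid_repr b).
Definition braid_inv (k : nat) (a : braid k) : braid k :=
  braid_of (inv_word (braid_repr a)).

Lemma braid_mulE k (u v : braid_word k) :
  braid_mul (braid_of u) (braid_of v) = braid_of (u ++ v).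
Proof. by apply/braid_ofP/braid_equiv_cat; apply: braid_ofK. Qed.

Lemma braid_invE k (u : braid_word k) :
  braid_inv (braid_of u) = braid_of (inv_word u).
Proof. exact/braid_ofP/inv_word_equiv/braid_ofK. Qed.

Lemma braid_mulA k : associative (@braid_mul k).
Proof.
move=> a b c; rewrite -(braid_reprK a) -(braid_reprK b) -(braid_reprK c).
by rewrite !braid_mulE catA.
Qed.

Lemma braid_mul1 k : left_id (braid_one k) (@braid_mul k).
Proof. by move=> a; rewrite -(braid_reprK a) braid_mulE. Qed.

Lemma braid_mulr1 k : right_id (braid_one k) (@braid_mul k).
Proof. by move=> a; rewrite -(braid_reprK a) braid_mulE cats0. Qed.

Lemma braid_mulrV k : right_inverse (braid_one k) (@braid_inv k) (@braid_mul k).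
Proof.
move=> a; rewrite -(braid_reprK a) braid_invE braid_mulE.
exact/braid_ofP/inv_wordV.
Qed.

Lemma braid_mulV k : left_inverse (braid_one k) (@braid_inv k) (@braid_mul k).
Proof.
move=> a; rewrite -(braid_reprK a) braid_invE braid_mulE.
by apply/braid_ofP; have := inv_wordV (inv_word (braid_repr a)); rewrite inv_wordK.
Qed.

HB.instance Definition _ (k : nat) :=
  isGroup.Build (braid k) (@braid_mulA k) (@braid_mul1 k) (@braid_mulr1 k)
    (@braid_mulV k) (@braid_mulrV k).

Definition sigma (k : nat) (i : 'I_k.-1) : braid k := braid_of [:: (i, true)].

Lemma adj_l_subproof k (i : 'I_k.-1) : (i < k)%N.
Proof. exact: leq_trans (ltn_ord i) (leq_pred k). Qed.

Lemma adj_r_subproof k (i : 'I_k.-1) : (i.+1 < k)%N.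
Proof. by rewrite -ltn_predRL. Qed.

Definition adj_tperm (k : nat) (i : 'I_k.-1) : 'S_k :=
  tperm (Ordinal (adj_l_subproof i)) (Ordinal (adj_r_subproof i)).

Definition word_perm (k : nat) (w : braid_word k) : 'S_k :=
  (\prod_(l <- w) adj_tperm l.1)%g.

Lemma word_perm_cat k (u v : braid_word k) :
  word_perm (u ++ v) = (word_perm u * word_perm v)%g.
Proof. exact: big_cat. Qed.

Lemma tperm_braid (T : finType) (x y z : T) : x != z -> y != z -> x != y ->
  (tperm x y * tperm y z * tperm x y = tperm y z * tperm x y * tperm y z)%g.
Proof.
move=> xz yz xy.
transitivity (tperm y z ^ tperm x y)%g; first by rewrite /conjg tpermV mulgA.
transitivity (tperm x y ^ tperm y z)%g; last by rewrite /conjg tpermV mulgA.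
by rewrite !tpermJ tpermR tpermL !tpermD // eq_sym.
Qed.

Lemma word_perm_equiv k (u v : braid_word k) :
  braid_equiv u v -> word_perm u = word_perm v.
Proof.
elim=> {u v} //.
- by move=> u v w _ -> _ ->.
- by move=> u u' v v' _ eu _ ev; rewrite !word_perm_cat eu ev.
- by move=> i b; rewrite /word_perm !big_cons big_nil mulg1 tperm2.
- move=> i j ij; rewrite /word_perm !big_cons big_nil !mulg1 /=.
  rewrite conjgC /adj_tperm tpermJ !tpermD //; rewrite -val_eqE /=; lia.
- move=> i j ji; rewrite /word_perm !big_cons big_nil !mulg1 /= !mulgA.
  have -> : adj_tperm j =
      tperm (Ordinal (adj_r_subproof i)) (Ordinal (adj_r_subproof j)).
    by rewrite /adj_tperm; congr tperm; apply: val_inj.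
  apply: tperm_braid; rewrite -val_eqE /=; lia.
Qed.

Definition braid_perm (k : nat) (b : braid k) : 'S_k := word_perm (braid_repr b).

Lemma braid_permE k (w : braid_word k) : braid_perm (braid_of w) = word_perm w.
Proof. exact/word_perm_equiv/braid_ofK. Qed.

Lemma braid_permM k (a b : braid k) :
  braid_perm (a * b)%g = (braid_perm a * braid_perm b)%g.
Proof. by rewrite braid_permE word_perm_cat. Qed.

Lemma braid_perm1 k : braid_perm (1%g : braid k) = 1%g.
Proof. by rewrite braid_permE /word_perm big_nil. Qed.

Lemma braid_permV k (a : braid k) : braid_perm a^-1%g = (braid_perm a)^-1%g.
Proof.
by apply: (mulgI (braid_perm a)); rewrite -braid_permM !mulgV braid_perm1.
Qed.

Lemma braid_perm_sigma k (i : 'I_k.-1) : braid_perm (sigma i) = adj_tperm i.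
Proof. by rewrite braid_permE /word_perm big_seq1. Qed.

Definition pure (k : nat) : pred (braid k) := fun b => braid_perm b == 1%g.

Lemma pure_group_closed k : group_closed (@pure k).
Proof.
split=> [|a b /eqP pa /eqP pb]; apply/eqP; first exact: braid_perm1.
by rewrite braid_permM braid_permV pa pb invg1 mulg1.
Qed.

Record pure_braid (k : nat) : Type := PureBraid {
  pure_braid_val :> braid k;
  pure_braidP : pure pure_braid_val
}.

HB.instance Definition _ k := [isSub for @pure_braid_val k].
HB.instance Definition _ k := [Choice of pure_braid k by <:].
HB.instance Definition _ k :=
  SubChoice_isSubGroup.Build (braid k) (@pure k) (pure_braid k)
    (@pure_group_closed k).
(* [pointedType] gives the functions [pure_braid k -> rat] their pointwise ring
   structure. *)
HB.instance Definition _ k := isPointed.Build (pure_braid k) 1%g.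

Variant crossing := Positive | Negative | Double.

Definition is_double (c : crossing) : bool := if c is Double then true else false.

(* Singular braids are words in [sigma_i], [sigma_i^-1] and the generators
   [tau_i] of the singular braid monoid; [tau_i], written [(i, Double)],
   is the singular crossing of the strands in positions [i] and [i + 1]. *)
Definition singular_word (k : nat) := seq ('I_k.-1 * crossing).

Definition double_points (k : nat) (w : singular_word k) : nat :=
  count (fun l => is_double l.2) w.

Definition singular_perm (k : nat) (w : singular_word k) : 'S_k :=
  (\prod_(l <- w) adj_tperm l.1)%g.

(* A list of pairs (coefficient, braid) stands for the corresponding formal
   linear combination of braids. *)
Definition crossing_resolve (k : nat) (l : 'I_k.-1 * crossing) :
    seq (rat * braid k) :=
  match l.2 with
  | Positive => [:: (1, sigma l.1)]
  | Negative => [:: (1, (sigma l.1)^-1%g)]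
  | Double => [:: (1, sigma l.1); (-1, (sigma l.1)^-1%g)]
  end.

Fixpoint resolve (k : nat) (w : singular_word k) : seq (rat * braid k) :=
  if w is l :: w' then
    [seq (x.1 * y.1, (x.2 * y.2)%g) | x <- crossing_resolve l, y <- resolve w']
  else [:: (1, 1%g)].

Lemma resolve_perm k (w : singular_word k) x :
  x \in resolve w -> braid_perm x.2 = singular_perm w.
Proof.
elim: w x => [|l w IH] x.
  by rewrite inE => /eqP->; rewrite braid_perm1 /singular_perm big_nil.
case/allpairsP=> -[y z] /= [yl zw ->] /=.
rewrite braid_permM (IH _ zw) /singular_perm big_cons; congr (_ * _)%g.
have pV : braid_perm (sigma l.1)^-1%g = adj_tperm l.1.
  by rewrite braid_permV braid_perm_sigma tpermV.
move: yl; rewrite /crossing_resolve.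
case: l.2; rewrite !inE; [move/eqP->|move/eqP->|case/orP=> /eqP->] => //=;
  exact: braid_perm_sigma.
Qed.

(* By [resolve_perm], every braid in the resolution of a singular pure braid is
   pure, so [pmap] drops no term there. *)
Definition pure_resolve (k : nat) (w : singular_word k) :
    seq (rat * pure_braid k) :=
  pmap (fun x => omap (pair x.1) (insub x.2)) (resolve w).

Definition linear_extension (T : Type) (v : T -> rat) (c : seq (rat * T)) : rat :=
  \sum_(x <- c) x.1 * v x.2.

(* [finite_type k n] is the space of invariants of type [n]. *)
Definition finite_type (k n : nat) : set (pure_braid k -> rat) :=
  [set v | forall w : singular_word k,
     singular_perm w = 1%g -> (n < double_points w)%N ->
     linear_extension v (pure_resolve w) = 0].
Arguments finite_type : clear implicits.

(* [finite_type_pred k n] is the space of invariants of type [n - 1], where only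
   the zero invariant has type [-1]. *)
Definition finite_type_pred (k n : nat) : set (pure_braid k -> rat) :=
  if n is m.+1 then finite_type k m else [set 0].
Arguments finite_type_pred : clear implicits.

(* An element of the graded algebra is represented by a polynomial whose
   coefficient of degree [i] is a type [i] invariant, taken modulo invariants
   of type [i - 1].  Products of polynomials represent products in the graded
   algebra. *)
Definition gr_positive (k : nat) : set {poly (pure_braid k -> rat)} :=
  [set p | p`_0 = 0 /\ forall i, finite_type k i p`_i].
Arguments gr_positive : clear implicits.

Definition gr_positive_sq (k : nat) : set {poly (pure_braid k -> rat)} :=
  [set p | exists (m : nat) (x y : 'I_m -> {poly (pure_braid k -> rat)}),
     [/\ forall j, gr_positive k (x j), forall j, gr_positive k (y j)
       & p = \sum_(j < m) x j * y j]].
Arguments gr_positive_sq : clear implicits.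

(* Type [n] invariants whose class modulo type [n - 1] lies in the degree [n]
   part of the square of the ideal of positive-degree elements. *)
Definition decomposable (k n : nat) : set (pure_braid k -> rat) :=
  [set u + p`_n | u in finite_type_pred k n & p in gr_positive_sq k].
Arguments decomposable : clear implicits.

(* For subspaces [W] of [U], the quotient [U / W] has dimension [d]: the classes
   of some [b_0, ..., b_(d-1)] in [U] form a basis of it. *)
Definition has_quotient_dim (E : lmodType rat) (U W : set E) (d : nat) : Prop :=
  exists b : 'I_d -> E, (forall i, U (b i)) /\
    forall u, U u -> exists! c : {ffun 'I_d -> rat},
      W (u - \sum_(i < d) c i *: b i).

(* [indecomposable_dim k n d]: the degree [n] part of the space of
   indecomposable elements has dimension [d]. *)
Definition indecomposable_dim (k n d : nat) : Prop :=
  @has_quotient_dim (pure_braid k -> rat^o) (finite_type k n) (decomposable k n) d.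

Definition moebius (n : nat) : int :=
  if all (fun p => logn p n == 1%N) (primes n) then (-1) ^+ size (primes n)
  else 0.

(* Main.v *)
Require Import Defs.
From HB Require Import structures.
From mathcomp Require Import all_boot all_order all_algebra all_fingroup.
From mathcomp Require Import zify ring lra.
From mathcomp Require Import boolp functions.

Set Implicit Arguments.
Unset Strict Implicit.
Unset Printing Implicit Defensive.

Import Order.TTheory GRing.Theory Num.Theory.
Local Open Scope ring_scope.

(** Why the formula holds.

    Let I be the two-sided ideal of the group algebra of the braid group spanned
    by singular braids with a double point.  Type n invariants are the functions
    on pure braids, extended by zero to all braids, that vanish on the power
    I^(n+1) ([vanish], [finite_typeP]).  The proof determines the quotients of
    the spaces of type n and type n - 1 invariants together with the product
    that they inherit, and then finds the indecomposable elements of the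
    resulting algebra.

    The upper bound.  Crossing changes connect any two braids with the same
    permutation, because the braid group becomes the symmetric group once the
    squares of the generators are killed ([coxeter]).  Hence, modulo one more
    double point, a singular pure braid with n double points is a product of n
    factors A - 1, where A runs over the standard generators of the pure braid
    group, the chords ([diffs_detect]).  So a type n invariant is determined
    modulo type n - 1 by its weight system, a function on words of n chords.  Let
    the strand of a chord be the upper of the two strands that it joins.  Disjoint
    chords commute and any three strands satisfy the 4T relations
    ([chord_disjoint], [four_term]), so that every word of chords can be
    rewritten into combed ones, in which the strands decrease weakly
    ([weight_combed]).  The weight system on combed words thus suffices
    ([weight_detect]).

    The lower bound.  The Hurwitz action of the braid group on tuples of
    unipotent matrices turns the Magnus coefficients of the conjugating word of a
    strand into functions on braids.  Their type is the length of the coefficient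
    ([magnus_vanish]), since a double point contributes a factor in the
    augmentation ideal ([aug_double]).  On combed words they are delta functions
    ([weight_magnus]), and their products realize every function on combed words
    of length n as the weight system of an invariant ([invariant_realize]).

    The algebra.  The product of invariants becomes the shuffle product of weight
    systems ([weight_mul]), so the graded algebra is the quotient of the shuffle
    algebra on chords obtained by restricting functions to combed words.  Order
    the chords by their strand first.  By the theorem of Radford, shuffle products
    of Lyndon words are triangular with respect to their decreasing
    concatenations ([lyndon_prod_le_lcat]).  A word is combed exactly when each
    of its Lyndon factors has all its chords on a single strand
    ([lyndon_combed_strand], [lcat_combed]).  Hence the algebra is a polynomial
    algebra whose generators of degree n are the Lyndon words of length n with
    all chords on one strand ([monomial_basis], [indecomposable_dim_lyndon]).

    The count.  Strand j carries j chords, one for each lower strand.  Every word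
    is in a unique way a rotation of a power of a Lyndon word, so that j^n is the
    sum over the divisors m of n of m times the number of Lyndon words of length
    m ([sum_lyndon_words]); Moebius inversion yields the formula. *)

(** * Shuffle products of functions on words *)

(** The sum of [F u * G v] over all ways of splitting [s] into complementary
    subwords [u] and [v]. *)
Fixpoint shuffle_prod (T : Type) (F G : seq T -> rat) (s : seq T) : rat :=
  if s is c :: s' then
    shuffle_prod (fun u => F (c :: u)) G s' + shuffle_prod F (fun v => G (c :: v)) s'
  else F [::] * G [::].

Inductive shuffle (T : Type) : seq T -> seq T -> seq T -> Prop :=
| shuffle_nil : shuffle [::] [::] [::]
| shuffle_left a u v s : shuffle u v s -> shuffle (a :: u) v (a :: s)
| shuffle_right a u v s : shuffle u v s -> shuffle u (a :: v) (a :: s).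

Section ShuffleProduct.
Variable T : eqType.
Implicit Types (F G H : seq T -> rat) (s u v : seq T).

Lemma eq_shuffle_prod_shuffle F F' G G' s :
    (forall u v, shuffle u v s -> F u * G v = F' u * G' v) ->
  shuffle_prod F G s = shuffle_prod F' G' s.
Proof.
elim: s F F' G G' => [|c s IH] F F' G G' E /=; first exact: E (shuffle_nil T).
congr (_ + _); apply: IH => u v uvs.
  exact: E (shuffle_left c uvs).
exact: E (shuffle_right c uvs).
Qed.

Lemma eq_shuffle_prod F F' G G' : F =1 F' -> G =1 G' -> shuffle_prod F G =1 shuffle_prod F' G'.
Proof. by move=> eF eG s; apply: eq_shuffle_prod_shuffle => u v _; rewrite eF eG. Qed.

Lemma shuffle_prodC F G s : shuffle_prod F G s = shuffle_prod G F s.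
Proof.
by elim: s F G => [|c s IH] F G /=; [rewrite mulrC | rewrite addrC !(IH _ G) !(IH F)].
Qed.

Lemma shuffle_prodDl F F' G s :
  shuffle_prod (fun u => F u + F' u) G s = shuffle_prod F G s + shuffle_prod F' G s.
Proof.
elim: s F F' G => [|c s IH] F F' G /=; first by rewrite mulrDl.
by rewrite !IH addrACA.
Qed.

Lemma shuffle_prodZl a F G s : shuffle_prod (fun u => a * F u) G s = a * shuffle_prod F G s.
Proof.
by elim: s F G => [|c s IH] F G /=; [rewrite mulrA | rewrite !IH mulrDr].
Qed.

Lemma shuffle_prod0l G s : shuffle_prod (fun=> 0) G s = 0.
Proof. by elim: s G => [|c s IH] G /=; rewrite ?mul0r // !IH addr0. Qed.

Lemma shuffle_prod_suml I (r : seq I) (a : I -> rat) (F : I -> seq T -> rat) G s :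
  shuffle_prod (fun u => \sum_(i <- r) a i * F i u) G s
    = \sum_(i <- r) a i * shuffle_prod (F i) G s.
Proof.
elim: r => [|i r IH].
  by rewrite big_nil -[RHS](shuffle_prod0l G s); apply: eq_shuffle_prod => // u;
    rewrite big_nil.
rewrite big_cons -IH -shuffle_prodZl -shuffle_prodDl.
by apply: eq_shuffle_prod => // u; rewrite big_cons.
Qed.

Lemma shuffle_prodA F G H s : shuffle_prod F (shuffle_prod G H) s
  = shuffle_prod (shuffle_prod F G) H s.
Proof.
elim: s F G H => [|c s IH] F G H /=; first by rewrite mulrA.
rewrite IH shuffle_prodDl -addrA; congr (_ + _).
by rewrite shuffle_prodC shuffle_prodDl; congr (_ + _); rewrite shuffle_prodC IH.
Qed.

Lemma shuffle_prod_unitl G s : shuffle_prod (fun u => (u == [::])%:R) G s = G s.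
Proof.
elim: s G => [|c s IH] G /=; first by rewrite mul1r.
by rewrite IH shuffle_prod0l add0r.
Qed.

Lemma shuffle_prod_support F G s : shuffle_prod F G s != 0 ->
  exists u v, [/\ shuffle u v s, F u != 0 & G v != 0].
Proof.
elim: s F G => [|c s IH] F G /= nz.
  exists [::], [::]; split; first exact: shuffle_nil.
    by apply: contraNneq nz => ->; rewrite mul0r.
  by apply: contraNneq nz => ->; rewrite mulr0.
have [z|/IH[u [v [uv Fu Gv]]]] := eqVneq (shuffle_prod (fun u => F (c :: u)) G s) 0.
  move: nz; rewrite z add0r => /IH[u [v [uv Fu Gv]]].
  by exists u, (c :: v); split=> //; apply: shuffle_right.
by exists (c :: u), v; split=> //; apply: shuffle_left.
Qed.

Lemma shuffle_prod_ge0 F G s :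
  (forall u, 0 <= F u) -> (forall v, 0 <= G v) -> 0 <= shuffle_prod F G s.
Proof.
elim: s F G => [|c s IH] F G F0 G0 /=; first exact: mulr_ge0.
by rewrite addr_ge0 // IH.
Qed.

Lemma shuffle_prod_gt0 F G u v s : (forall u, 0 <= F u) -> (forall v, 0 <= G v) ->
  shuffle u v s -> 0 < F u -> 0 < G v -> 0 < shuffle_prod F G s.
Proof.
move=> F0 G0 uvs; elim: uvs F G F0 G0 => {u v s} [|a u v s _ IH|a u v s _ IH] F G F0 G0 Fu Gv
  /=.
- exact: mulr_gt0.
- by rewrite ltr_wpDr ?shuffle_prod_ge0 // IH.
- by rewrite ltr_wpDl ?shuffle_prod_ge0 // IH.
Qed.

Lemma shuffle_size u v s : shuffle u v s -> size s = (size u + size v)%N.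
Proof. by elim=> //= {u v s} a u v s _ ->; rewrite ?addnS. Qed.

Lemma shuffle_sym u v s : shuffle u v s -> shuffle v u s.
Proof. by elim=> *; constructor. Qed.

Lemma shuffle_subseql u v s : shuffle u v s -> subseq u s.
Proof.
elim=> //= {u v s} a u v s _ us; first by rewrite eqxx.
by case: u us => // b u us; case: eqP => // _; apply: cons_subseq us.
Qed.

Lemma shuffle_subseqr u v s : shuffle u v s -> subseq v s.
Proof. by move/shuffle_sym/shuffle_subseql. Qed.

Lemma shuffle0s v s : shuffle [::] v s -> s = v.
Proof.
move E: [::] => u uvs; elim: uvs E => {u v s} // a u v s _ IH E.
by rewrite IH.
Qed.

Lemma shuffle0 s : shuffle [::] s s.
Proof. by elim: s => [|a s IH]; constructor. Qed.

Lemma shuffle_cat_prefix w u v s : shuffle u v s -> shuffle (w ++ u) v (w ++ s).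
Proof. by move=> uvs; elim: w => //= a w IH; constructor. Qed.

Lemma shuffle_cat u v : shuffle u v (u ++ v).
Proof. by rewrite -[X in shuffle X](cats0 u); apply/shuffle_cat_prefix/shuffle0. Qed.

Lemma shuffle_consl_split a u v s : shuffle (a :: u) v s ->
  exists v1 v2 z, [/\ v = v1 ++ v2, s = v1 ++ a :: z & shuffle u v2 z].
Proof.
move E: (a :: u) => w wvs; elim: wvs E => {w v s} // [b w v s h _ [-> ->]|b w v s h IH /IH].
  by exists [::], v, s.
by move=> [v1 [v2 [z [-> -> hz]]]]; exists (b :: v1), v2, z.
Qed.

Lemma shuffle_consl_inv a u v x : shuffle (a :: u) v x ->
  (exists2 s, x = a :: s & shuffle u v s) \/
  (exists b v' s, [/\ v = b :: v', x = b :: s & shuffle (a :: u) v' s]).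
Proof.
move E: (a :: u) => w h; case: h E => {w v x} // b w v s h E.
  by case: E h => -> -> h; left; exists s.
by right; exists b, v, s.
Qed.

End ShuffleProduct.

(** * Largest shuffles and Lyndon words *)

Section Lyndon.
Context {d : Order.disp_t} {T : orderType d}.
Local Notation W := (seqlexi T).
Local Notation "u <=w v" := (@Order.le _ W u v) (at level 70, v at next level).
Local Notation "u <w v" := (@Order.lt _ W u v) (at level 70, v at next level).
Implicit Types (l s u v w x y : W) (ll : seq W).

Lemma lexi_cat2l w u v : ((w ++ u) <=w (w ++ v)) = (u <=w v).
Proof. by elim: w => //= a w IH; rewrite lexi_cons lexx /=. Qed.

Lemma lexi_prefix u v : (u <=w (u ++ v)).
Proof. by rewrite -[X in (X <=w _)]cats0 lexi_cat2l lexi0s. Qed.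

Lemma lexi_lt_letter (a b : T) (w u v : seq T) : (a < b)%O ->
  ((w ++ a :: u) <w (w ++ b :: v)).
Proof.
move=> ab; rewrite lt_neqAle lexi_cat2l lexi_cons (ltW ab) leNgt ab /= andbT.
apply/eqP => /(congr1 (drop (size w))); rewrite !drop_size_cat // => -[e _].
by rewrite e ltxx in ab.
Qed.

Lemma lexi_split v1 v2 u : ((v1 ++ v2) <=w u) ->
  (exists2 u2 : W, u = (v1 ++ u2) & (v2 <=w u2)) \/
  (exists c (a b : T) v' u', [/\ v1 = (c ++ a :: v'),
      u = (c ++ b :: u') & (a < b)%O]).
Proof.
elim: v1 u => [|a v1 IH] [|b u] /=.
- by left; exists [::].
- by left; exists (b :: u).
- by rewrite lexis0.
rewrite lexi_cons; case: (ltgtP a b) => //= [ab _|-> /IH[[u2 -> le2]|]].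
- by right; exists [::], a, b, v1, u.
- by left; exists u2.
move=> [c [x [y [v' [u' [-> -> xy]]]]]].
by right; exists (b :: c), x, y, v', u'.
Qed.

(** An exchange argument: moving a block from the larger of two words to the
    smaller one can only improve the largest shuffle.  When [x] reads a prefix of
    [v] before it reads the first letter of the block, the same prefix can be read
    from [u] instead, unless [u] offers a larger letter at once. *)
Lemma shuffle_shift (q u v x : W) : (v <=w u) -> shuffle (q ++ u) v x ->
  exists2 y : W, shuffle u (q ++ v) y & (x <=w y).
Proof.
have [n] := ubnP (size x); elim: n q u v x => // n IH [|a q] u v x.
  by move=> _ _ h; exists x.
move=> xn vu; rewrite cat_cons => /shuffle_consl_split[v1 [v2 [z [def_v def_x hz]]]].
rewrite def_v in vu; case: (lexi_split vu) => [[u2 def_u le2]|].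
  have zn : (size z < n)%N.
    by move: xn; rewrite def_x size_cat /= addnS ltnS; apply: leq_ltn_trans; rewrite leq_addl.
  rewrite def_u catA in hz; have [y hy zy] := IH _ _ _ _ zn le2 hz.
  exists (v1 ++ a :: y); last by rewrite def_x lexi_cat2l lexi_cons lexx.
  rewrite def_u def_v cat_cons catA; apply: shuffle_cat_prefix; exact: shuffle_right.
move=> [c [e [b [v' [u' [def_v1 def_u eb]]]]]].
exists (u ++ (a :: q) ++ v); first exact: shuffle_cat.
by rewrite def_x def_u def_v1 -!catA; apply/ltW/lexi_lt_letter.
Qed.

(** Merging greedily is optimal: as long as the rest of [u] is at least [v],
    reading from [u] is the best choice, so the largest shuffle exhausts [u]
    first. *)
Lemma shuffle_le_cat (u v x : W) :
    (forall p s : W, u = (p ++ s) -> s != [::] -> (v <=w s)) ->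
  shuffle u v x -> (x <=w (u ++ v)).
Proof.
elim: u v x => [|a u IH] v x le_suf; first by move/shuffle0s->.
move=> h; have [y hy xy] : exists2 y : W, shuffle u v y & (x <=w (a :: y)).
  have vau : (v <=w (a :: u)) by apply: (le_suf [::]).
  case: (shuffle_consl_inv h) => [[s -> hs]|[b [v' [s [def_v -> hs]]]]].
    by exists s; rewrite ?lexx.
  move: vau; rewrite def_v lexi_cons; case: (ltgtP b a) => //= [ba _|ba vu].
    exists (u ++ (b :: v')); first exact: shuffle_cat.
    by rewrite lexi_cons (ltW ba) leNgt ba.
  rewrite ba in hs *; have [y hy sy] : exists2 y : W, shuffle u ([:: a] ++ v') y & (s <=w y).
    exact: (@shuffle_shift [:: a] u v' s vu hs).
  by exists y; rewrite ?lexi_cons ?lexx.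
apply: le_trans xy _; rewrite /= lexi_cons lexx /=.
by apply: IH => // p s def_u; apply: (le_suf (a :: p)); rewrite def_u.
Qed.

Lemma shuffle_mono (y y' v x : W) : size y = size y' -> (y <=w y') ->
  shuffle y v x -> exists2 x' : W, shuffle y' v x' & (x <=w x').
Proof.
move=> sz le h; elim: h y' sz le => {y v x} [|a u v s _ IH|a u v s _ IH] y' sz le.
- by exists [::]; move: sz; case: y' le => // _ _; constructor.
- case: y' sz le => // b y' [sz]; rewrite lexi_cons; case: (ltgtP a b) => //= [ab _|<- le].
    exists (b :: (y' ++ v)); first by apply/shuffle_left/shuffle_cat.
    by rewrite lexi_cons (ltW ab) leNgt ab.
  have [x' h' le'] := IH _ sz le.
  by exists (a :: x'); rewrite ?lexi_cons ?lexx //; constructor.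
- have [x' h' le'] := IH _ sz le.
  by exists (a :: x'); rewrite ?lexi_cons ?lexx //; constructor.
Qed.

Definition lyndon (l : W) : bool :=
  (l != [::]) && all (fun i => (l <=w (drop i l))) (iota 0 (size l)).

Lemma lyndonP l : reflect
  (l != [::] /\ forall p s : W, l = (p ++ s) -> s != [::] -> (l <=w s))
  (lyndon l).
Proof.
apply: (iffP andP) => -[l0 le_suf]; split=> //.
  move=> p s def_l s0; have /allP/(_ (size p)) := le_suf.
  rewrite mem_iota leq0n add0n {1}def_l size_cat -{1}[size p]addn0 ltn_add2l lt0n size_eq0 s0.
  by move=> /(_ isT); rewrite {2}def_l drop_size_cat.
apply/allP => i; rewrite mem_iota add0n => /= il.
apply: (le_suf (take i l)); first by rewrite cat_take_drop.
by rewrite -size_eq0 size_drop subn_eq0 -ltnNge.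
Qed.

(** Factors are listed from the last to the first, so that the decreasing
    factorizations of a word into Lyndon words are the nondecreasing lists. *)
Fixpoint lcat (ll : seq W) : W := if ll is l :: ll' then (lcat ll' ++ l) else [::].

Definition lyndon_seq ll := all lyndon ll && sorted <=%O ll.

Lemma cat_eq_cat (S : Type) (a b p s : seq S) : (a ++ b) = (p ++ s) ->
  (exists2 t, s = (t ++ b) & a = (p ++ t)) \/
  (exists2 t, p = (a ++ t) & b = (t ++ s)).
Proof.
elim: a p => [|x a IH] [|y p] /=.
- by move=> ->; left; exists [::].
- by move=> ->; right; exists (y :: p).
- by move=> <-; left; exists (x :: a).
case=> -> /IH[[t -> ->]|[t -> ->]]; [left|right]; by exists t.
Qed.

(** This recovers the last factor from the word, whence the uniqueness of the
    factorization. *)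
Lemma lcat_min_suffix l ll (p s : W) : lyndon_seq (l :: ll) ->
  lcat (l :: ll) = (p ++ s) -> s != [::] -> (l <=w s).
Proof.
elim: ll l p s => [|l' ll IH] l p s /andP[/= /andP[lyl lyll] srt].
  by case/lyndonP: lyl => _ h def; apply: h def.
case/cat_eq_cat => [[t -> def_t]|[t _ def_l]] s0; last first.
  by case/lyndonP: lyl => _ h; apply: h def_l s0.
case/andP: srt => ll' srt.
have [t0|t0] := eqVneq t [::]; first by rewrite t0.
apply: le_trans ll' (le_trans _ (lexi_prefix _ _)).
by apply: (IH l' p t) => //; rewrite /lyndon_seq /= lyll.
Qed.

Lemma lcat_inj ll ll' : lyndon_seq ll -> lyndon_seq ll' ->
  lcat ll = lcat ll' -> ll = ll'.
Proof.
have nz l lr : lyndon_seq (l :: lr) -> l != [::].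
  by case/andP => /andP[/lyndonP[]].
elim: ll ll' => [|l ll IH] [|l' ll'] //.
- by move=> _ /nz; case: l' => // a l' _ /= /(congr1 size); rewrite size_cat addnS.
- by move=> /nz; case: l => // a l _ _ /= /(congr1 size); rewrite size_cat addnS.
move=> h h' E.
have el : l = l'.
  apply: le_anti; rewrite (lcat_min_suffix h E) ?(nz _ _ h') //=.
  by rewrite (lcat_min_suffix h' (esym E)) ?(nz _ _ h).
rewrite -el; congr (_ :: _); apply: IH.
- by case/andP: h => /= /andP[_ a] /path_sorted b; rewrite /lyndon_seq a.
- by case/andP: h' => /= /andP[_ a] /path_sorted b; rewrite /lyndon_seq a.
move: E => /= E; have := E; rewrite -el => /eqP; rewrite eqseq_cat.
  by rewrite eqxx andbT => /eqP.
by move: E => /(congr1 size); rewrite -el !size_cat => /addIn.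
Qed.

Lemma min_suffix_exists (c : W) : c != [::] -> exists p s : W,
  [/\ c = (p ++ s), s != [::] &
      forall p' s' : W, c = (p' ++ s') -> s' != [::] -> (s <=w s')].
Proof.
elim: c => // a c IH _; have [->|/IH[p [s [def_c s0 min_s]]]] := eqVneq c [::].
  exists [::], [:: a]; split=> // p s; case: p => [|b p]; first by rewrite cat0s => <-.
  by rewrite cat_cons => -[_]; case: p => //; rewrite cat0s => <-.
case: (leP s (a :: c)) => le_s.
  exists (a :: p), s; split=> //; first by rewrite def_c.
  move=> p' s'; case: p' => [|b p']; first by rewrite cat0s => <-.
  by rewrite cat_cons => -[_ /min_s].
exists [::], (a :: c); split=> // p' s'; case: p' => [|b p'].
  by rewrite cat0s => <-.
by rewrite cat_cons => -[_ /min_s h] /h h'; apply: le_trans (ltW le_s) h'.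
Qed.

(** Split off the smallest nonempty suffix.  It is a Lyndon word because its
    suffixes are suffixes of the whole word, and by its minimality the factor
    before it is not smaller. *)
Lemma lyndon_factorization (c : W) : exists2 ll, lyndon_seq ll & lcat ll = c.
Proof.
have [n] := ubnP (size c); elim: n c => // n IH c.
have [-> _|c0 cn] := eqVneq c [::]; first by exists [::].
have [p [s [def_c s0 min_s]]] := min_suffix_exists c0.
have pn : (size p < n)%N.
  move: cn; rewrite def_c size_cat ltnS; apply: leq_trans.
  by rewrite -[X in (X < _)%N]addn0 ltn_add2l lt0n size_eq0.
have [ll good_ll def_p] := IH _ pn.
exists (s :: ll); last by rewrite /= def_p.
have lys : lyndon s.
  apply/lyndonP; split=> // p' s' def_s s'0.
  by apply: (min_s (p ++ p')) => //; rewrite def_c def_s catA.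
move: good_ll; rewrite /lyndon_seq /= lys.
case: ll def_p => // l' ll def_p /= /andP[/andP[lyl' ->]] ->; rewrite lyl' !andbT /=.
rewrite leNgt; apply/negP => l's.
have sl's : (s <=w (l' ++ s)).
  apply: (min_s (lcat ll)); first by rewrite def_c -def_p /= catA.
  by rewrite -size_eq0 size_cat addn_eq0 negb_and !size_eq0 s0 orbT.
have := ltW l's; rewrite -{1}[l']cats0.
case/lexi_split => [[z def_s _]|[e [a [b [v' [u' [def_l' def_s ab]]]]]]].
  have z0 : z != [::].
    by apply: contraTneq l's => z0; rewrite def_s z0 cats0 ltxx.
  have sz : (s <=w z).
    by apply: (min_s (p ++ l')) => //; rewrite def_c def_s catA.
  have l0 : (0 < size l')%N.
    by rewrite lt0n size_eq0; case/lyndonP: lyl'.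
  have e : s = (l' ++ s).
    by apply: le_anti; rewrite sl's {2}def_s lexi_cat2l sz.
  by move/(congr1 size): e; rewrite size_cat; lia.
have : ((l' ++ s) <w s) by rewrite def_l' {2}def_s -catA; apply: lexi_lt_letter.
by rewrite ltNge sl's.
Qed.

Definition dirac (l s : W) : rat := (s == l)%:R.

Definition lyndon_prod ll : W -> rat :=
  foldr (fun l F => shuffle_prod F (dirac l)) (dirac [::]) ll.

Lemma dirac_ge0 l s : 0 <= dirac l s.
Proof. exact: ler0n. Qed.

Lemma lyndon_prod_ge0 ll s : 0 <= lyndon_prod ll s.
Proof.
elim: ll s => [|l ll IH] s; first exact: dirac_ge0.
by apply: shuffle_prod_ge0 => // v; apply: dirac_ge0.
Qed.

Lemma lyndon_prod_lcat_gt0 ll : 0 < lyndon_prod ll (lcat ll).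
Proof.
elim: ll => [|l ll IH] /=; first by rewrite /dirac eqxx.
apply: shuffle_prod_gt0 IH _; [exact: lyndon_prod_ge0|exact: dirac_ge0|exact: shuffle_cat|].
by rewrite /dirac eqxx.
Qed.

Lemma lyndon_prod_size ll s : lyndon_prod ll s != 0 -> size s = size (lcat ll).
Proof.
elim: ll s => [|l ll IH] s /=.
  by rewrite /dirac; case: (eqVneq s [::]) => // ->.
case/shuffle_prod_support => u [v [uv /IH su]]; rewrite /dirac.
case: (eqVneq v l) uv => // -> uv _.
by rewrite size_cat -su; apply: shuffle_size uv.
Qed.

(** Radford's triangularity.  The smallest factor [l] is shuffled in last; it is
    at most every suffix of the product of the larger factors, so the greedy
    merge puts it at the end. *)
Lemma lyndon_prod_le_lcat ll s : lyndon_seq ll -> lyndon_prod ll s != 0 -> (s <=w lcat ll).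
Proof.
elim: ll s => [|l ll IH] s good /=.
  by rewrite /dirac; case: (eqVneq s [::]) => // ->.
have good' : lyndon_seq ll.
  by case/andP: good => /= /andP[_ a] /path_sorted b; rewrite /lyndon_seq a.
case/shuffle_prod_support => u [v [uv nzu]]; rewrite /dirac.
case: (eqVneq v l) uv => // -> uv _.
have [x' h' sx'] := shuffle_mono (lyndon_prod_size nzu) (IH _ good' nzu) uv.
apply: le_trans sx' _; apply: shuffle_le_cat h' => p t def_t t0.
case: ll good {IH good' nzu} def_t => [|l' ll] good def_t.
  by move: t0; case: p def_t => //; rewrite cat0s => <-.
have good' : lyndon_seq (l' :: ll).
  by case/andP: good => /= /andP[_ a] /andP[_ b]; rewrite /lyndon_seq /= b a.
have ll' : (l <=w l') by case/andP: good => _ /= /andP[].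
exact: le_trans ll' (lcat_min_suffix good' def_t t0).
Qed.

Lemma lyndon_prod_cat ll ll' : lyndon_prod (ll ++ ll') =1 shuffle_prod (lyndon_prod ll)
  (lyndon_prod ll').
Proof.
elim: ll => [|l ll IH] s /=; first by rewrite shuffle_prod_unitl.
rewrite (eq_shuffle_prod (F' := shuffle_prod (lyndon_prod ll) (lyndon_prod ll')) (G' :=
  dirac l)) //.
by rewrite -!shuffle_prodA; apply: eq_shuffle_prod => // u; rewrite shuffle_prodC.
Qed.

Lemma lyndon_prod_perm ll ll' : perm_eq ll ll' -> lyndon_prod ll =1 lyndon_prod ll'.
Proof.
move=> perm s; apply: (catCA_perm_subst (F := lyndon_prod ^~ s)) perm => m1 m2 l3.
have cat3 (u1 u2 : seq W) : lyndon_prod (u1 ++ u2 ++ l3) s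
    = shuffle_prod (shuffle_prod (lyndon_prod u1) (lyndon_prod u2)) (lyndon_prod l3) s.
  by rewrite lyndon_prod_cat -shuffle_prodA; apply: eq_shuffle_prod => // v;
    apply: lyndon_prod_cat.
by rewrite !cat3; apply: eq_shuffle_prod => // v; apply: shuffle_prodC.
Qed.

Lemma lyndon_prod1 l : lyndon_prod [:: l] =1 dirac l.
Proof. exact: shuffle_prod_unitl. Qed.

End Lyndon.

(** * Counting Lyndon words *)

Section Words.
Variable T : eqType.

Fixpoint words (A : seq T) (n : nat) : seq (seq T) :=
  if n is m.+1 then [seq a :: w | a <- A, w <- words A m] else [:: [::]].

Lemma mem_words A n w : (w \in words A n) = (size w == n) && all (mem A) w.
Proof.
elim: n w => [|n IH] [|a w] //=.
  by apply/negbTE/allpairsP => -[[x y] /= [_ _]].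
rewrite eqSS; apply/allpairsP/idP => [[[x y] /= [xA]]|/and3P[sw aA wA]].
  by rewrite IH => /andP[sy yA] [-> ->]; rewrite sy xA.
by exists (a, w); rewrite IH sw.
Qed.

Lemma words_uniq A n : uniq A -> uniq (words A n).
Proof.
move=> uA; elim: n => //= n IH; apply: allpairs_uniq => //.
by move=> [x y] [x' y'] _ _ /= [-> ->].
Qed.

Lemma size_words A n : size (words A n) = (size A ^ n)%N.
Proof. by elim: n => //= n IH; rewrite size_allpairs IH expnS. Qed.

Definition wpow (l : seq T) (e : nat) : seq T := iter e (cat l) [::].

Lemma size_wpow l e : size (wpow l e) = (e * size l)%N.
Proof. by elim: e => //= e IH; rewrite size_cat IH mulSn. Qed.

Lemma wpowD l e f : wpow l (e + f) = wpow l e ++ wpow l f.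
Proof. by elim: e => //= e IH; rewrite IH catA. Qed.

Lemma wpowSr l e : wpow l e.+1 = wpow l e ++ l.
Proof. by rewrite -addn1 wpowD /= cats0. Qed.

Lemma wpow_split l e p s : wpow l e = p ++ s -> (0 < e)%N ->
  exists q f l1 l2, [/\ l = l1 ++ l2, p = wpow l q ++ l1, s = l2 ++ wpow l f
                      & e = (q + f).+1].
Proof.
elim: e p => // e IH p E _.
have {E} : l ++ wpow l e = p ++ s by [].
case/cat_eq_cat => [[t def_s def_l]|[t def_p def_t]].
  by exists 0, e, p, t.
case: e IH def_t => [|e] IH def_t.
  move/(congr1 size): def_t; rewrite size_cat /= => /esym/eqP.
  rewrite addn_eq0 !size_eq0 => /andP[/eqP t0 /eqP ->].
  by exists 0, 0, l, [::]; rewrite def_p t0 !cats0.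
have [q [f [l1 [l2 [def_l def_t' def_s ->]]]]] := IH _ def_t isT.
exists q.+1, f, l1, l2; split=> //.
by rewrite def_p def_t' -[wpow l q.+1]/(l ++ wpow l q) catA.
Qed.

End Words.

Section LyndonCount.
Context {d : Order.disp_t} {T : orderType d}.
Local Notation W := (seqlexi T).
Local Notation "u <=w v" := (@Order.le _ W u v) (at level 70, v at next level).
Local Notation "u <w v" := (@Order.lt _ W u v) (at level 70, v at next level).
Implicit Types (l s u v w x y : W) (ll : seq W).

(** A proper suffix is too short to have a Lyndon word as a prefix, so the
    inequality is decided by a letter and survives any continuation. *)
Lemma lyndon_suffix_lt l (p s u v : W) : lyndon l -> l = p ++ s ->
  p != [::] -> s != [::] -> (l ++ u) <w (s ++ v).
Proof.
move=> /lyndonP[_ min_l] def_l p0 s0.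
have := min_l _ _ def_l s0; rewrite -{1}[l]cats0.
case/lexi_split => [[t /(congr1 size)]|[c [a [b [v' [u' [-> -> ab]]]]]]].
  have p1 : (0 < size p)%N by rewrite lt0n size_eq0.
  by move=> e _; exfalso; have := congr1 size def_l; rewrite size_cat e size_cat; lia.
by rewrite -!catA; apply: lexi_lt_letter.
Qed.

Lemma wpow_le_rot l e (p s : W) : lyndon l -> wpow l e = p ++ s ->
  (wpow l e) <=w (s ++ p).
Proof.
move=> lyl; case: e => [|e] E.
  by case: p E => // <-.
have [q [f [l1 [l2 [def_l def_p def_s [ef]]]]]] := wpow_split E (ltn0Sn e).
have [l10|l10] := eqVneq l1 [::].
  have l2l : l2 = l by rewrite def_l l10.
  by rewrite def_s def_p l2l l10 cats0 -catA -wpowD addnC -ef lexx.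
have [l20|l20] := eqVneq l2 [::].
  have l1l : l1 = l by rewrite def_l l20 cats0.
  by rewrite def_s def_p l20 cat0s l1l -wpowSr -wpowD addnS addnC -ef lexx.
rewrite def_s -catA; exact/ltW/(lyndon_suffix_lt _ _ lyl def_l).
Qed.

Lemma wpow_lt_rot l e r : lyndon l -> (0 < r < size l)%N -> (0 < e)%N ->
  (wpow l e) <w (rot r (wpow l e)).
Proof.
move=> lyl /andP[r0 rl]; case: e => // e _ /=.
rewrite /rot drop_cat rl -catA.
apply: (lyndon_suffix_lt _ _ lyl (p := take r l)); rewrite ?cat_take_drop //.
  by rewrite -size_eq0 size_take rl -lt0n.
by rewrite -size_eq0 size_drop subn_eq0 -ltnNge.
Qed.

Lemma wpow_le_rotn l e j : lyndon l -> (wpow l e) <=w (rot j (wpow l e)).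
Proof. by move=> lyl; apply: wpow_le_rot; rewrite // cat_take_drop. Qed.

Lemma lcat_nseq e l : lcat (nseq e l) = wpow l e.
Proof. by elim: e => [//|e IH]; rewrite wpowSr /= IH. Qed.

Lemma lyndon_seq_nseq e l : lyndon l -> lyndon_seq (nseq e l).
Proof.
move=> lyl; rewrite /lyndon_seq all_nseq lyl orbT /=.
by case: e => //= e; elim: e => //= e ->; rewrite lexx.
Qed.

Lemma rot_wpow_inj l l' e e' r r' : lyndon l -> lyndon l' ->
    (0 < e)%N -> (0 < e')%N -> (r < size l)%N -> (r' < size l')%N ->
  rot r (wpow l e) = rot r' (wpow l' e') -> l = l' /\ r = r'.
Proof.
move=> lyl lyl' e0 e0' rl rl' E.
have powE : wpow l e = wpow l' e'.
  apply: (@le_anti _ W); apply/andP; split.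
    have -> : wpow l' e' = rotr r' (rot r (wpow l e)) by rewrite E rotK.
    by rewrite /rotr rot_rot_add wpow_le_rotn.
  have -> : wpow l e = rotr r (rot r' (wpow l' e')) by rewrite -E rotK.
  by rewrite /rotr rot_rot_add wpow_le_rotn.
have ll' : l = l'.
  have := lcat_inj (lyndon_seq_nseq e lyl) (lyndon_seq_nseq e' lyl').
  rewrite !lcat_nseq => /(_ powE); move: e0 e0'.
  by case: (e) (e') => [|m] [|m'] //= _ _ [].
split=> //; subst l'; rewrite -powE in E.
have lt_rot i j : (i < j)%N -> (j < size l)%N -> rot i (wpow l e) <> rot j (wpow l e).
  move=> ij jl; rewrite -[j](subnKC (ltnW ij)) rotD; last first.
    rewrite (subnKC (ltnW ij)) size_wpow; apply: leq_trans (ltnW jl) _.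
    exact: leq_pmull.
  move/rot_inj => E'; have := @wpow_lt_rot l e (j - i) lyl.
  by rewrite -E' ltxx subn_gt0 ij e0 (leq_ltn_trans (leq_subr _ _) jl) => /(_ isT isT).
by case: (ltngtP r r') => // h; [case: (lt_rot _ _ h rl')|case: (lt_rot _ _ h rl)].
Qed.

Lemma lcat_last l ll : lcat (l :: ll) = last l ll ++ lcat (belast l ll).
Proof.
elim: ll l => [|x ll IH] l; first by rewrite /= cats0.
have -> : lcat [:: l, x & ll] = lcat (x :: ll) ++ l by [].
by rewrite IH -catA.
Qed.

Lemma path_le_last l ll x : path <=%O l ll -> x \in l :: ll -> x <=w last l ll.
Proof.
elim: ll l x => [|y ll IH] l x /=; first by rewrite inE => _ /eqP ->.
case/andP => ly yll; rewrite inE => /orP[/eqP ->|xl]; last exact: IH.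
by apply: le_trans ly (IH _ _ yll (mem_head _ _)).
Qed.

(** If a word is minimal among its rotations, its Lyndon factors coincide:
    otherwise moving the last and smallest factor to the front would give a
    smaller rotation. *)
Lemma min_rot_wpow w : w != [::] -> (forall j, w <=w (rot j w)) ->
  exists l e, [/\ lyndon l, (0 < e)%N & w = wpow l e].
Proof.
move=> w0 min_w; have [[|l ll] good def_w] := lyndon_factorization w.
  by rewrite -def_w in w0.
have lyl : lyndon l by case/andP: good => /andP[].
have pth : path <=%O l ll by case/andP: good.
have lyL : lyndon (last l ll).
  by case/andP: good => /allP /(_ _ (mem_last _ _)).
(* It suffices that the smallest and the largest factor agree. *)
suff eL : last l ll = l.
  exists l, (size ll).+1; split=> //; rewrite -def_w.
  have -> : l :: ll = nseq (size ll).+1 l.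
    apply/all_pred1P/allP => x xl /=; rewrite eq_le -{1}eL path_le_last //.
    by move: xl; rewrite inE => /orP[/eqP ->|];
      [rewrite lexx|apply/allP/order_path_min/pth/le_trans].
  by rewrite lcat_nseq.
have lw : l <=w w.
  by apply: (lcat_min_suffix (p := [::]) good); rewrite ?def_w.
have wrot : w <=w (l ++ lcat ll).
  have := min_w (size (lcat ll)); rewrite -{2}def_w /= rot_size_cat; exact.
have [z def_wz] : exists z, w = l ++ z.
  have := lw; rewrite -{1}[l]cats0; case/lexi_split => [[z -> _]|]; first by exists z.
  move=> [c [a [b [v' [u' [def_l def_w' ab]]]]]].
  move: wrot; rewrite leNgt def_l def_w' -catA => /negP[].
  exact: lexi_lt_letter.
case: ll good def_w pth lyL wrot => [//|x ll] good def_w pth lyL wrot.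
have wL := lcat_last l (x :: ll); rewrite def_w in wL.
have goodx : lyndon_seq (x :: ll).
  by case/andP: good => /= /andP[_ a] /andP[_ b]; rewrite /lyndon_seq /= a b.
have uL := lcat_last x ll.
have eqlast : last l (x :: ll) = last x ll by [].
rewrite eqlast in wL lyL *; set L := last x ll in wL lyL uL *.
apply: le_anti; apply/andP; split; last first.
  by rewrite /L -eqlast path_le_last ?mem_head.
case: (leqP (size L) (size l)) => sz.
  have -> : L = take (size L) l.
    move: def_wz; rewrite wL => /(congr1 (take (size L))).
    by rewrite take_size_cat // takel_cat.
  by rewrite -{2}[l](cat_take_drop (size L)) lexi_prefix.
have def_L : L = l ++ drop (size l) L.
  move: def_wz; rewrite wL => /(congr1 (take (size l))).
  by rewrite (take_size_cat z erefl) takel_cat ?(ltnW sz) // => {1}<-; rewrite cat_take_drop.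
(* A longer first factor [L] would extend [l] by a suffix larger than [L],
   making the rotation smaller. *)
have dl0 : drop (size l) L != [::] by rewrite -size_eq0 size_drop subn_eq0 -ltnNge.
have l0 : l != [::] by case/lyndonP: lyl.
have := lyndon_suffix_lt (lcat (belast x ll)) (lcat (belast l (x :: ll))) lyL def_L l0 dl0.
by rewrite -uL ltNge -(lexi_cat2l l) catA -def_L -wL wrot.
Qed.

Lemma word_rot_wpow w : w != [::] ->
  exists l e r, [/\ lyndon l, (0 < e)%N, (r < size l)%N & w = rot r (wpow l e)].
Proof.
move=> w0; have sw : (0 < size w)%N by rewrite lt0n size_eq0.
pose f (i : 'I_(size w)) : W := rot i w.
have [j _ min_j] := arg_minP f (P := xpredT) (i0 := Ordinal sw) isT.
have {min_j} min_j i : (rot j w) <=w (rot i w).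
  case: (ltnP i (size w)) => iw; first exact: (min_j (Ordinal iw)).
  by rewrite (rot_oversize iw) -[X in _ <=w X]rot0; apply: (min_j (Ordinal sw)).
have [||l [e [lyl e0 def_w]]] := @min_rot_wpow (rot j w).
- by rewrite -size_eq0 size_rot -lt0n.
- by move=> i; rewrite rot_rot_add.
have l0 : (0 < size l)%N by rewrite lt0n size_eq0; case/lyndonP: lyl.
have sz : (e * size l)%N = size w by rewrite -size_wpow -def_w size_rot.
have [r rsz def_w'] : exists2 r, (r <= size w)%N & w = rot r (wpow l e).
  exists (size w - j)%N; first exact: leq_subr.
  by rewrite -def_w -{1}(rotK j w) /rotr size_rot.
exists l, e, (r %% size l)%N; split=> //; first by rewrite ltn_mod.
set t := (r %% size l)%N; have r_eq := divn_eq r (size l).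
set q := (r %/ size l)%N in r_eq; rewrite -/t addnC in r_eq.
have qe : (q <= e)%N.
  rewrite -(leq_pmul2r l0) sz; apply: leq_trans rsz; rewrite r_eq; exact: leq_addl.
rewrite def_w' r_eq rotD; last by rewrite -r_eq size_wpow sz.
by congr (rot _ _); rewrite -(subnKC qe) wpowD -size_wpow rot_size_cat -!wpowD addnC.
Qed.

Definition lyndon_words (A : seq T) n : seq W := [seq w <- words A n | lyndon w].

Lemma mem_lyndon_words A n l :
  (l \in lyndon_words A n) = [&& lyndon l, size l == n & all (mem A) l].
Proof. by rewrite mem_filter mem_words. Qed.

Lemma all_wpow (a : pred T) l e : (0 < e)%N -> all a (wpow l e) = all a l.
Proof.
case: e => // e _; rewrite all_cat; case al : (all a l) => //=.
by elim: e => //= e IH; rewrite all_cat al.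
Qed.

Lemma all_rot (a : pred T) r w : all a (rot r w) = all a w.
Proof. exact/eq_all_r/mem_rot. Qed.

(** Each word is in a unique way the rotation by some [r < m] of a power of a
    Lyndon word of length [m]. *)
Lemma sum_lyndon_words (A : seq T) n : uniq A -> (0 < n)%N ->
  (\sum_(m <- divisors n) m * size (lyndon_words A m))%N = (size A ^ n)%N.
Proof.
move=> uA n0.
pose E : seq W := [seq rot p.2 (wpow p.1 (n %/ m)) | m <- divisors n,
            p <- [seq (l, r) | l <- lyndon_words A m, r <- iota 0 m]].
have div_gt0 m : m \in divisors n -> (0 < m)%N /\ (0 < n %/ m)%N.
  rewrite -dvdn_divisors // => mn; have m0 := dvdn_gt0 n0 mn.
  by split; rewrite // divn_gt0 // dvdn_leq.
have memP m l r : (l, r) \in [seq (l, r) | l <- lyndon_words A m, r <- iota 0 m] ->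
    [/\ lyndon l, size l = m, all (mem A) l & (r < m)%N].
  move/allpairsP => [[x y] /= [lx ry [-> ->]]].
  by move: lx ry; rewrite mem_lyndon_words mem_iota => /and3P[-> /eqP -> ->].
suff perm : perm_eq E (words A n).
  rewrite -size_words -(perm_size perm) size_allpairs_dep sumnE big_map.
  by apply: eq_bigr => m _; rewrite size_allpairs size_iota mulnC.
apply: uniq_perm; last 2 first.
- exact: words_uniq.
- move=> w; rewrite mem_words; apply/idP/idP.
    case/allpairsPdep => m [[l r] [/[dup] mn /div_gt0[m0 e0] /memP[lyl sl Al rm] ->]].
    rewrite size_rot size_wpow sl divnK ?eqxx ?dvdn_divisors // all_rot.
    by rewrite all_wpow.
  case/andP => /eqP sw Aw.
  have [|l [e [r [lyl e0 rl def_w]]]] := @word_rot_wpow w.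
    by rewrite -size_eq0 sw -lt0n.
  have def_n : n = (e * size l)%N by rewrite -sw def_w size_rot size_wpow.
  have l0 : (0 < size l)%N by apply: leq_ltn_trans rl.
  apply/allpairsPdep; exists (size l), (l, r); split.
  - by rewrite -dvdn_divisors // def_n dvdn_mull.
  - apply/allpairsP; exists (l, r); split=> //; last by rewrite mem_iota.
    rewrite mem_lyndon_words lyl eqxx /=.
    by move: Aw; rewrite def_w all_rot all_wpow.
  - by rewrite def_w def_n mulnK.
apply: allpairs_uniq_dep; first exact: divisors_uniq.
  move=> m _; apply: allpairs_uniq; [exact/filter_uniq/words_uniq|exact: iota_uniq|].
  by move=> [x y] [x' y'] _ _ [-> ->].
move=> [m [l r]] [m' [l' r']].
case/allpairsPdep => x [[y z] [xn yz E1]].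
case/allpairsPdep => x' [[y' z'] [xn' yz' E2]].
case: E1 => -> -> ->; case: E2 => -> -> -> /= E3.
have [lyl sl _ rl] := memP _ _ _ yz; have [lyl' sl' _ rl'] := memP _ _ _ yz'.
have [_ e0] := div_gt0 _ xn; have [_ e0'] := div_gt0 _ xn'.
rewrite -sl in rl; rewrite -sl' in rl'.
have [ey ez] := rot_wpow_inj lyl lyl' e0 e0' rl rl' E3.
by rewrite -sl -sl' ey ez.
Qed.

End LyndonCount.

(** * Moebius inversion *)

Lemma moebius_mulp p m : prime p -> (0 < m)%N -> ~~ (p %| m)%N ->
  moebius (p * m) = - moebius m.
Proof.
move=> pp m0 pm; have p0 := prime_gt0 pp.
have perm : perm_eq (primes (p * m)) (p :: primes m).
  apply: uniq_perm; rewrite ?primes_uniq //=.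
    by rewrite primes_uniq andbT mem_primes pp m0.
  by move=> q; rewrite primesM // inE primes_prime // inE.
rewrite /moebius (perm_all _ perm) (perm_size perm) /=.
have -> : (logn p (p * m) == 1)%N.
  by rewrite lognM // logn_prime // eqxx logn_coprime // prime_coprime.
have -> : all (fun q => logn q (p * m) == 1%N) (primes m)
    = all (fun q => logn q m == 1%N) (primes m).
  apply: eq_in_all => q; rewrite mem_primes => /and3P[qp _ qm].
  rewrite lognM // logn_prime //; case: (eqVneq q p) => // eqp.
  by rewrite -eqp qm in pm.
by rewrite andTb; case: ifP => _; rewrite ?oppr0 // exprS mulN1r.
Qed.

(** For a prime divisor [p] of [n], the terms at [m] and [p * m] cancel when [p]
    does not divide [m], and the terms at multiples of [p ^ 2] vanish. *)
Lemma sum_moebius n : (0 < n)%N ->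
  \sum_(m <- divisors n) moebius m = (n == 1%N)%:R.
Proof.
move=> n0; have [->|n1] := eqVneq n 1%N.
  by rewrite (_ : divisors 1 = [:: 1%N]) // big_seq1 /moebius.
have /pdivP[p pp pn] : (1 < n)%N by rewrite ltn_neqAle eq_sym n1.
have p0 := prime_gt0 pp.
have div_gt0 m : m \in divisors n -> (0 < m)%N.
  by rewrite -dvdn_divisors //; apply: dvdn_gt0.
rewrite (bigID (fun m => p %| m)%N) /= addrC; apply/eqP; rewrite addr_eq0; apply/eqP.
rewrite [X in _ = - X](bigID (fun m => p ^ 2 %| m)%N) /=.
rewrite [X in - (X + _)]big_seq_cond [X in - (X + _)]big1 ?add0r; last first.
  move=> m /and3P[/div_gt0 m0 _]; rewrite pfactor_dvdn // => l2.
  rewrite /moebius; case: ifP => // /allP/(_ p).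
  rewrite -logn_gt0 (ltnW l2) => /(_ isT) /eqP l1.
  by rewrite l1 in l2.
transitivity (\sum_(m <- [seq (p * m)%N | m <- divisors n & ~~ (p %| m)%N]) - moebius m).
  rewrite big_map big_filter big_seq_cond [RHS]big_seq_cond.
  apply: eq_bigr => m /andP[/div_gt0 m0 pm].
  by rewrite moebius_mulp // opprK.
rewrite sumrN; congr (- _); rewrite -big_filter.
apply: perm_big; apply: uniq_perm.
- rewrite map_inj_uniq ?filter_uniq ?divisors_uniq //.
  by move=> x y /eqP; rewrite eqn_pmul2l // => /eqP.
- by rewrite filter_uniq ?divisors_uniq.
move=> m; rewrite mem_filter -dvdn_divisors //; apply/mapP/idP.
  case=> d; rewrite mem_filter -dvdn_divisors // => /andP[pd dn] ->.
  rewrite dvdn_mulr // expnS expn1 dvdn_pmul2l // pd /=.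
  by rewrite Gauss_dvd ?pn ?dn // prime_coprime.
case/andP => /andP[/dvdnP[d ->] p2m] mn; exists d; last by rewrite mulnC.
rewrite mem_filter -dvdn_divisors // (dvdn_trans _ mn) ?dvdn_mulr // andbT.
by apply: contra p2m => pd; rewrite expnS expn1 dvdn_mul.
Qed.

Lemma moebius_inversion (f g : nat -> rat) n : (0 < n)%N ->
    (forall m, (0 < m)%N -> f m = \sum_(i <- divisors m) g i) ->
  g n = \sum_(m <- divisors n) (moebius (n %/ m))%:~R * f m.
Proof.
move=> n0 fg.
have div_gt0 m : m \in divisors n -> (0 < m)%N.
  by rewrite -dvdn_divisors //; apply: dvdn_gt0.
transitivity (\sum_(m <- divisors n) \sum_(i <- divisors n | (i %| m)%N)
    (moebius (n %/ m))%:~R * g i); last first.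
  apply: eq_big_seq => m mn; rewrite fg ?div_gt0 // mulr_sumr -big_filter.
  apply: perm_big; apply: uniq_perm; rewrite ?filter_uniq ?divisors_uniq //.
  move=> i; rewrite mem_filter -!dvdn_divisors ?(div_gt0 m) //.
  apply/andb_idr => im; apply: dvdn_trans im _.
  by rewrite dvdn_divisors.
rewrite (exchange_big_dep xpredT) //=.
transitivity (\sum_(i <- divisors n) (if i == n then g i else 0)).
  by rewrite -big_mkcond (big_rem n) ?divisors_id //= eqxx big_seq_cond big1 ?addr0 // => i;
    rewrite mem_rem_uniq ?divisors_uniq // inE => /andP[/andP[/negPf ->]].
apply: eq_big_seq => i; rewrite -dvdn_divisors // => i_n; have i0 := dvdn_gt0 n0 i_n.
have ni0 : (0 < n %/ i)%N by rewrite divn_gt0 // dvdn_leq.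
rewrite -mulr_suml.
have -> : \sum_(m <- divisors n | (i %| m)%N) (moebius (n %/ m))%:~R
    = \sum_(e <- divisors (n %/ i)) (moebius e)%:~R :> rat.
  rewrite -big_filter -[LHS](big_map (fun m => n %/ m)%N xpredT (fun e => (moebius e)%:~R)).
  apply: perm_big; apply: uniq_perm; rewrite ?divisors_uniq //.
    rewrite map_inj_in_uniq ?filter_uniq ?divisors_uniq // => x y.
    rewrite !mem_filter -!dvdn_divisors // => /andP[_ xn] /andP[_ yn] E.
    have nx0 : (0 < n %/ x)%N by rewrite divn_gt0 ?(dvdn_gt0 n0 xn) // dvdn_leq.
    have /eqP := divnK yn; rewrite -E -{2}(divnK xn) eqn_pmul2l //.
    by move/eqP.
  move=> e; rewrite -dvdn_divisors //; apply/mapP/idP.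
    case=> m; rewrite mem_filter -dvdn_divisors // => /andP[im mn] ->.
    have m0 := dvdn_gt0 n0 mn.
    case/dvdnP: mn => q def_n; case/dvdnP: im => t def_m.
    by rewrite def_n mulnK // def_m mulnA mulnK // dvdn_mulr.
  move=> e_n; have e0 := dvdn_gt0 ni0 e_n; case/dvdnP: e_n => q def_q.
  have q0 : (0 < q)%N by move: ni0; rewrite def_q muln_gt0 => /andP[].
  have def_n : n = (e * (q * i))%N by rewrite -(divnK i_n) def_q; lia.
  exists (q * i)%N; last by rewrite def_n mulnK // muln_gt0 q0.
  by rewrite mem_filter dvdn_mull // -dvdn_divisors // def_n dvdn_mull.
rewrite -(raddf_sum (intmul 1 : int -> rat)) /= sum_moebius //.
have -> : (n %/ i == 1)%N = (i == n).
  by rewrite -(eqn_pmul2r i0) divnK // mul1n eq_sym.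
by case: eqP => _; rewrite ?mul1r ?mul0r.
Qed.

(** * Braid relations *)

Section Conjugation.
Variable G : groupType.
Implicit Types g h a b : G.
Local Open Scope group_scope.

Definition lconj g a := g * a * g^-1.

Lemma lconjM g a b : lconj g (a * b) = lconj g a * lconj g b.
Proof. by rewrite /lconj !mulgA mulgKV. Qed.

Lemma lconjA g h a : lconj (g * h) a = lconj g (lconj h a).
Proof. by rewrite /lconj invgM !mulgA. Qed.

Lemma lconjK g a : lconj g^-1 (lconj g a) = a.
Proof. by rewrite /lconj invgK !mulgA mulVg mul1g mulgVK. Qed.

Lemma lconj_id g a : commute g a -> lconj g a = a.
Proof. by rewrite /lconj => ->; rewrite mulgK. Qed.

Lemma lconj_mul g a : lconj g a * g = g * a.
Proof. by rewrite /lconj mulgVK. Qed.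

End Conjugation.

Section Braids.
Variable k : nat.
Local Open Scope group_scope.

(** Indexing the generators by all of [nat], with the trivial braid outside
    the range, makes far commutation unconditional. *)
Definition gen (i : nat) : braid k := if insub i is Some o then sigma o else 1.

Lemma genE (o : 'I_k.-1) : gen o = sigma o.
Proof. by rewrite /gen valK. Qed.

Lemma gen_out i : (k.-1 <= i)%N -> gen i = 1.
Proof. by move=> ki; rewrite /gen insubN // -leqNgt. Qed.

Lemma gen_far i j : (i.+1 < j)%N -> commute (gen i) (gen j).
Proof.
move=> ij; case: (ltnP j k.-1) => [jk|/gen_out ->]; last exact: commute1.
have ik : (i < k.-1)%N by lia.
have := genE (Ordinal ik); have := genE (Ordinal jk) => /= -> ->.
by rewrite /commute /sigma /mul /= !braid_mulE; apply/braid_ofP/braid_equiv_far.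
Qed.

Lemma gen_far_dist i j : (i.+1 < j)%N || (j.+1 < i)%N -> commute (gen i) (gen j).
Proof. by case/orP => /gen_far // h; apply: commute_sym. Qed.

Lemma gen_near i : (i.+1 < k.-1)%N ->
  gen i * gen i.+1 * gen i = gen i.+1 * gen i * gen i.+1.
Proof.
move=> ik; have ik' : (i < k.-1)%N by lia.
have := genE (Ordinal ik); have := genE (Ordinal ik') => /= -> ->.
rewrite /sigma /mul /= !braid_mulE; apply/braid_ofP.
exact: (@braid_equiv_near k (Ordinal ik') (Ordinal ik)).
Qed.

Lemma braid_of_letter (l : 'I_k.-1 * bool) :
  braid_of [:: l] = if l.2 then gen l.1 else (gen l.1)^-1.
Proof. by case: l => o [] /=; rewrite genE //; apply/esym/braid_invE. Qed.

Lemma braid_ind (P : braid k -> Prop) : P 1 ->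
    (forall i x, (i < k.-1)%N -> P x -> P (gen i * x) /\ P ((gen i)^-1 * x)) ->
  forall x, P x.
Proof.
move=> P1 PS x; rewrite -(braid_reprK x); elim: (braid_repr x) => [|l w IH] //.
rewrite -cat1s -braid_mulE braid_of_letter.
by case: (PS l.1 _ (ltn_ord _) IH); case: l.2.
Qed.

Definition swap_nat (i x : nat) : nat :=
  if x == i then i.+1 else if x == i.+1 then i else x.

Lemma braid_perm_gen i (x : 'I_k) : (i < k.-1)%N ->
  braid_perm (gen i) x = swap_nat i x :> nat.
Proof.
move=> ik; have := genE (Ordinal ik) => /= ->.
rewrite braid_perm_sigma /adj_tperm /swap_nat.
case: tpermP => [->|->|/eqP + /eqP] /=; rewrite ?eqxx //.
  by rewrite gtn_eqF.
by rewrite -!val_eqE /= => /negPf -> /negPf ->.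
Qed.

Lemma braid_permMx (a b : braid k) x :
  braid_perm (a * b) x = braid_perm b (braid_perm a x).
Proof. by rewrite braid_permM permM. Qed.

Lemma pureM (a b : braid k) : pure a -> pure b -> pure (a * b).
Proof. by move=> /eqP pa /eqP pb; rewrite /pure braid_permM pa pb mulg1. Qed.

Lemma pureV (a : braid k) : pure a -> pure a^-1.
Proof. by move=> /eqP pa; rewrite /pure braid_permV pa invg1. Qed.

Lemma pure1 : pure (1 : braid k).
Proof. by rewrite /pure braid_perm1. Qed.

Lemma pure_lconj (g a : braid k) : pure a -> pure (lconj g a).
Proof. by move=> /eqP pa; rewrite /pure !braid_permM braid_permV pa mulg1 mulgV. Qed.

Lemma pure_gen2 i : pure (gen i * gen i).
Proof.
case: (ltnP i k.-1) => [ik|/gen_out ->]; last by rewrite mulg1 pure1.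
apply/eqP/permP => x; rewrite perm1; apply: val_inj => /=.
rewrite braid_permMx !braid_perm_gen // /swap_nat.
by case: (eqVneq (x : nat) i) => [->|?]; [|case: (eqVneq (x : nat) i.+1) => [->|?]];
  rewrite ?eqxx //; do ?case: eqP => //; lia.
Qed.

(** * Generators of the pure braid group *)

(** The generator [A_(a, b)], in which strand [b] crosses down to its neighbour
    [a], links with it and returns; here [b = a + n + 1]. *)
Fixpoint chord_rec (a n : nat) : braid k :=
  if n is m.+1 then lconj (gen (a + n)) (chord_rec a m) else gen a * gen a.

Definition chord a b : braid k := chord_rec a (b - a.+1).

Lemma chord_adj a : chord a a.+1 = gen a * gen a.
Proof. by rewrite /chord subnn. Qed.

Lemma chordS a b : (a < b)%N -> chord a b.+1 = lconj (gen b) (chord a b).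
Proof. by move=> ab; rewrite /chord subSn //=; congr (lconj (gen _) _); lia. Qed.

Lemma chord_ind a (P : nat -> Prop) : P a.+1 ->
  (forall b, (a < b)%N -> P b -> P b.+1) -> forall b, (a < b)%N -> P b.
Proof.
move=> P1 PS b ab; rewrite -(subnKC ab); elim: (b - a.+1)%N => [|n IH].
  by rewrite addn0.
by rewrite addnS; apply: PS => //; lia.
Qed.

Lemma chord_pure a b : (a < b)%N -> pure (chord a b).
Proof.
move: b; apply: chord_ind => [|b ab IH]; first by rewrite chord_adj pure_gen2.
by rewrite chordS // pure_lconj.
Qed.

Lemma commute_chord a b g : (a < b)%N ->
  (forall i, (a <= i < b)%N -> commute g (gen i)) -> commute g (chord a b).
Proof.
move: b; apply: chord_ind => [|b ab IH] gi.
  by rewrite chord_adj; apply: commuteM; apply: gi; lia.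
rewrite chordS //; apply: commuteM; last by apply/commuteV/gi; lia.
by apply: commuteM; [apply: gi; lia|apply: IH => i ?; apply: gi; lia].
Qed.

Lemma gen_chord_far a b i : (a < b)%N -> (i.+1 < a)%N || (b < i)%N ->
  commute (gen i) (chord a b).
Proof. by move=> ab h; apply: commute_chord => // j ?; apply: gen_far_dist; lia. Qed.

(** Conjugation by [gen a] slides the lower end of the chord past the next
    strand: for adjacent strands this is the braid relation. *)
Lemma lconj_gen_chordl a b : (a.+1 < b)%N -> (b < k)%N ->
  lconj (gen a) (chord a b) = chord a.+1 b.
Proof.
move: b; apply: chord_ind => [|b ab IH] bk.
  rewrite chordS // !chord_adj -lconjA !lconjM.
  have -> // : lconj (gen a * gen a.+1) (gen a) = gen a.+1.
  rewrite /lconj gen_near; last by lia.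
  by rewrite -(mulgA _ (gen a)) mulgK.
rewrite chordS; last by lia.
rewrite chordS // -IH; last by lia.
by rewrite -!lconjA (gen_far ab).
Qed.

Lemma gen_chord_inside a b i : (a < i)%N -> (i.+1 < b)%N -> (b < k)%N ->
  commute (gen i) (chord a b).
Proof.
move=> ai ib; move: b ib; apply: chord_ind => [|b ib IH] bk.
  rewrite chordS; last by lia.
  rewrite chordS // -lconjA.
  have /lconj_id E : commute (gen i.+1) (chord a i) by apply: gen_chord_far; lia.
  have h : lconj (gen i) (lconj (gen i.+1 * gen i) (chord a i))
      = lconj (gen i.+1 * gen i) (chord a i).
    rewrite -lconjA mulgA gen_near; last by lia.
    by rewrite lconjA E.
  by rewrite /commute -{2}h lconj_mul.
rewrite chordS; last by lia.
apply: commuteM; last by apply/commuteV/gen_far; lia.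
by apply: commuteM; [apply: gen_far; lia|apply: IH; lia].
Qed.

Lemma chord_nested a b x y : (a < x)%N -> (x < y)%N -> (y < b)%N -> (b < k)%N ->
  commute (chord x y) (chord a b).
Proof.
move=> ax xy yb bk; apply/commute_sym/commute_chord => // i ?.
by apply/commute_sym/gen_chord_inside; lia.
Qed.

Lemma chord_apart a b x y : (x < y)%N -> (y < a)%N -> (a < b)%N ->
  commute (chord x y) (chord a b).
Proof.
move=> xy ya ab; apply/commute_sym/commute_chord => // i ?.
by apply/commute_sym/gen_chord_far; lia.
Qed.

(** The Artin relation of type B.  For adjacent strands both sides are the
    square of [s * t * s]; the general case is conjugate to this one by braids
    that commute with [gen b]. *)
Lemma chord_gen_relation a b : (a < b)%N -> (b.+1 < k)%N ->
  let A := chord a b in let t := gen b in A * t * A * t = t * A * t * A.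
Proof.
move=> ab bk /=; have [n] := ubnP (b - a); elim: n a ab => // n IH a ab h.
case: (ltngtP a.+1 b) ab bk => // [ab _|<- _] bk; last first.
  have near : gen a * gen a.+1 * gen a = gen a.+1 * gen a * gen a.+1.
    by apply: gen_near; lia.
  rewrite chord_adj; move: (gen a) (gen a.+1) near => s t near.
  have -> : s * s * t * (s * s) * t = s * (s * t * s) * (s * t) by rewrite !mulgA.
  have -> : t * (s * s) * t * (s * s) = t * s * (s * t * s) * s by rewrite !mulgA.
  rewrite near.
  have -> : s * (t * s * t) * (s * t) = (s * t * s) * (t * s * t) by rewrite !mulgA.
  have -> : t * s * (t * s * t) * s = (t * s * t) * (s * t * s) by rewrite !mulgA.
  by rewrite near.
have ct : commute (gen a) (gen b) by apply: gen_far.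
have IHa := IH a.+1 ab; rewrite -lconj_gen_chordl // in IHa; last by lia.
have {}IHa : lconj (gen a) (chord a b * gen b * chord a b * gen b)
    = lconj (gen a) (gen b * chord a b * gen b * chord a b).
  by rewrite !lconjM (lconj_id ct) IHa //; lia.
by rewrite -(lconjK (gen a) (chord a b * _ * _ * _)) IHa lconjK.
Qed.

(** The full twist [X * Y * Z] on three strands commutes with each of its
    factors.  Moving the upper strand down to [b + 1] by conjugation reduces this
    to the previous relation. *)
Lemma chord_triple a b c : (a < b)%N -> (b < c)%N -> (c < k)%N ->
  let X := chord a b in let Y := chord a c in let Z := chord b c in
  X * Y * Z = Y * Z * X /\ X * Y * Z = Z * X * Y.
Proof.
move=> ab bc ck /=; move: c bc ck; apply: chord_ind => [|c bc IH] ck.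
  have := chord_gen_relation ab ck => /=.
  rewrite chordS // chord_adj; move: (chord a b) (gen b) => A t rel.
  have EY : lconj t A * (t * t) = t * A * t by rewrite mulgA lconj_mul.
  have EZ : t * t * A * lconj t A = lconj t (t * A * t * A).
    by rewrite /lconj !mulgA.
  split; first by rewrite -mulgA !EY !mulgA.
  by rewrite -mulgA EY EZ -rel /lconj !mulgA mulgK rel.
have [|E1 E2] := IH; first by lia.
have fixX : lconj (gen c) (chord a b) = chord a b.
  by apply/lconj_id/gen_chord_far => //; rewrite bc orbT.
rewrite !chordS //; last by lia.
rewrite -fixX.
by rewrite -!lconjM; split; congr (lconj _ _).
Qed.

(** * The symmetric group as a quotient of the braid group *)

Fixpoint prod_gen (s : seq nat) : braid k := if s is i :: s' then gen i * prod_gen s' else 1.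

Lemma prod_gen_cat s s' : prod_gen (s ++ s') = prod_gen s * prod_gen s'.
Proof. by elim: s => [|i s IH] /=; rewrite ?mul1g // IH mulgA. Qed.

(** The product [gen (j + n - 1) * ... * gen j] carries position [j + n] to
    position [j]; these are the minimal coset representatives of one symmetric
    group in the next. *)
Fixpoint descent (j n : nat) : braid k :=
  if n is m.+1 then gen (j + m) * descent j m else 1.

Lemma descentSr j n : descent j n.+1 = descent j.+1 n * gen j.
Proof.
elim: n => [|n IH]; first by rewrite /= addn0 mul1g mulg1.
have -> : descent j n.+2 = gen (j + n.+1) * descent j n.+1 by [].
by rewrite IH /= addSnnS mulgA.
Qed.

Lemma commute_descent i j n : (i.+1 < j)%N || (j + n < i)%N ->
  commute (gen i) (descent j n).
Proof.
elim: n => [|n IH] h /=; first exact: commute1.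
by apply: commuteM; [apply: gen_far_dist; lia | apply: IH; lia].
Qed.

(** The generator slides through by one braid relation. *)
Lemma descent_gen i j n : (j < i)%N -> (i < j + n)%N -> (j + n < k)%N ->
  descent j n * gen i = gen i.-1 * descent j n.
Proof.
elim: n => [|n IH] ji ijn jnk /=; first by lia.
case: (ltngtP i (j + n)) ijn => [ijn _|h h'|def_i _].
- rewrite -mulgA IH //; last by lia.
  by rewrite !mulgA (gen_far_dist (i := i.-1) (j := j + n)) //; lia.
- by lia.
case: n IH jnk def_i => [|n] IH jnk def_i; first by lia.
rewrite def_i /= -!mulgA.
rewrite -(commute_descent (i := j + n.+1) (j := j) (n := n)); last by lia.
by rewrite addnS /= !mulgA -gen_near //; lia.
Qed.

Section Coxeter.
Variable E : braid k -> braid k -> Prop.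
Hypothesis E_refl : forall x, E x x.
Hypothesis E_trans : forall x y z, E x y -> E y z -> E x z.
Hypothesis E_mull : forall g x y, E x y -> E (g * x) (g * y).
Hypothesis E_mulr : forall g x y, E x y -> E (x * g) (y * g).
Hypothesis E_genV : forall i, E (gen i)^-1 (gen i).
Hypothesis E_gen2 : forall i, E (gen i * gen i) 1.
Hypothesis E_perm : forall x y, E x y -> braid_perm x = braid_perm y.

(** Multiplying a coset representative by a generator on the right gives another
    representative, up to a generator of the smaller group on the left. *)
Lemma normal_form m s : (m < k)%N -> all (fun i => i < m)%N s ->
  exists s' j, [/\ all (fun i => i.+1 < m)%N s', (j <= m)%N
                 & E (prod_gen s) (prod_gen s' * descent j (m - j))].
Proof.
move=> mk; elim/last_ind: s => [|s i IH].
  by exists [::], m; rewrite subnn /= mulg1.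
rewrite all_rcons => /andP[im /IH[s' [j [sm jm Es]]]].
rewrite -cats1 prod_gen_cat /= mulg1.
have {Es} := E_mulr (gen i) Es; rewrite -mulgA => Es.
case: (ltngtP i j) => [ij|ji|eij]; last 2 first.
- exists (rcons s' i.-1), j; rewrite all_rcons sm jm; split=> //; first by lia.
  move: Es; rewrite -cats1 prod_gen_cat /= mulg1 descent_gen ?mulgA //; lia.
- exists s', j.+1; split=> //; first by lia.
  apply: E_trans Es _; rewrite -eij in jm *; apply: E_mull.
  have -> : (m - i)%N = (m - i.+1).+1 by lia.
  rewrite descentSr -mulgA -[X in E _ X]mulg1; exact/E_mull/E_gen2.
have [eij|nij] := eqVneq i.+1 j.
  exists s', i; split=> //; first by lia.
  have -> : (m - i)%N = (m - j).+1 by lia.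
  by rewrite descentSr eij.
exists (rcons s' i), j; rewrite all_rcons sm jm; split=> //; first by lia.
move: Es; rewrite -cats1 prod_gen_cat /= mulg1 -mulgA.
by rewrite (commute_descent (i := i)) //; lia.
Qed.

Lemma braid_perm_prod_gen m s (x : 'I_k) : (m < k)%N ->
  all (fun i => i.+1 < m)%N s -> x = m :> nat -> braid_perm (prod_gen s) x = x.
Proof.
move=> mk; elim: s => [|i s IH] /= => [_ _|/andP[im sm] xm].
  by rewrite braid_perm1 perm1.
rewrite braid_permMx (_ : braid_perm (gen i) x = x) ?IH //.
by apply: val_inj; rewrite /= braid_perm_gen /swap_nat; [do 2?case: eqP => //; lia|lia].
Qed.

Lemma braid_perm_descent j n (x : 'I_k) : (j + n < k)%N -> x = (j + n)%N :> nat ->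
  braid_perm (descent j n) x = j :> nat.
Proof.
elim: n x => [|n IH] x jnk xE /=; first by rewrite braid_perm1 perm1 xE addn0.
rewrite braid_permMx IH //; first by lia.
by rewrite braid_perm_gen ?/swap_nat; [do 2?case: eqP => //; lia|lia].
Qed.

Lemma coxeter_positive m s : (m < k)%N -> all (fun i => i < m)%N s ->
  pure (prod_gen s) -> E (prod_gen s) 1.
Proof.
elim: m s => [|m IH] s mk; first by case: s => [|? ?] //=; rewrite E_refl.
move=> sm ps; have [s' [j [s'm jm Es]]] := normal_form mk sm.
have jE : j = m.+1.
  move: ps => /eqP; rewrite (E_perm Es) => /permP/(_ (Ordinal mk)).
  rewrite perm1 braid_permMx (braid_perm_prod_gen (m := m.+1)) // => /(congr1 val) /=.
  by rewrite braid_perm_descent /=; lia.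
move: Es; rewrite jE subnn mulg1 => Es.
apply: (E_trans Es); apply: IH; [by lia|by apply: sub_all s'm => i; lia|].
by rewrite /pure -(E_perm Es).
Qed.

(** The squares of the generators generate the kernel of the permutation
    homomorphism as a normal subgroup, by Coxeter's presentation of the symmetric
    group: a congruence that kills them identifies any pure braid with the trivial
    one. *)
Lemma coxeter x : pure x -> E x 1.
Proof.
have [s [sk Es]] : exists s, all (fun i => i < k.-1)%N s /\ E x (prod_gen s).
  elim/braid_ind: x => [|i x ik [s [sk Es]]]; first by exists [::].
  split; exists (i :: s); rewrite /= ik sk; split=> //; first exact: E_mull.
  by apply: E_trans (E_mulr _ (E_genV i)) _; apply: E_mull.
move=> px; apply: (E_trans Es).
case: (posnP k) => [k0|k0].
  by case: s sk {Es} => [|i s] //= /andP[? _]; exfalso; lia.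
apply: coxeter_positive sk _; first by lia.
by rewrite /pure -(E_perm Es).
Qed.

End Coxeter.

End Braids.

(** * The filtration by the number of double points *)

Section Filtration.
Variable k : nat.
Implicit Types (f g : braid k -> rat) (x y z : braid k).
Local Notation gen := (@gen k).
Local Notation chord := (@chord k).

(** Invariants of type [n - 1], by recursion on the first double point; the braid
    [h] gathers the ordinary crossings before it. *)
Fixpoint vanish (n : nat) f : Prop :=
  if n is m.+1 then
    forall h i, vanish m (fun x => f (h * gen i * x)%g - f (h * (gen i)^-1 * x)%g)
  else forall x, f x = 0.

Lemma eq_vanish n f g : f =1 g -> vanish n f -> vanish n g.
Proof. by move/funext->. Qed.

Lemma vanish_lin n a b f g : vanish n f -> vanish n g ->
  vanish n (fun x => a * f x + b * g x).
Proof.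
elim: n f g => [|n IH] f g /= vf vg => [x|h i]; first by rewrite vf vg !mulr0 addr0.
by apply: eq_vanish (IH _ _ (vf h i) (vg h i)) => x /=; ring.
Qed.

Lemma vanishD n f g : vanish n f -> vanish n g -> vanish n (fun x => f x + g x).
Proof.
by move=> vf vg; apply: eq_vanish (vanish_lin 1 1 vf vg) => x; rewrite !mul1r.
Qed.

Lemma vanishB n f g : vanish n f -> vanish n g -> vanish n (fun x => f x - g x).
Proof.
by move=> vf vg; apply: eq_vanish (vanish_lin 1 (-1) vf vg) => x; rewrite mul1r mulN1r.
Qed.

Lemma vanish_eq0 n f : (forall x, f x = 0) -> vanish n f.
Proof.
elim: n f => //= n IH f f0 h i; apply: IH => x; by rewrite !f0 subr0.
Qed.

Lemma vanish_left n f h : vanish n f -> vanish n (fun x => f (h * x)%g).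
Proof.
case: n => [|n] vf /= => [x|h' i]; first exact: vf.
by apply: eq_vanish (vf (h * h')%g i) => x; rewrite !mulgA.
Qed.

Lemma vanishS n f : vanish n f -> vanish n.+1 f.
Proof. by move=> vf h i; apply: vanishB; apply: vanish_left. Qed.

Lemma leq_vanish m n f : (m <= n)%N -> vanish m f -> vanish n f.
Proof. by move/subnK <-; elim: (n - m)%N => //= p IH /IH /vanishS. Qed.

(** The Leibniz rule: a double point of a product of two functions is the sum of
    a double point of each factor. *)
Lemma vanishM p q f g : vanish p f -> vanish q g ->
  vanish (p + q).-1 (fun x => f x * g x).
Proof.
have [n] := ubnP (p + q); elim: n p q f g => // n IH [|p] [|q] f g h vf vg.
- by apply: vanish_eq0 => x; rewrite vf mul0r.
- by apply: vanish_eq0 => x; rewrite vf mul0r.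
- by apply: vanish_eq0 => x; rewrite vg mulr0.
rewrite addSn addnS /= => h' i.
pose P x := (h' * gen i * x)%g; pose N x := (h' * (gen i)^-1 * x)%g.
have v1 : vanish (p + q) (fun x => (f (P x) - f (N x)) * g (P x)).
  have := IH p q.+1 _ _ _ (vf h' i) (vanish_left (h' * gen i)%g vg).
  by rewrite addnS /=; apply; lia.
have v2 : vanish (p + q) (fun x => f (N x) * (g (P x) - g (N x))).
  have := IH p.+1 q _ _ _ (vanish_left (h' * (gen i)^-1)%g vf) (vg h' i).
  by rewrite addSn /=; apply; lia.
by apply: eq_vanish (vanishD v1 v2) => x; rewrite /P /N; ring.
Qed.

(** * Congruences modulo powers of the ideal of double points *)

(** The difference [x - y] lies in the [m]-th power of the ideal of double
    points. *)
Definition cong (m : nat) x y : Prop :=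
  forall n f, vanish (n + m) f -> vanish n (fun z => f (x * z)%g - f (y * z)%g).

Lemma cong_refl m x : cong m x x.
Proof. by move=> n f _; apply: vanish_eq0 => z; rewrite subrr. Qed.

Lemma cong_sym m x y : cong m x y -> cong m y x.
Proof.
move=> c n f /c v; apply: eq_vanish (vanish_lin 0 (-1) v v) => z; ring.
Qed.

Lemma cong_trans m x y z : cong m x y -> cong m y z -> cong m x z.
Proof.
move=> c1 c2 n f vf; apply: eq_vanish (vanishD (c1 _ _ vf) (c2 _ _ vf)) => t /=.
by ring.
Qed.

Lemma cong_mull m h x y : cong m x y -> cong m (h * x)%g (h * y)%g.
Proof.
move=> c n f vf; apply: eq_vanish (c _ _ (vanish_left h vf)) => z.
by rewrite !mulgA.
Qed.

Lemma cong_mulr m h x y : cong m x y -> cong m (x * h)%g (y * h)%g.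
Proof.
move=> c n f vf; apply: eq_vanish (vanish_left h (c _ _ vf)) => z.
by rewrite !mulgA.
Qed.

Lemma cong_lconj m h x y : cong m x y -> cong m (lconj h x) (lconj h y).
Proof. by move=> c; apply/cong_mulr/cong_mull. Qed.

Lemma cong_genV i : cong 1 (gen i)^-1%g (gen i).
Proof.
apply: cong_sym => n f; rewrite addn1 => /(_ 1%g i).
by apply: eq_vanish => z; rewrite !mul1g.
Qed.

(** Crossing changes unknot every pure braid. *)
Lemma cong_pure x : pure x -> cong 1 x 1%g.
Proof.
move=> px; have [_ //] : braid_perm x = braid_perm 1%g /\ cong 1 x 1%g.
apply: (coxeter (E := fun x y => braid_perm x = braid_perm y /\ cong 1 x y)) => //.
- by move=> y; split=> //; apply: cong_refl.
- move=> a b c [-> ab] [-> bc]; split=> //; exact: cong_trans bc.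
- by move=> g a b [p ab]; split; [rewrite !braid_permM p|apply: cong_mull].
- by move=> g a b [p ab]; split; [rewrite !braid_permM p|apply: cong_mulr].
- move=> i; split; last exact: cong_genV.
  have /eqP := pure_gen2 k i; rewrite braid_permM braid_permV => e.
  by apply: (mulgI (braid_perm (gen i))); rewrite mulgV e.
- move=> i; split; first by rewrite braid_perm1; apply/eqP/pure_gen2.
  by apply: cong_sym; have := cong_mull (gen i) (@cong_genV i); rewrite mulgV.
- by move=> a b [].
Qed.

Definition diff (A : braid k) f : braid k -> rat := fun z => f (A * z)%g - f z.

Lemma vanish_diff A n f : pure A -> vanish n.+1 f -> vanish n (diff A f).
Proof.
move=> pA vf; have := cong_pure pA; move/(_ n f); rewrite addn1 => /(_ vf).
by apply: eq_vanish => z; rewrite mul1g.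
Qed.

Lemma vanish_diff_pred A n f : pure A -> vanish n f -> vanish n.-1 (diff A f).
Proof.
move=> pA; case: n => [v|n]; last exact: vanish_diff.
by apply: vanish_eq0 => z; rewrite /diff !v subrr.
Qed.

(** The commutator of [P] and [A] is that of [P - 1] and [A - 1]. *)
Lemma cong2_mulC P A : pure P -> pure A -> cong 2 (P * A)%g (A * P)%g.
Proof.
move=> pP pA n f; rewrite addn2 => vf.
have v1 := vanish_diff pA (vanish_diff pP vf).
have v2 := vanish_diff pP (vanish_diff pA vf).
by apply: eq_vanish (vanishB v1 v2) => z; rewrite /diff !mulgA; ring.
Qed.

Lemma cong2_lconj P A : pure P -> pure A -> cong 2 (lconj P A) A.
Proof.
move=> pP pA; have := cong_mulr P^-1%g (cong2_mulC pP pA).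
by rewrite -(mulgA A P) mulgV mulg1.
Qed.

(** The two conjugates differ by conjugation by the pure braid [gen i * gen i]. *)
Lemma cong2_lconj_genV i A : pure A -> cong 2 (lconj (gen i)^-1%g A) (lconj (gen i) A).
Proof.
move=> pA; apply: cong_sym.
have -> : lconj (gen i) A = lconj (gen i * gen i)%g (lconj (gen i)^-1%g A).
  by rewrite -lconjA -mulgA mulgV mulg1.
by apply: cong2_lconj; [exact: pure_gen2|exact: pure_lconj].
Qed.

(** Modulo squares of the ideal, conjugation by a braid permutes the chords
    according to its action on the end points.  Where the exact conjugate is not
    a chord, that by the inverse generator is one. *)
Lemma lconj_gen_chord i a b : (i < k.-1)%N -> (a < b)%N -> (b < k)%N ->
  exists a' b', [/\ (a' < b')%N, (b' < k)%N & cong 2 (lconj (gen i) (chord a b)) (chord a'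
    b')].
Proof.
move=> ik ab bk; have pc := chord_pure k ab.
have fixed : commute (gen i) (chord a b) -> exists a' b',
    [/\ (a' < b')%N, (b' < k)%N & cong 2 (lconj (gen i) (chord a b)) (chord a' b')].
  by move=> /lconj_id ->; exists a, b; split=> //; apply: cong_refl.
case: (ltngtP i b) => [ib|bi|ib]; last 2 first.
- by apply/fixed/gen_chord_far; lia.
- exists a, b.+1; split; [lia|lia|]; rewrite ib chordS //; exact: cong_refl.
case: (ltngtP i.+1 b) => [ib1||ib1]; last 2 first.
- by lia.
- case: (ltngtP a i) => [ai||ai]; last 2 first.
  + by lia.
  + apply: fixed; rewrite -ib1 ai chord_adj.
    by apply: commuteM; apply: commute_refl.
  + exists a, i; split; [lia|lia|].
    have e : chord a b = lconj (gen i) (chord a i) by rewrite -ib1 chordS.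
    apply: cong_trans (cong_sym (cong2_lconj_genV i pc)) _.
    by rewrite e lconjK; apply: cong_refl.
case: (ltngtP a i) => [ai|ia|ai].
- by apply/fixed/gen_chord_inside.
- case: (ltngtP i.+1 a) => [ia1||ia1]; last 2 first.
  + by lia.
  + exists i, b; split; [lia|lia|].
    have e : chord a b = lconj (gen i) (chord i b) by rewrite lconj_gen_chordl ?ia1.
    apply: cong_trans (cong_sym (cong2_lconj_genV i pc)) _.
    by rewrite e lconjK; apply: cong_refl.
  + by apply/fixed/gen_chord_far; lia.
exists a.+1, b; split; [lia|lia|].
by rewrite -ai lconj_gen_chordl ?ai //; apply: cong_refl.
Qed.

Lemma lconj_chord (g : braid k) a b : (a < b)%N -> (b < k)%N ->
  exists a' b', [/\ (a' < b')%N, (b' < k)%N & cong 2 (lconj g (chord a b)) (chord a' b')].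
Proof.
move=> ab bk; elim/braid_ind: g => [|i g ik [a1 [b1 [ab1 bk1 c1]]]].
  by exists a, b; split=> //; rewrite /lconj mul1g invg1 mulg1; apply: cong_refl.
have [a2 [b2 [ab2 bk2 c2]]] := lconj_gen_chord ik ab1 bk1.
have c3 : cong 2 (lconj (gen i) (lconj g (chord a b))) (chord a2 b2).
  exact: cong_trans (cong_lconj _ c1) c2.
split; exists a2, b2; rewrite lconjA; split=> //.
by apply: cong_trans (cong2_lconj_genV i _) c3; apply/pure_lconj/chord_pure.
Qed.

(** * Infinitesimal braid relations *)

(** [X - 1] and [Y - 1] commute modulo the cube of the ideal, one power more
    than their product. *)
Definition comm3 X Y : Prop := forall n f, vanish n.+3 f ->
  vanish n (fun z => f (X * Y * z)%g - f (Y * X * z)%g).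

Lemma comm3_commute X Y : commute X Y -> comm3 X Y.
Proof. by move=> XY n f _; apply: vanish_eq0 => z; rewrite XY subrr. Qed.

Lemma comm3_congl X X' Y : pure X -> pure Y -> cong 2 X X' ->
  comm3 X' Y -> comm3 X Y.
Proof.
move=> pX pY c XY n f vf.
have v1 : vanish n (diff Y (fun z => f (X * z)%g - f (X' * z)%g)).
  by apply: vanish_diff pY _; apply: c; rewrite addn2.
have v2 : vanish n (fun z => diff Y f (X * z)%g - diff Y f (X' * z)%g).
  by apply: c; rewrite addn2; apply: vanish_diff.
apply: eq_vanish (vanishD (XY _ _ vf) (vanishB v1 v2)) => z.
by rewrite /diff !mulgA; ring.
Qed.

Lemma comm3_lconj (g X Y : braid k) : comm3 (lconj g X) (lconj g Y) -> comm3 X Y.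
Proof.
move=> c n f vf; have := vanish_left g (c _ _ (vanish_left g^-1%g vf)).
have e a z : (g^-1 * (lconj g a * (g * z)) = a * z)%g.
  by rewrite (mulgA (lconj g a)) lconj_mul !mulgA mulVg mul1g.
by apply: eq_vanish => z; rewrite -!lconjM !e.
Qed.

(** Nested chords and chords side by side commute as braids.  If the end points
    interleave, conjugation moves the lower end [a] step by step below [x], where
    the chords become nested; since only degree two matters, chords may be replaced
    by congruent ones on the way. *)
Lemma chord_disjoint (a b x y : nat) : (x < y)%N -> (y < b)%N -> (a < b)%N -> (b < k)%N ->
  a != x -> a != y -> comm3 (chord x y) (chord a b).
Proof.
move=> xy yb ab bk ax ay.
case: (ltngtP y a) ay => // [ya _|ay _].
  by apply: comm3_commute; apply: chord_apart.
case: (ltngtP a x) ax => // [ax _|xa _].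
  by apply: comm3_commute; apply: chord_nested.
have [n] := ubnP (a - x); elim: n a ab ay xa => // n IH a ab ay xa an.
pose i := a.-1; have ai : a = i.+1 by rewrite /i; lia.
have cb : lconj (gen i)^-1%g (chord a b) = chord i b.
  by rewrite -[RHS](lconjK (gen i)) lconj_gen_chordl -?ai //; lia.
apply: (@comm3_lconj (gen i)^-1%g); rewrite cb.
case: (ltngtP x i) => [xi||xi]; last 2 first.
- by lia.
- have pc : pure (lconj (gen i)^-1%g (chord x y)) by apply/pure_lconj/chord_pure.
  apply: (comm3_congl pc) (cong2_lconj_genV i (chord_pure k xy)) _.
    by apply: chord_pure; lia.
  rewrite -xi lconj_gen_chordl; [|lia|lia].
  by apply: comm3_commute; apply: chord_nested; lia.
have /lconj_id -> : commute (gen i)^-1%g (chord x y).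
  by apply/commute_sym/commuteV/commute_sym/gen_chord_inside; lia.
by apply: IH; lia.
Qed.

(** Expanding the relation in [X - 1], [Y - 1] and [Z - 1] leaves the
    commutators, as the cubic terms have three double points. *)
Lemma four_term X Y Z : pure X -> pure Y -> pure Z ->
    (X * Y * Z = Y * Z * X)%g ->
  forall n f, vanish n.+3 f -> vanish n (fun z =>
    (f (X * Y * z)%g - f (Y * X * z)%g) + (f (X * Z * z)%g - f (Z * X * z)%g)).
Proof.
move=> pX pY pZ rel n f vf.
have v1 := vanish_diff pZ (vanish_diff pY (vanish_diff pX vf)).
have v2 := vanish_diff pX (vanish_diff pZ (vanish_diff pY vf)).
apply: eq_vanish (vanishB v2 v1) => z; rewrite /diff !mulgA rel; ring.
Qed.

End Filtration.

(** * Weight systems *)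

Section WeightSystems.
Variable k : nat.
Local Notation letter := ('I_k *l 'I_k)%type.
Implicit Types (f g : braid k -> rat) (x y z : braid k) (c : letter) (s : seq letter).

(** The letter [(j, a)] stands for the chord between the strands [a < j]. *)
Definition lchord c : braid k := chord k c.2 c.1.
Definition is_chord c := (c.2 < c.1)%N.
Definition combed_rel c c' := (c'.1 <= c.1)%N.
Definition combed s := all is_chord s && sorted combed_rel s.

Lemma lchord_pure c : is_chord c -> pure (lchord c).
Proof. exact: chord_pure. Qed.

Fixpoint diffs f s := if s is c :: s' then diffs (diff (lchord c) f) s' else f.

(** The value of [f] on the product of the [A - 1] for the chords [A] of [s],
    which for [f] of type [size s] depends only on [f] modulo lower type: the
    weight system of [f]. *)
Definition weight f s : rat := diffs f s 1%g.

Lemma weight_nil f : weight f [::] = f 1%g. Proof. by []. Qed.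

Lemma weight_cons f c s : weight f (c :: s) = weight (diff (lchord c) f) s.
Proof. by []. Qed.

Lemma diffs_cat f s s' : diffs f (s ++ s') = diffs (diffs f s) s'.
Proof. by elim: s f => //= c s IH f. Qed.

Lemma weight_cat f s s' : weight f (s ++ s') = weight (diffs f s) s'.
Proof. by rewrite /weight diffs_cat. Qed.

Lemma diffs_lin a b f g s z :
  diffs (fun x => a * f x + b * g x) s z = a * diffs f s z + b * diffs g s z.
Proof.
elim: s f g => //= c s IH f g; rewrite -IH; congr (diffs _ _ _).
by apply/funext => t; rewrite /diff; ring.
Qed.

Lemma diffsD f g s z : diffs (fun x => f x + g x) s z = diffs f s z + diffs g s z.
Proof.
rewrite -[diffs f s z]mul1r -[diffs g s z]mul1r -diffs_lin; congr (diffs _ _ _).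
by apply/funext => t; rewrite !mul1r.
Qed.

Lemma diffs_vanish f s n : all is_chord s -> vanish n f ->
  vanish (n - size s) (diffs f s).
Proof.
elim: s n f => [|c s IH] n f /=; first by rewrite subn0.
move=> /andP[vc vs] vf; rewrite subnS -subn1 subnAC subn1.
exact/IH/vanish_diff_pred/vf/lchord_pure.
Qed.

Lemma weight_vanish f s : all is_chord s -> vanish (size s) f -> weight f s = 0.
Proof. by move=> vs /(diffs_vanish vs); rewrite subnn; exact. Qed.

Lemma weight_lin a b f g s :
  weight (fun x => a * f x + b * g x) s = a * weight f s + b * weight g s.
Proof. exact: diffs_lin. Qed.

Lemma weightD f g s : weight (fun x => f x + g x) s = weight f s + weight g s.
Proof. exact: diffsD. Qed.

Lemma weight_four c d e e' f s : all is_chord s ->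
    vanish (size s) (fun z => (f (lchord d * lchord c * z)%g - f (lchord c * lchord d * z)%g)
       - (f (lchord e * lchord e' * z)%g - f (lchord e' * lchord e * z)%g)) ->
  weight f [:: d, c & s] = weight f [:: c, d & s]
    + (weight f [:: e, e' & s] - weight f [:: e', e & s]).
Proof.
move=> vs /(weight_vanish vs) w0; rewrite !weight_cons.
pose w1 := weight (diff (lchord c) (diff (lchord d) f)) s.
pose w2 := weight (diff (lchord d) (diff (lchord c) f)) s.
pose w3 := weight (diff (lchord e') (diff (lchord e) f)) s.
pose w4 := weight (diff (lchord e) (diff (lchord e') f)) s.
suff : 1 * w1 + (-1) * w2 + (-1) * (1 * w3 + (-1) * w4) = 0.
  by rewrite /w1 /w2 /w3 /w4; lra.
rewrite -w0 /w1 /w2 /w3 /w4 -!weight_lin -[X in X + _]mul1r -weight_lin.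
by congr (weight _ _); apply/funext => z; rewrite /diff !mulgA; ring.
Qed.

(** Exchanging neighbours is free for disjoint chords.  If the chords share a
    strand, the 4T relations express the commutator by that of two chords on the
    larger of the two upper strands. *)
Lemma weight_swap c d f s : all is_chord s -> is_chord c -> is_chord d ->
    (d.1 < c.1)%N -> vanish (size s).+3 f ->
  weight f [:: d, c & s] = weight f [:: c, d & s] \/
  exists e e', [/\ is_chord e, is_chord e', e.1 = c.1, e'.1 = c.1 &
    weight f [:: d, c & s] = weight f [:: c, d & s]
      + (weight f [:: e, e' & s] - weight f [:: e', e & s])].
Proof.
move=> vs vc vd dc vf.
have ck : (c.1 < k)%N by [].
have pX := lchord_pure vd; have pY := lchord_pure vc.
have [ax|ax] := eqVneq (c.2 : nat) d.2; last first.
  have [ay|ay] := eqVneq (c.2 : nat) d.1; last first.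
    left; have := chord_disjoint vd dc vc ck ax ay vf.
    move/(weight_vanish vs) => w0; rewrite !weight_cons.
    pose w1 := weight (diff (lchord c) (diff (lchord d) f)) s.
    pose w2 := weight (diff (lchord d) (diff (lchord c) f)) s.
    suff : 1 * w1 + (-1) * w2 = 0 by rewrite /w1 /w2; lra.
    rewrite -w0 /w1 /w2 -!weight_lin.
    by congr (weight _ _); apply/funext => z; rewrite /diff !mulgA; ring.
  right; pose e : letter := (c.1, d.2).
  have ve : is_chord e by rewrite /is_chord /=; exact: ltn_trans vd dc.
  exists c, e; split=> //; apply: weight_four => //.
  have [E1 E2] := chord_triple vd dc ck.
  have E : (lchord c * lchord d * lchord e = lchord d * lchord e * lchord c)%g.
    by rewrite /lchord /= ay -E2.
  have v := four_term (lchord_pure vc) pX (lchord_pure ve) E vf.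
  by apply: eq_vanish (vanish_lin (-1) 0 v v) => z; ring.
right; pose e : letter := (c.1, d.1).
exists c, e; split=> //; apply: weight_four => //.
have [E1 E2] := chord_triple vd dc ck.
have E : (lchord c * lchord e * lchord d = lchord e * lchord d * lchord c)%g.
  by rewrite /lchord /= ax -E1 E2.
have v := four_term (lchord_pure vc) (lchord_pure (c := e) dc) pX E vf.
by apply: eq_vanish (vanish_lin (-1) 0 v v) => z; ring.
Qed.

(** Two measures for the sorting of words: the correction terms of an exchange
    lie on larger strands and decrease [low_sum]; the exchange itself preserves
    [low_sum] and moves the larger strand to the left, which decreases
    [late_sum]. *)
Definition low_sum s : nat := (\sum_(c <- s) (k - c.1))%N.
Fixpoint late_sum s : nat :=
  if s is c :: s' then (\sum_(e <- s') e.1 + late_sum s')%N else 0%N.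

Lemma late_sum_catl u s s' : (\sum_(c <- s) c.1 = \sum_(c <- s') c.1)%N ->
  (late_sum s < late_sum s')%N -> (late_sum (u ++ s) < late_sum (u ++ s'))%N.
Proof.
move=> e lt; elim: u => //= c u IH.
by rewrite !big_cat /= e ltn_add2l.
Qed.

Lemma unsorted_split s : ~~ sorted combed_rel s ->
  exists u d c v, s = u ++ [:: d, c & v] /\ (d.1 < c.1)%N.
Proof.
case: s => // x s; elim: s x => //= y s IH x; rewrite negb_and => /orP[xy|/IH].
  by exists [::], x, y, s; split=> //; rewrite ltnNge.
by move=> [u [d [c [v [-> dc]]]]]; exists (x :: u), d, c, v.
Qed.

(** Sort the word by exchanges of neighbours, with the termination order just
    described. *)
Lemma weight_combed n f : vanish n.+1 f ->
    (forall s, size s = n -> combed s -> weight f s = 0) ->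
  forall s, size s = n -> all is_chord s -> weight f s = 0.
Proof.
move=> vf w0 s; have [m] := ubnP (low_sum s); elim: m s => // m IHm s.
have [p] := ubnP (late_sum s); elim: p s => // p IHp s sp sm sz vs.
have [ss|/unsorted_split[u [d [c [v [def_s dc]]]]]] := boolP (sorted combed_rel s).
  by apply: w0; rewrite // /combed vs.
move: sp sm sz vs; rewrite {}def_s all_cat /= size_cat /= => sp sm sz.
case/and4P=> vu vd vc vv.
have vf' : vanish (size v).+3 (diffs f u).
  have := diffs_vanish vu vf; rewrite -sz.
  by rewrite (_ : (_ - _)%N = (size v).+3) //; lia.
have wcd : weight (diffs f u) [:: c, d & v] = 0.
  rewrite -weight_cat; apply: IHp; rewrite ?size_cat //=.
  - rewrite ltnS in sp; apply: leq_trans sp; apply: late_sum_catl.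
      by rewrite !big_cons addnCA.
    by rewrite /= !big_cons !ltn_add2r.
  - apply: leq_ltn_trans sm; rewrite /low_sum !big_cat /= !big_cons.
    by rewrite (addnCA (k - c.1)%N).
  - by rewrite all_cat /= vu vc vd.
rewrite weight_cat; case: (weight_swap vv vc vd dc vf') => [->//|].
move=> [e [e' [ve ve' ec ec' ->]]]; rewrite wcd -!weight_cat add0r.
have w1 (x x' : letter) : is_chord x -> is_chord x' -> x.1 = c.1 -> x'.1 = c.1 ->
    weight f (u ++ [:: x, x' & v]) = 0.
  move=> vx vx' xc xc'; apply: IHm; rewrite ?size_cat ?all_cat //=.
    rewrite ltnS in sm; apply: leq_trans sm; rewrite /low_sum !big_cat /= !big_cons xc xc'.
    by rewrite ltn_add2l !addnA !ltn_add2r ltn_sub2l // ltn_ord.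
  by rewrite vu vx vx'.
by rewrite !w1 ?subr0.
Qed.

Lemma cong_lconj_letter h c : is_chord c ->
  exists2 c', is_chord c' & cong 2 (lconj h (lchord c)) (lchord c').
Proof.
move=> vc; have ck : (c.1 < k)%N by [].
have [a [b [ab bk cab]]] := lconj_chord h vc ck.
by exists (Ordinal bk, Ordinal (ltn_trans ab bk)).
Qed.

Lemma diffs_conj s h f A c y : all is_chord s -> vanish (size s).+2 f ->
    cong 2 A (lchord c) ->
  diffs (fun z => diff A f (h * z)%g) s y = diffs (fun z => diff (lchord c) f (h * z)%g) s y.
Proof.
move=> vs vf cA.
have vr : vanish (size s) (fun z => f (A * (h * z))%g - f (lchord c * (h * z))%g).
  by apply: (vanish_left (f := fun z => f (A * z)%g - f (lchord c * z)%g)); apply: cA;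
    rewrite addn2.
have := diffs_vanish vs vr; rewrite subnn => /(_ y) r0.
rewrite -[RHS]addr0 -r0 -diffsD; congr (diffs _ _ _); apply/funext => z.
by rewrite /diff; ring.
Qed.

(** Moving a braid to the left past chords permutes their end points, up to an
    error with one more double point at each step. *)
Lemma diffs_left s h : all is_chord s -> exists s',
  [/\ size s' = size s, all is_chord s' &
      forall f y, vanish (size s).+1 f ->
        diffs (fun z => f (h * z)%g) s y = diffs f s' (h * y)%g].
Proof.
elim: s => [|c s IH] /=; first by exists [::].
case/andP=> vc vs; have [s' [sz' vs' E]] := IH vs.
have [c' vc' cc'] := cong_lconj_letter h vc.
exists (c' :: s'); split; rewrite /= ?sz' // ?vc' // => f y vf.
rewrite -E; last by apply: vanish_diff => //; exact: lchord_pure.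
rewrite -(diffs_conj h y vs vf cc'); congr (diffs _ _ _).
by apply/funext => z; rewrite /diff (mulgA (lconj _ _)) lconj_mul mulgA.
Qed.

(** A double point at [gen i] after the braid [h] is [A - 1] for the conjugate [A]
    of [gen i * gen i] by [h], followed by a braid; modulo higher order [A] is a
    chord.  So double points can be traded for chords one by one. *)
Lemma diffs_detect n f : vanish n.+1 f ->
    (forall s y, size s = n -> all is_chord s -> diffs f s y = 0) -> vanish n f.
Proof.
elim: n f => [|n IH] f vf d0; first by move=> x; apply: (d0 [::] x).
move=> h i; apply: IH; first exact: (vf h i).
move=> s y sz vs; case: (leqP k.-1 i) => ik.
  rewrite (_ : (fun x => _) = (fun x => 0 * f x + 0 * f x)).
    by rewrite diffs_lin !mul0r addr0.
  by apply/funext => x; rewrite gen_out // invg1 subrr !mul0r addr0.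
have ik' : (i.+1 < k)%N by lia.
pose ci : letter := (Ordinal ik', Ordinal (ltnW ik')).
have [c vc cc] := @cong_lconj_letter h ci (ltnSn i).
pose h' := (h * (gen k i)^-1)%g.
have -> : (fun x => f (h * gen k i * x)%g - f (h * (gen k i)^-1 * x)%g)
    = (fun x => diff (lconj h (lchord ci)) f (h' * x)%g).
  apply/funext => x; rewrite /diff /h' /lchord /= chord_adj; congr (f _ - _).
  by rewrite /lconj !mulgA !mulgVK mulgK.
rewrite -sz in vf; rewrite (diffs_conj h' y vs vf cc).
have [s' [sz' vs' E]] := diffs_left h' vs.
rewrite E; last by apply: vanish_diff => //; exact: lchord_pure.
by apply: (d0 (c :: s')); rewrite /= ?sz' ?sz // vc.
Qed.

(** After [n] chords only the permutation of the remaining braid matters, and the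
    support condition leaves the trivial permutation. *)
Lemma weight_detect n f : vanish n.+1 f ->
    (forall x, ~~ pure x -> f x = 0) ->
    (forall s, size s = n -> combed s -> weight f s = 0) -> vanish n f.
Proof.
move=> vf f0 w0; apply: diffs_detect => // s y sz vs.
have [py|npy] := boolP (pure y).
  have := diffs_vanish vs vf; rewrite sz subSnn => v1.
  have := vanish_diff py v1 1%g; rewrite /diff mulg1 => /eqP.
  by rewrite subr_eq0 => /eqP ->; apply: (weight_combed vf w0 sz vs).
elim: s vs {sz vf w0} f f0 => [|c s IH] /=; first by move=> _ f f0; apply: f0.
case/andP=> vc vs f f0; apply: IH => // x npx.
rewrite /diff !f0 ?subr0 //; apply: contra npx => pcx.
by rewrite -[x](mulKg (lchord c)) pureM // pureV // lchord_pure.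
Qed.

(** * Products of weight systems *)

Lemma weight0 s : weight (fun=> 0) s = 0.
Proof.
by elim: s => // c s IH; rewrite weight_cons -[RHS]IH; congr (weight _ _);
  apply/funext => x; rewrite /diff subrr.
Qed.

(** Since [A - 1] is not primitive, a chord may fall on both factors of the
    product; in the top degree such terms have too many chords and vanish, which
    leaves the shuffles. *)
Lemma weight_mul p q f g s : all is_chord s -> vanish p f -> vanish q g ->
    (p + q <= (size s).+2)%N ->
  weight (fun x => f x * g x) s = shuffle_prod (weight f) (weight g) s.
Proof.
have shuffle_prod0 h : shuffle_prod (weight (fun=> 0)) h =1 fun=> 0.
  by move=> t; rewrite -[RHS](shuffle_prod0l h t); apply: eq_shuffle_prod => // u;
    apply: weight0.
elim: s p q f g => [|c s IH] [|p] [|q] f g vs vf vg pq //.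
- have -> : f = fun=> 0 by apply/funext.
  by rewrite shuffle_prod0 (_ : (fun x => _) = fun=> 0) ?weight0 //; apply/funext => x;
    rewrite mul0r.
- have -> : f = fun=> 0 by apply/funext.
  by rewrite shuffle_prod0 (_ : (fun x => _) = fun=> 0) ?weight0 //; apply/funext => x;
    rewrite mul0r.
- have -> : g = fun=> 0 by apply/funext.
  by rewrite shuffle_prodC shuffle_prod0 (_ : (fun x => _) = fun=> 0) ?weight0 //;
    apply/funext => x; rewrite mulr0.
move: vs pq => /= /andP[vc vs] pq; have pc := lchord_pure vc.
have vf' := vanish_diff pc vf; have vg' := vanish_diff pc vg.
have cross : weight (fun x => diff (lchord c) f x * diff (lchord c) g x) s = 0.
  by apply: (weight_vanish vs); apply: leq_vanish (vanishM vf' vg'); lia.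
rewrite /= -(IH p q.+1 (diff (lchord c) f) g) //.
rewrite -(IH p.+1 q f (diff (lchord c) g)) //; last by rewrite addSn -addnS.
rewrite -[RHS]addr0 -cross -!weightD weight_cons; congr (weight _ _).
by apply/funext => x; rewrite /diff; ring.
Qed.

End WeightSystems.

(** * The Hurwitz action *)

Section Hurwitz.
Variables (k : nat) (G : groupType).
Local Open Scope group_scope.
Implicit Types (h : nat -> G) (w : braid_word k) (x y : braid k).

(** The step of a positive ([b = true]) or negative crossing of positions [i] and
    [i + 1]: one entry passes by and conjugates the other. *)
Definition hurwitz_step (i : nat) (b : bool) h : nat -> G := fun l =>
  if l == i then if b then h i.+1 else h i * h i.+1 * (h i)^-1
  else if l == i.+1 then if b then (h i.+1)^-1 * h i * h i.+1 else h i
  else h l.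

Definition hurwitz_word h w : nat -> G :=
  foldl (fun h' (l : 'I_k.-1 * bool) => hurwitz_step l.1 l.2 h') h w.

Lemma hurwitz_word_cat h u v : hurwitz_word h (u ++ v) = hurwitz_word (hurwitz_word h u) v.
Proof. exact: foldl_cat. Qed.

Lemma hurwitz_stepK i b h : hurwitz_step i (~~ b) (hurwitz_step i b h) = h.
Proof.
apply/funext => l; rewrite /hurwitz_step eqxx.
have -> : (i.+1 == i) = false by apply/negbTE; lia.
rewrite eqxx; case: b => /=; case: (eqVneq l i) => [->|li] //.
- by rewrite !mulgA mulgV mul1g mulgK.
- by case: (eqVneq l i.+1) => [->|].
- by case: (eqVneq l i.+1) => [->|//]; rewrite !mulgA mulVg mul1g mulgVK.
Qed.

Lemma hurwitz_word_equiv h u v : braid_equiv u v -> hurwitz_word h u = hurwitz_word h v.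
Proof.
move=> uv; elim: uv h => {u v} //.
- by move=> u v w _ IH1 _ IH2 h; rewrite IH1 IH2.
- by move=> u u' v v' _ IH1 _ IH2 h; rewrite !hurwitz_word_cat IH1 IH2.
- by move=> i b h; rewrite /hurwitz_word /= hurwitz_stepK.
- move=> i j ij h; rewrite /hurwitz_word /=; apply/funext => l; rewrite /hurwitz_step.
  have e (x y : nat) : (x < y)%N -> ((x == y) = false) * ((y == x) = false).
    by move=> xy; split; apply/negbTE; lia.
  have e1 := e i j ltac:(lia); have e2 := e i j.+1 ltac:(lia).
  have e3 := e i.+1 j ltac:(lia); have e4 := e i.+1 j.+1 ltac:(lia).
  case: (eqVneq l i) => [->|li]; first by rewrite !(e1, e2, e3, e4, eqxx).
  case: (eqVneq l i.+1) => [->|li1]; first by rewrite !(e1, e2, e3, e4, eqxx).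
  by rewrite !(e1, e2, e3, e4, eqxx).
move=> i j ji h; rewrite /hurwitz_word /= ji; apply/funext => l; rewrite /hurwitz_step.
have e1 : (i.+1 == i) = false by apply/negbTE; lia.
have e2 : (i.+2 == i) = false by apply/negbTE; lia.
have e3 : (i.+2 == i.+1) = false by apply/negbTE; lia.
have e4 : (i == i.+1 :> nat) = false by apply/negbTE; lia.
have e5 : (i.+1 == i.+2) = false by apply/negbTE; lia.
have e6 : (i == i.+2 :> nat) = false by apply/negbTE; lia.
case: (eqVneq l i) => [->|li]; first by rewrite !(e1, e2, e3, e4, e5, e6, eqxx).
case: (eqVneq l i.+1) => [_|li1]; first by rewrite !(e1, e2, e3, e4, e5, e6, eqxx).
case: (eqVneq l i.+2) => [_|_]; rewrite ?(e1, e2, e3, e4, e5, e6, eqxx) //.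
by rewrite !invgM !invgK !mulgA !mulgK.
Qed.

Definition hurwitz h x := hurwitz_word h (braid_repr x).

Lemma hurwitz_of h w : hurwitz h (braid_of w) = hurwitz_word h w.
Proof. exact/hurwitz_word_equiv/braid_ofK. Qed.

Lemma hurwitzM h x y : hurwitz h (x * y) = hurwitz (hurwitz h x) y.
Proof.
by rewrite -{1}(braid_reprK x) -{1}(braid_reprK y) [_ * _]braid_mulE hurwitz_of
  hurwitz_word_cat.
Qed.

Lemma hurwitz1 h : hurwitz h 1 = h.
Proof. exact: hurwitz_of. Qed.

Lemma hurwitz_gen h i : (i < k.-1)%N -> hurwitz h (gen k i) = hurwitz_step i true h.
Proof. by move=> ik; have := genE (Ordinal ik) => /= ->; apply: hurwitz_of. Qed.

Lemma hurwitz_genV h i : (i < k.-1)%N -> hurwitz h (gen k i)^-1 = hurwitz_step i false h.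
Proof.
move=> ik; rewrite -{2}[h]hurwitz1 -(mulVg (gen k i)) hurwitzM hurwitz_gen //.
by rewrite -[LHS](hurwitz_stepK i true).
Qed.

(** The trivial entry at [b] moves down and back without conjugating the
    others. *)
Lemma hurwitz_chord_fix h a b : (a < b)%N -> (b < k)%N -> h b = 1 ->
  hurwitz h (chord k a b) = h.
Proof.
move=> ab; move: b ab h; apply: chord_ind => [|b ab IH] h bk hb.
  rewrite chord_adj hurwitzM !hurwitz_gen; [|lia|lia].
  have e1 : (a.+1 == a) = false by apply/negbTE; lia.
  apply/funext => l; rewrite /hurwitz_step; case: (eqVneq l a) => [->|la].
    by rewrite !(e1, eqxx) hb invg1 mul1g mulg1.
  case: (eqVneq l a.+1) => [->|//].
  by rewrite !(e1, eqxx) hb !mulg1 mulVg.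
rewrite chordS // /lconj !hurwitzM IH; [|lia|].
  by rewrite -hurwitzM mulgV hurwitz1.
by rewrite hurwitz_gen; [rewrite /hurwitz_step eqxx | lia].
Qed.

(** Once strand [b] is adjacent to strand [a], the full twist conjugates both
    entries by their product. *)
Lemma hurwitz_chord_top h a b : (a < b)%N -> (b < k)%N ->
  hurwitz h (chord k a b) b = (h a * h b)^-1 * h b * (h a * h b).
Proof.
move=> ab; move: b ab h; apply: chord_ind => [|b ab IH] h bk.
  rewrite chord_adj hurwitzM !hurwitz_gen; [|lia|lia].
  have e1 : (a.+1 == a) = false by apply/negbTE; lia.
  by rewrite /hurwitz_step !(e1, eqxx) invgM !invgM invgK !mulgA mulgK.
rewrite chordS // /lconj !hurwitzM hurwitz_genV; last by lia.
have e1 : (b.+1 == b) = false by apply/negbTE; lia.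
have e2 : (a == b) = false by apply/negbTE; lia.
have e3 : (a == b.+1) = false by apply/negbTE; lia.
rewrite {1}/hurwitz_step e1 eqxx IH; last by lia.
by rewrite hurwitz_gen ?/hurwitz_step ?eqxx ?e2 ?e3 //; lia.
Qed.

Lemma hurwitz_chord_below h a b i : (a < b)%N -> (b < i)%N -> (b < k)%N ->
  hurwitz h (chord k a b) i = h i.
Proof.
move=> ab; move: b ab h; apply: chord_ind => [|b ab IH] h bi bk.
  by rewrite chord_adj hurwitzM !hurwitz_gen /hurwitz_step; [rewrite !ifN //; lia|lia|lia].
rewrite chordS // /lconj !hurwitzM hurwitz_genV; last by lia.
rewrite /hurwitz_step !ifN; [|lia|lia].
rewrite IH; [|lia|lia].
by rewrite hurwitz_gen /hurwitz_step; [rewrite !ifN //; lia|lia].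
Qed.

End Hurwitz.

Lemma hurwitz_rel (k : nat) (G G' : groupType) (R : G -> G' -> Prop) :
    (forall x x' y y', R x x' -> R y y' -> R (x * y)%g (x' * y')%g) ->
    (forall x x', R x x' -> R x^-1%g x'^-1%g) ->
  forall h h' (x : braid k), (forall l, R (h l) (h' l)) ->
    forall l, R (hurwitz h x l) (hurwitz h' x l).
Proof.
move=> RM RV h h' x; rewrite /hurwitz; elim: (braid_repr x) h h' => [|[i b] w IH] h h' Rh //=.
apply: IH => l; rewrite /hurwitz_step; case: (l == i); first by case: b; auto.
by case: (l == i.+1); case: b; auto.
Qed.

(** * Units of a ring and the augmentation filtration *)

Section Units.
Variable A : nzRingType.

(** Units of [A] carried with their inverses, which makes them a group whatever
    the ring. *)
Definition unit_pair := {p : A * A | (p.1 * p.2 == 1) && (p.2 * p.1 == 1)}.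
HB.instance Definition _ := Choice.on unit_pair.

Definition uval (u : unit_pair) : A := (val u).1.
Definition uinv (u : unit_pair) : A := (val u).2.

Lemma uvalK u : uval u * uinv u = 1.
Proof. by have /andP[/eqP] := valP u. Qed.

Lemma uinvK u : uinv u * uval u = 1.
Proof. by have /andP[_ /eqP] := valP u. Qed.

Lemma unit_pairP (a b : A) : a * b = 1 -> b * a = 1 -> (a * b == 1) && (b * a == 1).
Proof. by move=> -> ->; rewrite eqxx. Qed.

Definition mk_unit_pair (a b : A) (ab : a * b = 1) (ba : b * a = 1) : unit_pair :=
  exist _ (a, b) (unit_pairP ab ba).

Lemma unit_pair_mul_subproof1 u v : (uval u * uval v) * (uinv v * uinv u) = 1.
Proof. by rewrite mulrA -(mulrA (uval u)) uvalK mulr1 uvalK. Qed.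
Lemma unit_pair_mul_subproof2 u v : (uinv v * uinv u) * (uval u * uval v) = 1.
Proof. by rewrite mulrA -(mulrA (uinv v)) uinvK mulr1 uinvK. Qed.

Definition umul u v := mk_unit_pair (unit_pair_mul_subproof1 u v) (unit_pair_mul_subproof2 u
  v).
Definition uone : unit_pair := mk_unit_pair (mul1r 1) (mul1r 1).
Definition uinverse u : unit_pair := mk_unit_pair (uinvK u) (uvalK u).

Lemma unit_pair_inj u v : uval u = uval v -> uinv u = uinv v -> u = v.
Proof. by move=> e1 e2; apply: val_inj;
  rewrite [LHS]surjective_pairing [RHS]surjective_pairing; congr (_, _). Qed.

Lemma umulA : associative umul.
Proof. by move=> u v w; apply: unit_pair_inj; rewrite /uval /uinv /= mulrA. Qed.
Lemma umul1 : left_id uone umul.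
Proof. by move=> u; apply: unit_pair_inj; rewrite /uval /uinv /= ?mul1r ?mulr1. Qed.
Lemma umulr1 : right_id uone umul.
Proof. by move=> u; apply: unit_pair_inj; rewrite /uval /uinv /= ?mul1r ?mulr1. Qed.
Lemma umulV : left_inverse uone uinverse umul.
Proof. by move=> u; apply: unit_pair_inj; apply: uinvK. Qed.
Lemma umulrV : right_inverse uone uinverse umul.
Proof. by move=> u; apply: unit_pair_inj; apply: uvalK. Qed.

HB.instance Definition _ := isGroup.Build unit_pair umulA umul1 umulr1 umulV umulrV.

Lemma uvalV (u : unit_pair) : uval (u^-1)%g = uinv u. Proof. by []. Qed.
Lemma uval1 : uval (1%g : unit_pair) = 1. Proof. by []. Qed.

(** The functions of a tuple of units that are combinations of products with at
    least [m] factors [h l - 1]: the filtration of words in the units by powers of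
    the augmentation ideal. *)
Inductive aug : nat -> ((nat -> unit_pair) -> A) -> Prop :=
| aug_zero m : aug m (fun=> 0)
| aug_val l : aug 0 (fun h => uval (h l))
| aug_inv l : aug 0 (fun h => uinv (h l))
| aug_sub1 l : aug 1 (fun h => uval (h l) - 1)
| aug_add m t t' : aug m t -> aug m t' -> aug m (fun h => t h + t' h)
| aug_opp m t : aug m t -> aug m (fun h => - t h)
| aug_mul m m' t t' : aug m t -> aug m' t' -> aug (m + m') (fun h => t h * t' h)
| aug_weak m t : aug m.+1 t -> aug m t.

Lemma eq_aug m t t' : t =1 t' -> aug m t -> aug m t'.
Proof. by move/funext ->. Qed.

Lemma aug_sub m t t' : aug m t -> aug m t' -> aug m (fun h => t h - t' h).
Proof. by move=> a a'; apply: aug_add a (aug_opp a'). Qed.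

Lemma aug_step m t i b : aug m t -> aug m (fun h => t (hurwitz_step i b h)).
Proof.
move=> a; elim: a => {m t} [m|l|l|l|m t t' _ IH _ IH'|m t _ IH|m m' t t' _ IH _ IH'|m t _ IH];
  [exact: aug_zero| | | |exact: aug_add|exact: aug_opp|exact: aug_mul|exact: aug_weak].
- rewrite /hurwitz_step; case: (l == i); [case: b|case: (l == i.+1); [case: b|]];
  try exact: aug_val.
  + exact: (aug_mul (aug_mul (aug_val i) (aug_val i.+1)) (aug_inv i)).
  + exact: (aug_mul (aug_mul (aug_inv i.+1) (aug_val i)) (aug_val i.+1)).
- rewrite /hurwitz_step; case: (l == i); [case: b|case: (l == i.+1); [case: b|]];
  try exact: aug_inv.
  + exact: (aug_mul (aug_val i) (aug_mul (aug_inv i.+1) (aug_inv i))).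
  + exact: (aug_mul (aug_inv i.+1) (aug_mul (aug_inv i) (aug_val i.+1))).
- rewrite /hurwitz_step; case: (l == i); [case: b|case: (l == i.+1); [case: b|]];
  try exact: aug_sub1.
  + apply: (eq_aug (t := fun h => uval (h i) * (uval (h i.+1) - 1) * uinv (h i))).
      by move=> h; rewrite mulrBr mulrBl mulr1 uvalK.
    exact: (aug_mul (aug_mul (aug_val i) (aug_sub1 i.+1)) (aug_inv i)).
  + apply: (eq_aug (t := fun h => uinv (h i.+1) * (uval (h i) - 1) * uval (h i.+1))).
      by move=> h; rewrite mulrBr mulrBl mulr1 uinvK.
    exact: (aug_mul (aug_mul (aug_inv i.+1) (aug_sub1 i)) (aug_val i.+1)).
Qed.

(** The commutator of two units is that of their differences from [1]. *)
Lemma aug_comm l l' : aug 2 (fun h => uval (h l) * uval (h l') - uval (h l') * uval (h l)).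
Proof.
apply: (eq_aug (t := fun h => (uval (h l) - 1) * (uval (h l') - 1)
                            - (uval (h l') - 1) * (uval (h l) - 1))).
  have E (a b p : A) : p - a - (b - 1) = p - (a + b - 1).
    by rewrite !opprB opprD -!addrA; congr (_ + _); rewrite addrCA.
  move=> h; rewrite !mulrBl !mulrBr !mulr1 !mul1r !E.
  rewrite (addrC (uval (h l'))); move: (uval (h l) + _ - 1) => c.
  by rewrite opprB addrA subrK.
exact: (aug_sub (aug_mul (aug_sub1 l) (aug_sub1 l')) (aug_mul (aug_sub1 l') (aug_sub1 l))).
Qed.

Lemma aug_dval l i :
  aug 2 (fun h => uval (hurwitz_step i true h l) - uval (hurwitz_step i false h l)).
Proof.
rewrite /hurwitz_step; case: (l == i) => [|].
  apply: (eq_aug (t := fun h =>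
     (uval (h i.+1) * uval (h i) - uval (h i) * uval (h i.+1)) * uinv (h i))).
    by move=> h; rewrite mulrBl -mulrA uvalK mulr1.
  exact: (aug_mul (aug_comm i.+1 i) (aug_inv i)).
case: (l == i.+1) => [|].
  apply: (eq_aug (t := fun h => uinv (h i.+1) *
     (uval (h i) * uval (h i.+1) - uval (h i.+1) * uval (h i)))).
    by move=> h; rewrite mulrBr !mulrA uinvK mul1r.
  exact: (aug_mul (aug_inv i.+1) (aug_comm i i.+1)).
by apply: (eq_aug (t := fun=> 0)); [move=> h; rewrite subrr|apply: aug_zero].
Qed.

(** The two resolutions of a crossing agree up to commutators of units, so a
    double point raises the filtration, by the Leibniz rule on products. *)
Lemma aug_double m t i : aug m t ->
  aug m.+1 (fun h => t (hurwitz_step i true h) - t (hurwitz_step i false h)).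
Proof.
move=> a; elim: a => {m t} [m|l|l|l|m t t' _ IH _ IH'|m t _ IH|m m' t t' a IH a' IH'|m t _ IH].
- by apply: (eq_aug (t := fun=> 0)); [move=> h; rewrite subrr|apply: aug_zero].
- exact/aug_weak/aug_dval.
- apply: (eq_aug (t := fun h => - (uinv (hurwitz_step i true h l) *
     (uval (hurwitz_step i true h l) - uval (hurwitz_step i false h l)) * uinv (hurwitz_step i
       false h l)))).
    move=> h; rewrite mulrBr mulrBl uinvK mul1r -mulrA uvalK mulr1.
    by rewrite opprB.
  apply/aug_weak/aug_opp.
  exact: (aug_mul (aug_mul (aug_step i true (aug_inv l)) (aug_dval l i)) (aug_step i false
    (aug_inv l))).
- by apply: (eq_aug _ (aug_dval l i)) => h; rewrite opprB addrA subrK.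
- by apply: (eq_aug _ (aug_add IH IH')) => h; rewrite opprD addrACA.
- by apply: (eq_aug _ (aug_opp IH)) => h; rewrite opprB opprK addrC.
- have a1 := aug_mul IH (aug_step i true a').
  have a2 := aug_mul (aug_step i false a) IH'.
  rewrite addSn in a1; rewrite addnS in a2.
  apply: (eq_aug _ (aug_add a1 a2)) => h.
  by rewrite mulrBl mulrBr addrA subrK.
- exact: aug_weak.
Qed.

End Units.

(** * Finite type invariants and singular braids *)

Section SingularBraids.
Variable k : nat.
Implicit Types (f g : braid k -> rat) (x y : braid k) (w : singular_word k).

Lemma linear_extension_cons f (l : 'I_k.-1 * crossing) w :
  linear_extension f (resolve (l :: w)) =
  \sum_(x <- crossing_resolve l)
     x.1 * linear_extension (fun y => f (x.2 * y)%g) (resolve w).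
Proof.
rewrite /linear_extension /= big_allpairs_dep; apply: eq_bigr => x _.
by rewrite mulr_sumr; apply: eq_bigr => y _; rewrite /= mulrA.
Qed.

Lemma linear_extension_cons_letter f i c w :
  linear_extension f (resolve ((i, c) :: w)) =
  let pos := linear_extension (fun y => f (sigma i * y)%g) (resolve w) in
  let neg := linear_extension (fun y => f ((sigma i)^-1 * y)%g) (resolve w) in
  match c with Positive => pos | Negative => neg | Double => pos - neg end.
Proof.
rewrite linear_extension_cons; case: c; rewrite /crossing_resolve /=.
- by rewrite big_seq1 mul1r.
- by rewrite big_seq1 mul1r.
by rewrite big_cons big_seq1 mul1r mulN1r.
Qed.

Lemma linear_extensionB f g (c : seq (rat * braid k)) :
  linear_extension (fun x => f x - g x) c = linear_extension f c - linear_extension g c.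
Proof. by rewrite -sumrB; apply: eq_bigr => x _; rewrite mulrBr. Qed.

Lemma linear_extension0 f (c : seq (rat * braid k)) :
  (forall t, t \in c -> f t.2 = 0) -> linear_extension f c = 0.
Proof.
by move=> f0; rewrite /linear_extension big_seq big1 // => x /f0 ->; rewrite mulr0.
Qed.

(** The recursive description of the filtration agrees with that by singular
    words, in both directions. *)
Lemma vanish_resolve n f w : vanish n f -> (n <= double_points w)%N ->
  linear_extension f (resolve w) = 0.
Proof.
elim: w n f => [|[i c] w IH] n f vf.
  rewrite leqn0 => /eqP n0; rewrite n0 in vf.
  exact: linear_extension0.
rewrite linear_extension_cons_letter /double_points /=.
case: c => /= [nw|nw|nw].
- exact: IH (vanish_left _ vf) nw.
- exact: IH (vanish_left _ vf) nw.
case: n vf nw => [|n] vf nw.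
  by rewrite !linear_extension0 ?subrr // => x _; rewrite vf.
rewrite -linear_extensionB; apply: IH nw.
by have := vf 1%g i; apply: eq_vanish => x; rewrite genE !mul1g.
Qed.

Definition word_of_braid x : singular_word k :=
  [seq (l.1, if l.2 then Positive else Negative) | l <- braid_repr x].

Lemma linear_extension_braid_word f (u : braid_word k) w :
  linear_extension f (resolve
    ([seq (l.1, if l.2 then Positive else Negative) | l <- u] ++ w))
  = linear_extension (fun y => f (braid_of u * y)%g) (resolve w).
Proof.
elim: u f => [|[i b] u IH] f /=.
  by congr (linear_extension _ _); apply/funext => y; rewrite -{1}[y]mul1g.
rewrite linear_extension_cons_letter; case: b => /=; rewrite IH;
  congr (linear_extension _ _); apply/funext => y; rewrite mulgA; congr (f (_ * _)%g).
- exact: braid_mulE.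
- by rewrite -cat1s -braid_mulE braid_of_letter /= genE.
Qed.

Lemma double_points_braid_word (u : braid_word k) w :
  double_points ([seq (l.1, if l.2 then Positive else Negative) | l <- u] ++ w)
  = double_points w.
Proof. by elim: u => [|[i []] u IH] //=. Qed.

Lemma resolve_vanish n f :
    (forall w, (n <= double_points w)%N -> linear_extension f (resolve w) = 0) ->
  vanish n f.
Proof.
elim: n f => [|n IH] f f0.
  move=> x; have := f0 (word_of_braid x ++ [::]); rewrite linear_extension_braid_word.
  rewrite braid_reprK /linear_extension big_seq1 /= mul1r mulg1; exact.
move=> h i; apply: IH => w nw; case: (ltnP i k.-1) => ik; last first.
  by apply: linear_extension0 => x _; rewrite gen_out // invg1 subrr.
have := f0 (word_of_braid h ++ (Ordinal ik, Double) :: w).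
rewrite double_points_braid_word linear_extension_braid_word braid_reprK.
rewrite linear_extension_cons_letter /= => <- //.
rewrite linear_extensionB; have := genE (Ordinal ik) => /= ->.
by congr (_ - _); congr (linear_extension _ _); apply/funext => y; rewrite mulgA.
Qed.

(** Extending by zero keeps the type, as the resolution of a singular word whose
    permutation is not trivial contains no pure braid. *)
Definition ext (v : pure_braid k -> rat) : braid k -> rat :=
  fun x => if insub x is Some p then v p else 0.

Lemma ext_pure v (p : pure_braid k) : ext v (pure_braid_val p) = v p.
Proof. by rewrite /ext valK. Qed.

Lemma ext_npure v x : ~~ pure x -> ext v x = 0.
Proof. by move=> npx; rewrite /ext insubN. Qed.

Lemma linear_extension_pure_resolve v w :
  linear_extension v (pure_resolve w) = linear_extension (ext v) (resolve w).
Proof.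
rewrite /linear_extension /pure_resolve; elim: (resolve w) => [|[a x] c IH] /=.
  by rewrite !big_nil.
rewrite big_cons /= -IH /ext; case: insubP => [p _ /= _|_] /=.
  by rewrite big_cons.
by rewrite mulr0 add0r.
Qed.

Lemma finite_typeP n v : finite_type k n v <-> vanish n.+1 (ext v).
Proof.
split=> [ft|vf w _ nw]; last first.
  by rewrite linear_extension_pure_resolve (vanish_resolve vf nw).
apply: resolve_vanish => w nw.
have [pw|npw] := eqVneq (singular_perm w) 1%g.
  by rewrite -linear_extension_pure_resolve; apply: ft.
apply: linear_extension0 => x xw; apply: ext_npure.
by rewrite /pure (resolve_perm xw).
Qed.

Lemma finite_type_predP n v : finite_type_pred k n v <-> vanish n (ext v).
Proof.
case: n => [|n]; last exact: finite_typeP.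
split=> [-> x|v0]; first by rewrite /ext; case: insubP.
by apply/funext => p; rewrite -ext_pure v0.
Qed.

Lemma ext_lin a b u v : ext (fun p => a * u p + b * v p) =1 fun x => a * ext u x + b * ext v x.
Proof. by move=> x; rewrite /ext; case: insubP => // _; rewrite !mulr0 addr0. Qed.

Lemma extM u v : ext (fun p => u p * v p) =1 fun x => ext u x * ext v x.
Proof. by move=> x; rewrite /ext; case: insubP => // _; rewrite mulr0. Qed.

End SingularBraids.

(** * Magnus coefficients *)

Section UpperMatrices.
Variable n : nat.
Implicit Types M : 'M[rat]_n.+1.

(** Matrices that vanish below their [d]-th upper diagonal. *)
Definition upper (d : nat) M := forall i j : 'I_n.+1, (j < i + d)%N -> M i j = 0.

Lemma upperD d M M' : upper d M -> upper d M' -> upper d (M + M').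
Proof. by move=> uM uM' i j ij; rewrite mxE uM ?uM' ?addr0. Qed.

Lemma upperN d M : upper d M -> upper d (- M).
Proof. by move=> uM i j ij; rewrite mxE uM ?oppr0. Qed.

Lemma upperM d d' M M' : upper d M -> upper d' M' -> upper (d + d') (M * M').
Proof.
move=> uM uM' i j ij; rewrite mxE big1 // => l _.
case: (ltnP l (i + d)) => il; first by rewrite uM ?mul0r.
by rewrite uM' ?mulr0 //; lia.
Qed.

Lemma upper_leq d d' M : (d' <= d)%N -> upper d M -> upper d' M.
Proof. by move=> dd uM i j ij; apply: uM; lia. Qed.

Lemma upper1 : upper 0 (1 : 'M[rat]_n.+1).
Proof. by move=> i j ij; rewrite !mxE (_ : (i == j) = false) //; apply/negbTE;
  rewrite -val_eqE /=; lia. Qed.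

Lemma upperX d M e : upper d M -> upper (e * d) (M ^+ e).
Proof.
move=> uM; elim: e => [|e IH]; first exact: upper1.
by rewrite exprS mulSn; apply: upperM.
Qed.

Lemma upper_nil d M : (n < d)%N -> upper d M -> M = 0.
Proof. by move=> nd uM; apply/matrixP => i j; rewrite mxE uM //; have := ltn_ord j; lia. Qed.

(** The geometric series, which inverts [1 + M] for nilpotent [M]. *)
Definition geom M : 'M[rat]_n.+1 := \sum_(i < n.+1) (- M) ^+ i.

Lemma geomK M : upper 1 M -> (1 + M) * geom M = 1.
Proof.
move=> uM; have := subrX1 (- M) n.+1.
have -> : (- M) ^+ n.+1 = 0.
  by apply: (@upper_nil (n.+1 * 1)); [rewrite muln1|apply/upperX/upperN].
rewrite sub0r -opprD mulNr => /oppr_inj E.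
by rewrite addrC /geom -E.
Qed.

Lemma geomKl M : upper 1 M -> geom M * (1 + M) = 1.
Proof. by move=> /geomK/mulmx1C. Qed.

Lemma upper_geom M : upper 1 M -> upper 0 (geom M).
Proof.
move=> uM; rewrite /geom; elim/big_ind: _ => [i j _|A B|i _]; first by rewrite mxE.
  exact: upperD.
by apply: (@upper_leq (i * 1)) => //; apply/upperX/upperN.
Qed.

End UpperMatrices.

(** The letter [l] leads from the prefix of length [p] of [w] to that of length
    [p + 1] when it is the next letter of [w].  The last entry of the first row of
    a product of such matrices thus tests whether the letters spell [w], and a
    product of units [1 + letter_mx w l] has a Magnus coefficient there. *)
Definition letter_mx (w : seq nat) (l : nat) : 'M[rat]_((size w).+1) :=
  \matrix_(p, q) ((q == p.+1 :> nat) && (nth 0%N w p == l))%:R.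

Lemma upper_letter_mx (w : seq nat) l : upper 1 (letter_mx w l).
Proof.
by move=> p q pq; rewrite mxE (_ : (_ == _) = false) //; apply/negbTE; lia.
Qed.

Definition letter_unit (w : seq nat) (l : nat) : unit_pair 'M[rat]_((size w).+1) :=
  mk_unit_pair (geomK (@upper_letter_mx w l)) (geomKl (@upper_letter_mx w l)).

Lemma uval_letter w l : uval (letter_unit w l) = 1 + letter_mx w l.
Proof. by []. Qed.

Lemma letter_mx_notin w l : l \notin w -> letter_mx w l = 0.
Proof.
move=> lw; apply/matrixP => p q; rewrite !mxE.
case: (eqVneq (q : nat) p.+1) => //= qp; case: eqP => // wl.
by rewrite -wl mem_nth // in lw; have := ltn_ord q; rewrite qp ltnS.
Qed.

Lemma letter_unit_notin w l : l \notin w -> letter_unit w l = 1%g.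
Proof.
move=> lw; have e : uval (letter_unit w l) = 1 by rewrite uval_letter letter_mx_notin // addr0.
apply: unit_pair_inj => //; have := uinvK (letter_unit w l).
by rewrite e mulr1.
Qed.

Lemma aug_upper w m t : aug m t -> upper m (t (letter_unit w)).
Proof.
elim=> {m t} [m|l|l|l|m t t' _ IH _ IH'|m t _ IH|m m' t t' _ IH _ IH'|m t _ IH].
- by move=> i j _; rewrite mxE.
- by apply: upperD; [apply: upper1|apply: upper_leq (@upper_letter_mx w l)].
- exact/upper_geom/upper_letter_mx.
- by rewrite uval_letter addrAC subrr add0r; apply: upper_letter_mx.
- exact: upperD.
- exact: upperN.
- exact: upperM.
- exact: upper_leq IH.
Qed.

Section SingularAction.
Variables (k : nat) (n : nat).
Local Notation state := (nat -> unit_pair 'M[rat]_(n.+1)).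
Implicit Types (w : singular_word k) (t : state -> 'M[rat]_(n.+1)).

(** The signed sum of the actions of the resolutions of [w]. *)
Fixpoint singular_act w t : state -> 'M[rat]_(n.+1) :=
  if w is (i, c) :: w' then
    match c with
    | Positive => fun h => singular_act w' t (hurwitz_step i true h)
    | Negative => fun h => singular_act w' t (hurwitz_step i false h)
    | Double => fun h => singular_act w' t (hurwitz_step i true h) - singular_act w' t
      (hurwitz_step i false h)
    end
  else t.

Lemma aug_singular_act w m t : aug m t -> aug (m + double_points w) (singular_act w t).
Proof.
move=> a; elim: w => [|[i c] w IH] /=; first by rewrite addn0.
case: c; rewrite /double_points /= ?add0n; try exact: aug_step.
by rewrite add1n addnS; apply: aug_double.
Qed.

Lemma singular_actE w t h p q :
  singular_act w t h p q = linear_extension (fun x => t (hurwitz h x) p q) (resolve w).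
Proof.
elim: w h => [|[i c] w IH] h.
  by rewrite /linear_extension big_seq1 /= mul1r hurwitz1.
have ik : (i < k.-1)%N by [].
have pos : singular_act w t (hurwitz_step i true h) p q =
    linear_extension (fun y => t (hurwitz h (sigma i * y)%g) p q) (resolve w).
  rewrite IH; congr (linear_extension _ _); apply/funext => y.
  by rewrite hurwitzM -genE hurwitz_gen.
have neg : singular_act w t (hurwitz_step i false h) p q =
    linear_extension (fun y => t (hurwitz h ((sigma i)^-1 * y)%g) p q) (resolve w).
  rewrite IH; congr (linear_extension _ _); apply/funext => y.
  by rewrite hurwitzM -genE hurwitz_genV.
by rewrite linear_extension_cons_letter; case: c; rewrite /= -?pos -?neg ?mxE.
Qed.

End SingularAction.

Section Magnus.
Variable k : nat.
Local Notation letter := ('I_k *l 'I_k)%type.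

(** Strand [i] ends with a conjugate of its initial unit by a word in the others.
    The coefficient at [i :: w] of this conjugate is the Magnus coefficient at [w]
    of the conjugating word when [i] is not in [w]. *)
Definition magnus (i : nat) (w : seq nat) (x : braid k) : rat :=
  uval (hurwitz (letter_unit (i :: w)) x i) ord0 ord_max.

Lemma magnus_vanish i w : vanish (size w).+1 (magnus i w).
Proof.
apply: resolve_vanish => s ws.
pose t (h : nat -> unit_pair 'M[rat]_((size (i :: w)).+1)) := uval (h i) - 1.
have -> : magnus i w = fun x => t (hurwitz (letter_unit (i :: w)) x) ord0 ord_max.
  by apply/funext => x; rewrite !mxE subr0.
rewrite -singular_actE; apply: (aug_upper (aug_singular_act s (aug_sub1 _ i))).
by rewrite /= add0n add1n.
Qed.

(** Deleting the first letter of a word removes the first row and column of the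
    matrices; the removed row remains as a translation part. *)
Definition affine n (u : unit_pair 'M[rat]_(n.+2)) (u' : unit_pair 'M[rat]_(n.+1)) : Prop :=
  exists v : 'rV[rat]_n.+1,
    (uval u : 'M[rat]_(1 + n.+1)) = block_mx 1 v 0 (uval u').

Lemma affineM n (u : unit_pair 'M[rat]_(n.+2)) (u' : unit_pair 'M[rat]_(n.+1)) v v' :
  affine u u' -> affine v v' -> affine (u * v)%g (u' * v')%g.
Proof.
move=> [r def_u] [s def_v]; exists (1%:M *m s + r *m uval v').
transitivity (block_mx 1 r 0 (uval u') *m block_mx 1 s 0 (uval v')).
  by rewrite -def_u -def_v.
rewrite mulmx_block; by rewrite !mulmx0 !mul0mx !addr0 add0r mulmx1.
Qed.

Lemma affineV n (u : unit_pair 'M[rat]_(n.+2)) (u' : unit_pair 'M[rat]_(n.+1)) :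
  affine u u' -> affine u^-1%g u'^-1%g.
Proof.
move=> [r def_u]; exists (- (r *m uinv u')).
pose M : 'M[rat]_(1 + n.+1) := block_mx 1 (- (r *m uinv u')) 0 (uinv u').
have uM : (uval u : 'M_(1 + n.+1)) *m M = 1%:M.
  rewrite def_u /M (mulmx_block (1 : 'M_1)) !mulmx0 !mul0mx !addr0 add0r mulmx1 mul1mx addNr.
  by rewrite [_ *m _](uvalK u') -scalar_mx_block.
have uu : (uinv u : 'M_(1 + n.+1)) *m (uval u : 'M_(1 + n.+1)) = 1%:M := uinvK u.
by rewrite !uvalV -[LHS]mulmx1 -uM mulmxA uu mul1mx.
Qed.

Lemma letter_unit_affine i w l :
  uval (letter_unit (i :: w) l)
    = block_mx 1 ((i == l)%:R *: delta_mx 0 0) 0 (uval (letter_unit w l))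
    :> 'M[rat]_(1 + (size w).+1).
Proof.
rewrite !uval_letter; apply/matrixP => p q.
rewrite -[p]splitK -[q]splitK; case: (fintype.split p) => p'; case: (fintype.split q) => q';
  rewrite ?block_mxEul ?block_mxEur ?block_mxEdl ?block_mxEdr !mxE -!val_eqE /= ?ord1 //=.
rewrite add0r !add1n eqSS; case: eqP => _; last by rewrite mulr0.
  by rewrite mulr1.
Qed.

Fixpoint row_act n (X : nat -> 'M[rat]_n) (v : 'rV_n) (t : seq nat) : 'rV_n :=
  if t is a :: t' then row_act X (v *m X a) t' else v.

Lemma row_actB n (X : nat -> 'M[rat]_n) u v t :
  row_act X (u - v) t = row_act X u t - row_act X v t.
Proof. by elim: t u v => //= a t IH u v; rewrite mulmxBl IH. Qed.

Lemma row_act_delta w p t : (p <= size w)%N ->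
  row_act (letter_mx w) (delta_mx 0 (inord p)) t 0 ord_max = (drop p w == t)%:R.
Proof.
elim: t p => [|a t IH] p pw /=.
  rewrite mxE eqxx /= -val_eqE /= inordK // -size_eq0 size_drop subn_eq0.
  by rewrite eqn_leq pw andbT.
have -> : (delta_mx 0 (inord p) : 'rV_((size w).+1)) *m letter_mx w a
    = if (p < size w)%N && (nth 0%N w p == a) then delta_mx 0 (inord p.+1) else 0.
  rewrite -rowE; apply/rowP => q; rewrite !mxE inordK //.
  case: ifP => [/andP[pw' wa]|npw].
    by rewrite mxE eqxx /= wa andbT -val_eqE /= inordK.
  rewrite mxE; case: eqP => //= qp; case: eqP npw => //= _.
  by rewrite andbT => /negbT; rewrite -leqNgt => h; have := ltn_ord q;
    rewrite qp ltnS ltnNge h.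
case: ltnP => pw' /=.
  rewrite (drop_nth 0%N pw') eqseq_cons; case: eqP => //= _; first exact: IH.
  by rewrite -[0](subrr 0) row_actB subrr mxE.
by rewrite drop_oversize // -[0](subrr 0) row_actB subrr mxE.
Qed.

(** If strand [i] acts by a translation [v], linking it with strand [a]
    multiplies [v] by [1 + letter_mx w a] and does not change the linear parts.
    Each factor [A - 1] then multiplies [v] by [letter_mx w a]. *)
Lemma weight_row_act i w s (h : nat -> unit_pair 'M[rat]_((size w).+2)) v :
    (forall l, affine (h l) (letter_unit w l)) -> i \notin w ->
    uval (h i) = block_mx 1 v 0 1 :> 'M_(1 + (size w).+1) ->
    all (fun c : letter => is_chord c && (c.1 == i :> nat)) s ->
  weight (fun x : braid k => uval (hurwitz h x i) ord0 ord_max) s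
    = row_act (letter_mx w) v [seq (c.2 : nat) | c : letter <- s] 0 ord_max.
Proof.
elim: s h v => [|c s IH] h v aff iw hi.
  move=> _; rewrite weight_nil hurwitz1 hi.
  transitivity (ursubmx (block_mx 1 v 0 1 : 'M_(1 + (size w).+1)) 0 ord_max).
    by rewrite [RHS]mxE [RHS]mxE; congr (fun_of_matrix _ _ _); apply: val_inj;
      rewrite /= ?add1n.
  by rewrite block_mxKur.
move=> /= /andP[/andP[vc /eqP ci] vs]; rewrite weight_cons.
pose h' := hurwitz h (lchord c).
have ik : (i < k)%N by rewrite -ci.
have ai : (c.2 < i)%N by rewrite -ci.
have chE : lchord c = chord k c.2 i by rewrite /lchord ci.
have w1 : letter_unit w i = 1%g by apply: letter_unit_notin.
have aff' l : affine (h' l) (letter_unit w l).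
  have := hurwitz_rel (R := @affine _) (@affineM _) (@affineV _) (lchord c) aff l.
  by rewrite /h' chE (hurwitz_chord_fix (h := letter_unit w)).
have [v' hi'] := aff' i; rewrite w1 uval1 in hi'.
have [va ha] := aff c.2.
have def_v' : v' = v *m (1 + letter_mx w c.2).
  (* The conjugation formula, read in the upper right block. *)
  have : (h c.2 * h i * h' i = h i * (h c.2 * h i))%g.
    by rewrite /h' chE hurwitz_chord_top // !mulgA mulgV mul1g.
  move/(congr1 (@uval _)) => E.
  have {}E : (uval (h c.2) : 'M_(1 + (size w).+1)) *m (uval (h i) : 'M_(1 + (size w).+1))
        *m (uval (h' i) : 'M_(1 + (size w).+1))
      = (uval (h i) : 'M_(1 + (size w).+1)) *m
        ((uval (h c.2) : 'M_(1 + (size w).+1)) *m (uval (h i) : 'M_(1 + (size w).+1))) := E.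
  move: E; rewrite ha hi hi' !mulmx_block => /(congr1 ursubmx).
  rewrite !block_mxKur !mulmx0 !mul0mx !addr0 !mulmx1 !mul1mx uval_letter add0r.
  by rewrite addrC => /addrI.
have -> : diff (lchord c) (fun x => uval (hurwitz h x i) ord0 ord_max)
    = fun x => 1 * uval (hurwitz h' x i) ord0 ord_max + (-1) * uval (hurwitz h x i) ord0
      ord_max.
  by apply/funext => x; rewrite /diff hurwitzM mul1r mulN1r.
rewrite weight_lin mul1r mulN1r (IH h' v') // (IH h v) //.
have -> : v *m letter_mx w c.2 = v' - v by rewrite def_v' mulmxDr mulmx1 addrC addKr.
by rewrite row_actB !mxE.
Qed.

Lemma diffs_right f s (A : braid k) : (forall x, f (x * A)%g = f x) ->
  forall x, diffs f s (x * A)%g = diffs f s x.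
Proof.
elim: s f => //= c s IH f fA; apply: IH => x.
by rewrite /diff mulgA !fA.
Qed.

(** In a combed word, chords with upper strand above [i] come first and fix the
    base point, whose unit at that strand is trivial; chords with upper strand
    below [i] come last and do not move strand [i].  Both make the weight vanish,
    so only words of chords ending at strand [i] remain. *)
Lemma weight_magnus i w s : (i < k)%N -> all (fun a => a < i)%N w -> combed s ->
  weight (magnus i w) s
    = ([seq (c.1 : nat, c.2 : nat) | c : letter <- s] == [seq (i, a) | a <- w])%:R.
Proof.
move=> ik wi /andP[vs ss].
have iw : i \notin w by apply/negP => /(allP wi); rewrite ltnn.
have [allj|] := boolP (all (fun c : letter => c.1 == i :> nat) s).
  have [aff hi] : (forall l, affine (letter_unit (i :: w) l) (letter_unit w l)) /\
     uval (letter_unit (i :: w) i) = block_mx 1 (delta_mx 0 0) 0 1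
     :> 'M_(1 + (size w).+1).
    split=> [l|]; first by eexists; apply: letter_unit_affine.
    by rewrite letter_unit_affine eqxx scale1r letter_unit_notin.
  rewrite /magnus (weight_row_act aff iw hi); last first.
    by apply/allP => c cs; rewrite (allP vs) ?(allP allj).
  have -> : (0 : 'I_(size w).+1) = inord 0 by apply: val_inj; rewrite /= inordK.
  rewrite row_act_delta // drop0; congr (_%:R); congr (nat_of_bool _).
  have -> : [seq (c.1 : nat, c.2 : nat) | c : letter <- s]
      = [seq (i, a) | a <- [seq (c.2 : nat) | c : letter <- s]].
    by rewrite -map_comp; apply/eq_in_map => c /(allP allj) /eqP /= ->.
  rewrite (inj_eq (inj_map _)); first by rewrite eq_sym.
  by move=> a b [].
move=> nall; rewrite [RHS](_ : _ = 0); last first.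
  case: eqP => // E; case/negP: nall; apply/allP => c cs.
  have : (c.1 : nat, c.2 : nat) \in [seq (i, a) | a <- w] by rewrite -E map_f.
  by case/mapP => a _ [-> _].
have tr : transitive (@combed_rel k) by move=> a b c ba cb; apply: leq_trans cb ba.
case: s vs ss nall => // c s vs ss nall.
have ps : path (@combed_rel k) c s := ss.
case: (ltnP i c.1) => ic.
  rewrite weight_cons (_ : diff _ _ = fun=> 0) ?weight0 //.
  apply/funext => x; rewrite /diff /magnus hurwitzM hurwitz_chord_fix ?subrr //.
    by case/andP: vs.
  by apply: letter_unit_notin; rewrite inE negb_or gtn_eqF //; apply/negP => /(allP wi); lia.
have [t [e def_s]] : exists t e, c :: s = rcons t e.
  by exists (belast c s), (last c s); rewrite lastI.
rewrite def_s.
have ve : is_chord e by move: vs; rewrite def_s all_rcons => /andP[].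
have ei : (e.1 < i)%N.
  rewrite ltnNge; apply/negP => ie; case/negP: nall.
  have le_i : all (fun c : letter => c.1 <= i)%N (c :: s).
    rewrite /= ic; apply/allP => x /(allP (order_path_min tr ps)) h.
    exact: leq_trans h ic.
  have : pairwise (@combed_rel k) (c :: s) by rewrite -sorted_pairwise.
  rewrite def_s pairwise_rcons => /andP[/allP ge_e _].
  have ge_i : all (fun c : letter => i <= c.1)%N (c :: s).
    apply/allP => x; rewrite def_s mem_rcons inE => /orP[/eqP -> //|/ge_e].
    by apply: leq_trans ie.
  apply/allP => x xs; rewrite eqn_leq; apply/andP; split.
    by rewrite def_s in le_i; apply: (allP le_i x xs).
  by rewrite def_s in ge_i; apply: (allP ge_i x xs).
rewrite -cats1 weight_cat /weight /= /diff mulg1.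
rewrite -[lchord e]mul1g (@diffs_right _ _ (lchord e)) ?subrr // => x.
by rewrite /magnus hurwitzM hurwitz_chord_below.
Qed.

End Magnus.

(** * Combed words *)

Section CombedWords.
Variable k : nat.
Local Notation letter := ('I_k *l 'I_k)%type.
Local Notation W := (seqlexi letter).
Implicit Types (c : letter) (s t u v : seq letter) (l : W) (ll : seq W).

Lemma combed_rel_trans : transitive (@combed_rel k).
Proof. by move=> a b c ba cb; apply: leq_trans cb ba. Qed.

Lemma combed_subseq s t : subseq s t -> combed t -> combed s.
Proof.
move=> st /andP[vt ot]; apply/andP; split; last exact: (subseq_sorted combed_rel_trans st).
by apply/allP => c /(mem_subseq st); apply: (allP vt).
Qed.

Lemma combed_shuffle u v s : shuffle u v s -> combed s -> combed u /\ combed v.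
Proof.
by move=> uvs os; split; apply: combed_subseq os;
  [apply: shuffle_subseql uvs|apply: shuffle_subseqr uvs].
Qed.

Lemma combed_top m s : combed s -> all (fun c : letter => c.1 < m.+1)%N s ->
  s = [seq c : letter <- s | c.1 == m :> nat] ++ [seq c : letter <- s | (c.1 < m)%N].
Proof.
elim: s => //= c s IH /andP[/= /andP[vc vs] ps] /andP[cm sm].
have [cE|cN] := eqVneq (c.1 : nat) m.
  by rewrite cE ltnn /= -IH // /combed vs (path_sorted ps).
have cm' : (c.1 < m)%N by rewrite ltn_neqAle cN -ltnS.
have lt_m c' : c' \in s -> (c'.1 < m)%N.
  by move/(allP (order_path_min combed_rel_trans ps)) => h; apply: leq_ltn_trans h cm'.
rewrite cm' (_ : [seq c : letter <- s | c.1 == m :> nat] = [::]); last first.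
  by apply/eqP; rewrite -[_ == _]negbK -has_filter; apply/hasPn => x /lt_m h; rewrite ltn_eqF.
by rewrite (_ : [seq c : letter <- s | (c.1 < m)%N] = s) //; apply/all_filterP/allP.
Qed.

Lemma shuffle_filter (a : pred letter) u v s : shuffle u v s ->
  shuffle (filter a u) (filter a v) (filter a s).
Proof. by elim=> [|x u' v' s' _ IH|x u' v' s' _ IH] /=; [constructor| |]; case: (a x) => //;
  constructor. Qed.

Lemma pure_vanish : vanish 1 (fun x : braid k => (pure x)%:R).
Proof.
move=> h i x; rewrite /pure !braid_permM braid_permV.
have /eqP := pure_gen2 k i; rewrite braid_permM => e.
by rewrite -[(braid_perm (gen k i))^-1%g]mulg1 -e mulKg subrr.
Qed.

Lemma weight_pure s : all (@is_chord k) s -> weight (fun x : braid k => (pure x)%:R) s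
  = (s == [::])%:R.
Proof.
case: s => [_|c s vs]; first by rewrite weight_nil pure1.
by apply: (weight_vanish vs); apply: leq_vanish pure_vanish.
Qed.

(** Multiply the Magnus coefficients of the strands.  In a combed word the chords
    of the top strand [m] form a prefix [b], so a shuffle of [b] and a word [t'] on
    lower strands is combed only if it is [b ++ t'].  The constant [a] is the
    product, over the strands, of the numbers of shuffles that give this word. *)
Lemma magnus_monomial m t : (m <= k)%N -> combed t -> all (fun c : letter => c.1 < m)%N t ->
  exists f a, [/\ vanish (size t).+1 f, a != 0 &
    forall s, combed s -> size s = size t -> weight f s = a * (s == t)%:R].
Proof.
elim: m t => [|m IH] t mk ot tm.
  case: t ot tm => // _ _; exists (fun=> 1), 1; split=> //.
  by move=> s _ /size0nil ->; rewrite weight_nil eqxx mulr1.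
pose b := [seq c : letter <- t | c.1 == m :> nat]; pose t' :=
  [seq c : letter <- t | (c.1 < m)%N].
have def_t : t = b ++ t' by apply: combed_top.
have ot' : combed t' by apply: combed_subseq ot; apply: filter_subseq.
have t'm : all (fun c : letter => c.1 < m)%N t' by apply: filter_all.
have bm : all (fun c : letter => c.1 == m :> nat) b by apply: filter_all.
have ob : combed b by apply: combed_subseq ot; apply: filter_subseq.
have [f' [a' [vf' a'0 wf']]] := IH t' (ltnW mk) ot' t'm.
pose w := [seq (c.2 : nat) | c : letter <- b].
have wm : all (fun a => a < m)%N w.
  rewrite all_map; apply/allP => c cb /=; rewrite -(eqP (allP bm c cb)).
  by case/andP: ob => /allP vb _; apply: vb.
have wmag v : combed v -> weight (magnus m w) v = dirac b v.
  move=> ov; rewrite weight_magnus // /dirac.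
  have -> : [seq (m, a) | a <- w] = [seq (c.1 : nat, c.2 : nat) | c : letter <- b].
    by rewrite -map_comp; apply/eq_in_map => c /(allP bm) /eqP /= ->.
  rewrite (inj_eq (inj_map _)) // => -[x y] [x' y'] /= [e1 e2].
  by congr (_, _); apply: val_inj.
have szt : size t = (size b + size t')%N by rewrite {1}def_t size_cat.
have tb : shuffle t' b t by rewrite def_t; apply/shuffle_sym/shuffle_cat.
exists (fun x => f' x * magnus m w x), (a' * shuffle_prod (dirac t') (dirac b) t); split.
- suff -> : (size t).+1 = ((size t').+1 + (size w).+1).-1.
    exact: vanishM vf' (@magnus_vanish k m w).
  by rewrite size_map szt addSn addnS /= addnC.
- rewrite mulf_neq0 // gt_eqF // (shuffle_prod_gt0 _ _ tb) /dirac ?eqxx //; move=> ?;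
  exact: ler0n.
move=> s os sz; have vs : all (@is_chord k) s by case/andP: os.
rewrite (weight_mul vs vf' (@magnus_vanish k m w)); last first.
  by rewrite sz szt size_map addSn addnS addnC.
transitivity (shuffle_prod (fun u => a' * dirac t' u) (dirac b) s).
  apply: eq_shuffle_prod_shuffle => u v uvs; have [ou ov] := combed_shuffle uvs os.
  rewrite wmag //; have [vb|nvb] := eqVneq v b; last first.
    by rewrite /dirac (negPf nvb) !mulr0.
  rewrite wf' // /dirac; have := shuffle_size uvs; rewrite sz szt vb addnC.
  by move/addIn.
rewrite shuffle_prodZl -mulrA; congr (_ * _).
have [->|nst] := eqVneq s t; first by rewrite mulr1.
rewrite mulr0; apply: contraNeq nst => /shuffle_prod_support[u [v [uvs]]].
rewrite /dirac; case: (eqVneq u t') uvs => // -> uvs _; case: (eqVneq v b) uvs => // -> uvs _.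
have sm : all (fun c : letter => c.1 < m.+1)%N s.
  have : perm_eq (t' ++ b) s.
    elim: uvs {ot' t'm bm ob} => //= [x p q r _ |x p q r _ ]; first by rewrite perm_cons.
    by move=> IHp; rewrite -cat_rcons -cats1 -catA perm_catCA perm_cons.
  move/perm_all => <-; rewrite all_cat; apply/andP; split.
    by apply: sub_all t'm => c h; apply: leq_trans h _.
  by apply: sub_all bm => c /eqP ->.
rewrite (combed_top os sm) def_t; apply/eqP; congr (_ ++ _).
  have := shuffle_filter (fun c : letter => c.1 == m :> nat) uvs.
  rewrite (_ : filter _ t' = [::]); last first.
    by apply/eqP; rewrite -[_ == _]negbK -has_filter; apply/hasPn => x /(allP t'm) h;
      rewrite ltn_eqF.
  by rewrite (_ : filter _ b = b) => [/shuffle0s|]; last exact/all_filterP.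
have := shuffle_sym (shuffle_filter (fun c : letter => c.1 < m)%N uvs).
rewrite (_ : filter _ b = [::]); last first.
  by apply/eqP; rewrite -[_ == _]negbK -has_filter; apply/hasPn => x /(allP bm) /eqP ->;
    rewrite ltnn.
by rewrite (_ : filter _ t' = t') => [/shuffle0s|]; last exact/all_filterP.
Qed.

Lemma invariant_dual t : combed t ->
  exists2 v : pure_braid k -> rat, finite_type k (size t) v &
    forall s, combed s -> size s = size t -> weight (ext v) s = (s == t)%:R.
Proof.
move=> ot; have [|f [a [vf a0 wf]]] := magnus_monomial (leqnn k) ot.
  by apply/allP => c _; exact: ltn_ord.
pose v (p : pure_braid k) : rat := a^-1 * f (pure_braid_val p).
have extE : ext v = fun x => a^-1 * (f x * (pure x)%:R) + 0 * f x.
  apply/funext => x; rewrite mul0r addr0 /ext; case: insubP => [p px xE|npx].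
    by rewrite px mulr1 -xE.
  by rewrite (negPf npx) !mulr0.
have vv : vanish (size t).+1 (fun x => f x * (pure x)%:R).
  by have := vanishM vf pure_vanish; rewrite addn1.
exists v; first by apply/finite_typeP; rewrite extE; apply: vanish_lin.
move=> s os sz; have vs : all (@is_chord k) s by case/andP: os.
rewrite extE weight_lin mul0r addr0 (weight_mul vs vf pure_vanish) ?addn1 ?sz //.
rewrite (@eq_shuffle_prod_shuffle _ _ (weight f) _ (fun u => (u == [::])%:R)); last first.
  move=> u p up; congr (_ * _); apply: weight_pure.
  by have [_ /andP[]] := combed_shuffle up os.
by rewrite shuffle_prodC shuffle_prod_unitl wf // mulrA mulVf // mul1r.
Qed.

End CombedWords.

(** * Triangular families *)

Section Triangular.
Context {d : Order.disp_t} {X : orderType d}.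
Variable R : X -> X -> rat.

Lemma triangular_sorted (S : seq X) : sorted >%O S ->
    (forall c, c \in S -> R c c != 0) ->
    (forall c x, c \in S -> x \in S -> R c x != 0 -> (x <= c)%O) ->
  (forall F : X -> rat, exists b, forall x, x \in S -> F x = \sum_(c <- S) b c * R c x) /\
  (forall b, (forall x, x \in S -> \sum_(c <- S) b c * R c x = 0) ->
     forall c, c \in S -> b c = 0).
Proof.
elim: S => [|c S IH] srt nz tri; first by split=> [F|b _ c //]; exists (fun=> 0).
have gt_tr : transitive (>%O : rel X) by move=> x y z yx zy; apply: lt_trans zy yx.
have /allP ltS := order_path_min gt_tr srt.
have ltc x : x \in S -> (x < c)%O by move/ltS.
have R0 x : x \in S -> R x c = 0.
  move=> xS; apply/eqP; apply: contraTT (ltc x xS) => /tri.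
  by rewrite !inE xS orbT eqxx => /(_ isT isT); rewrite leNgt.
have cS : c \notin S by apply/negP => /ltc; rewrite ltxx.
have [||| IH1 IH2] := IH.
- exact: path_sorted srt.
- by move=> x xS; apply: nz; rewrite inE xS orbT.
- by move=> x y xS yS; apply: tri; rewrite inE ?xS ?yS orbT.
have sumc b : \sum_(x <- S) b x * R x c = 0.
  by rewrite big_seq big1 // => x xS; rewrite R0 ?mulr0.
split=> [F|b b0 x].
  pose bc := F c / R c c; have [b Fb] := IH1 (fun x => F x - bc * R c x).
  exists (fun x => if x == c then bc else b x) => x; rewrite inE big_cons eqxx.
  have -> : \sum_(j <- S) (if j == c then bc else b j) * R j x = \sum_(j <- S) b j * R j x.
    by apply: eq_big_seq => j jS; case: eqP => // jc; rewrite -jc jS in cS.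
  case/orP => [/eqP ->|xS]; last by rewrite -Fb // addrC subrK.
  by rewrite sumc addr0 /bc divfK // nz ?mem_head.
have bc0 : b c = 0.
  have := b0 c (mem_head _ _); rewrite big_cons sumc addr0 => /eqP.
  by rewrite mulf_eq0 (negPf (nz c (mem_head _ _))) orbF => /eqP.
rewrite inE => /orP[/eqP ->|] //; apply: IH2 => y yS.
by have := b0 y; rewrite inE yS orbT big_cons bc0 mul0r add0r; apply.
Qed.

Lemma triangular_basis (S : seq X) : uniq S ->
    (forall c, c \in S -> R c c != 0) ->
    (forall c x, c \in S -> x \in S -> R c x != 0 -> (x <= c)%O) ->
  (forall F : X -> rat, exists b, forall x, x \in S -> F x = \sum_(c <- S) b c * R c x) /\
  (forall b, (forall x, x \in S -> \sum_(c <- S) b c * R c x = 0) ->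
     forall c, c \in S -> b c = 0).
Proof.
move=> uS nz tri.
have perm : perm_eq (sort >=%O S) S by rewrite perm_sort.
have sum b x : \sum_(c <- S) b c * R c x = \sum_(c <- sort >=%O S) b c * R c x.
  by apply/esym/perm_big.
have [||| H1 H2] := @triangular_sorted (sort >=%O S).
- by rewrite -rev_sorted lt_sorted_uniq_le rev_uniq sort_uniq uS rev_sorted sort_sorted //;
  move=> x y; apply: le_total.
- by move=> c; rewrite mem_sort; apply: nz.
- by move=> c x; rewrite !mem_sort; apply: tri.
split=> [F|b b0 c].
  by have [b Fb] := H1 F; exists b => x xS; rewrite sum Fb ?mem_sort.
rewrite -(mem_sort >=%O) => cS; apply: H2 cS => x; rewrite mem_sort => xS.
by rewrite -sum b0.
Qed.

End Triangular.

(** * Lyndon monomials on combed words *)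

Section LyndonMonomials.
Variable k : nat.
Local Notation letter := ('I_k *l 'I_k)%type.
Local Notation W := (seqlexi letter).
Implicit Types (s t u v : seq letter) (l : W) (ll : seq W).

Definition factors (s : W) : seq W := sval (cid2 (lyndon_factorization s)).

Lemma factors_lyndon s : lyndon_seq (factors s).
Proof. by rewrite /factors; case: cid2. Qed.

Lemma factorsK s : lcat (factors s) = s.
Proof. by rewrite /factors; case: cid2. Qed.

Lemma factors_lcat ll : lyndon_seq ll -> factors (lcat ll) = ll.
Proof. by move=> good; apply: lcat_inj (factorsK _); first exact: factors_lyndon. Qed.

Lemma factors1 l : lyndon l -> factors l = [:: l].
Proof.
move=> lyl; rewrite -{1}[l]cat0s -[([::] ++ l)]/(lcat [:: l]) factors_lcat //.
by rewrite /lyndon_seq /= lyl.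
Qed.

(** A Lyndon word is at most its last letter, so the strand of its first letter
    is at most that of its last one, while in combed words strands decrease. *)
Lemma lyndon_combed_strand l c0 : lyndon l -> combed l ->
  all (fun c : letter => c.1 == (head c0 l).1) l.
Proof.
case: l => // x l /lyndonP[_ min_l] /andP[_ ps]; rewrite /= eqxx.
apply/allP => c cl; rewrite eq_le; apply/andP; split.
  exact: (allP (order_path_min (@combed_rel_trans k) ps) c cl).
case/splitPr: cl min_l ps => l1 l2 min_l ps.
have := min_l (x :: l1) (c :: l2) erefl isT.
by rewrite lexi_cons => /andP[]; rewrite leEprodlexi => /andP[].
Qed.

(** A larger Lyndon word starts on a strand that is at least as large, so the
    decreasing factorization reads the strands in decreasing order. *)
Lemma lcat_combed ll : lyndon_seq ll -> all (@combed k) ll -> combed (lcat ll).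
Proof.
elim: ll => // l ll IH good /andP[ol oll].
have good' : lyndon_seq ll.
  by case/andP: good => /= /andP[_ a] /path_sorted b; rewrite /lyndon_seq a.
have /andP[vll sll] := IH good' oll; have /andP[vl sl] := ol.
apply/andP; split; first by rewrite all_cat vll.
rewrite (sorted_pairwise (@combed_rel_trans k)) pairwise_cat.
rewrite -!(sorted_pairwise (@combed_rel_trans k)) sll sl !andbT.
apply/allrelP => x y xll yl.
have {xll} [l' l'll xl'] : exists2 l', l' \in ll & x \in l'.
  elim: (ll) xll => //= l' ll' IHl; rewrite mem_cat => /orP[/IHl[l'' h h']|h].
    by exists l''; rewrite // inE h orbT.
  by exists l'; rewrite ?mem_head.
have lyl : lyndon l by case/andP: good => /andP[].
have lyl' : lyndon l' by case/andP: good' => /allP /(_ _ l'll).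
have ll' : (l <= l')%O.
  by case/andP: good => _ /= /(order_path_min le_trans) /allP /(_ _ l'll).
have ol' : combed l' by move/allP: oll => /(_ l' l'll).
have := lyndon_combed_strand x lyl ol; have := lyndon_combed_strand x lyl' ol'.
case: l ll' yl {good lyl ol vl sl} => // a l;
  case: l' xl' {l'll lyl' ol'} => // a' l' xl' ll' yl.
move=> /allP/(_ _ xl')/eqP xE /allP/(_ _ yl)/eqP yE; rewrite /= in xE yE.
rewrite /combed_rel xE yE; move: ll'; rewrite lexi_cons => /andP[+ _].
by rewrite leEprodlexi => /andP[].
Qed.

Lemma factors_combed s l : combed s -> l \in factors s -> combed l.
Proof.
move=> os ls; apply: combed_subseq os; rewrite -[X in subseq _ X]factorsK.
elim: (factors s) ls => //= l' ll IH; rewrite inE => /orP[/eqP ->|/IH h].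
  exact: suffix_subseq.
exact: subseq_trans h (prefix_subseq _ _).
Qed.

Definition monomial (s : W) : W -> rat := lyndon_prod (factors s).

Lemma monomial_lyndon l : lyndon l -> monomial l =1 dirac l.
Proof. by move=> lyl s; rewrite /monomial factors1 // lyndon_prod1. Qed.

Lemma monomial_size s t : monomial s t != 0 -> size t = size s.
Proof. by move/lyndon_prod_size; rewrite factorsK. Qed.

(** Merge the two factorizations; the result has at least two factors. *)
Lemma monomial_mul s t : combed s -> combed t -> s != [::] -> t != [::] ->
  exists e : W, [/\ combed e, size e = (size s + size t)%N, ~~ lyndon e &
    shuffle_prod (monomial s) (monomial t) =1 monomial e].
Proof.
move=> os ot s0 t0; pose ll : seq W := sort <=%O (factors s ++ factors t).
have perm : perm_eq ll (factors s ++ factors t) by rewrite perm_sort.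
have good : lyndon_seq ll.
  rewrite /lyndon_seq (perm_all _ perm) all_cat.
  have /andP[-> _] := factors_lyndon s; have /andP[-> _] := factors_lyndon t.
  by apply: sort_sorted; apply: le_total.
have szc (l1 l2 : seq W) : perm_eq l1 l2 -> size (lcat l1) = size (lcat l2).
  have E (l3 : seq W) : size (lcat l3) = (\sum_(l <- l3) size (l : seq letter))%N.
    by elim: l3 => [|l l3 IH]; rewrite ?big_nil // big_cons /= size_cat IH addnC.
  by move=> p; rewrite !E; apply: perm_big.
have lcat_cat (l1 l2 : seq W) : lcat (l1 ++ l2) = (lcat l2 ++ lcat l1)%SEQ.
  by elim: l1 => [|l l1 IH] /=; rewrite ?cats0 // IH catA.
have fs0 r : r != [::] -> (0 < size (factors r))%N.
  by move=> r0; rewrite lt0n size_eq0; apply: contra r0 => /eqP h; rewrite -[r]factorsK h.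
exists (lcat ll); split.
- apply: lcat_combed => //; rewrite (perm_all _ perm) all_cat; apply/andP; split;
    by apply/allP => l; apply: factors_combed.
- by rewrite (szc _ _ perm) lcat_cat size_cat !factorsK addnC.
- apply/negP => lye; have ll1 : size ll = 1%N by rewrite -(factors_lcat good) factors1.
  have := perm_size perm; rewrite size_cat ll1 => e1.
  have h1 := fs0 _ s0; have h2 := fs0 _ t0.
  by have := leq_add h1 h2; rewrite -e1.
move=> r; rewrite /monomial factors_lcat // (lyndon_prod_perm perm).
by rewrite lyndon_prod_cat.
Qed.

Definition combed_words n : seq W := [seq s <- words (enum {: letter}) n | combed s].

Lemma mem_combed_words n s : (s \in combed_words n) = (size s == n) && combed s.
Proof.
rewrite mem_filter mem_words andbC; congr (_ && _); rewrite -[RHS]andbT; congr (_ && _).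
by apply/allP => c _; rewrite /= mem_enum.
Qed.

Lemma combed_words_uniq n : uniq (combed_words n).
Proof. exact/filter_uniq/words_uniq/enum_uniq. Qed.

(** The monomial of [c] is positive at [c] and vanishes at larger words. *)
Lemma monomial_basis n :
  (forall F : W -> rat, exists b, forall s : W, s \in combed_words n ->
     F s = \sum_(c <- combed_words n) b c * monomial c s) /\
  (forall b, (forall s : W, s \in combed_words n ->
       \sum_(c <- combed_words n) b c * monomial c s = 0) ->
     forall c, c \in combed_words n -> b c = 0).
Proof.
apply: (triangular_basis (R := monomial)); first exact: combed_words_uniq.
- move=> c _; rewrite gt_eqF // /monomial -{2}[c]factorsK.
  exact: lyndon_prod_lcat_gt0.
- move=> c x _ _ /(lyndon_prod_le_lcat (factors_lyndon c)).
  by rewrite factorsK.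
Qed.

(** The decomposable part of degree [n]: the span of the monomials with at least
    two Lyndon factors. *)
Definition decomp n (F : W -> rat) : Prop := exists b : W -> rat,
  forall s : W, s \in combed_words n ->
    F s = \sum_(c <- combed_words n | ~~ lyndon c) b c * monomial c s.

Lemma decomp_lin n a b F G : decomp n F -> decomp n G ->
  decomp n (fun s => a * F s + b * G s).
Proof.
move=> [bF eF] [bG eG]; exists (fun c => a * bF c + b * bG c) => s sn.
rewrite eF // eG // !mulr_sumr -big_split; apply: eq_bigr => c _ /=.
by ring.
Qed.

Lemma decomp0 n F : (forall s : W, s \in combed_words n -> F s = 0) -> decomp n F.
Proof. by move=> F0; exists (fun=> 0) => s sn; rewrite F0 // big1 // => c _;
  rewrite mul0r. Qed.

Lemma eq_decomp n F G : (forall s : W, s \in combed_words n -> F s = G s) ->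
  decomp n F -> decomp n G.
Proof. by move=> FG [b Fb]; exists b => s sn; rewrite -FG // Fb. Qed.

Lemma decomp_sum_in n (r : seq W) (a : W -> rat) (F : W -> W -> rat) :
  (forall i, i \in r -> decomp n (F i)) ->
  decomp n (fun s => \sum_(i <- r) a i * F i s).
Proof.
elim: r => [|i r IH] dF; first by apply: decomp0 => s _; rewrite big_nil.
have dr : decomp n (fun s => \sum_(i <- r) a i * F i s).
  by apply: IH => j jr; apply: dF; rewrite inE jr orbT.
apply: eq_decomp (decomp_lin (a i) 1 (dF i (mem_head _ _)) dr) => s _.
by rewrite big_cons mul1r.
Qed.

Lemma decomp_monomial n e : e \in combed_words n -> ~~ lyndon e -> decomp n (monomial e).
Proof.
move=> en nle; exists (fun c => (c == e)%:R) => s sn.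
have uS : uniq [seq c <- combed_words n | ~~ lyndon c] by exact/filter_uniq/combed_words_uniq.
have eS : e \in [seq c <- combed_words n | ~~ lyndon c] by rewrite mem_filter nle.
rewrite -big_filter (bigD1_seq e eS uS) /=.
by rewrite eqxx mul1r big1 ?addr0 // => c /negPf ->; rewrite mul0r.
Qed.

Definition degree_le a (F : W -> rat) := forall s, combed s -> (a < size s)%N -> F s = 0.

(** A shuffle of length [a + b] of words with other lengths contains one that is
    too long. *)
Lemma shuffle_prod_top a b F F' G G' s : degree_le a F -> degree_le a F' ->
    degree_le b G -> degree_le b G' ->
    (forall u, u \in combed_words a -> F u = F' u) ->
    (forall v, v \in combed_words b -> G v = G' v) ->
  s \in combed_words (a + b)%N -> shuffle_prod F G s = shuffle_prod F' G' s.
Proof.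
move=> dF dF' dG dG' eF eG; rewrite mem_combed_words => /andP[/eqP sz os].
apply: eq_shuffle_prod_shuffle => u v uvs; have [ou ov] := combed_shuffle uvs os.
have := shuffle_size uvs; rewrite sz => szuv.
case: (ltngtP (size u) a) => ua.
- have vb : (b < size v)%N by move: szuv ua => /=; lia.
  by rewrite dG // dG' // !mulr0.
- by rewrite dF // dF' // !mul0r.
have vb : size v = b by apply/eqP; rewrite -(eqn_add2l a) -{1}ua szuv.
by rewrite eF ?eG // mem_combed_words ?ua ?vb ?eqxx.
Qed.

Lemma monomial_degree a c : c \in combed_words a -> degree_le a (monomial c).
Proof.
rewrite mem_combed_words => /andP[/eqP <- _] s _.
by apply: contraTeq => /monomial_size ->; rewrite ltnn.
Qed.

(** Expand both factors into monomials and multiply. *)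
Lemma decomp_shuffle_prod a b F G : (0 < a)%N -> (0 < b)%N ->
  degree_le a F -> degree_le b G -> decomp (a + b)%N (shuffle_prod F G).
Proof.
move=> a0 b0 dF dG.
have [bF eF] := (monomial_basis a).1 F; have [bG eG] := (monomial_basis b).1 G.
pose S n' (B : W -> rat) (u : W) := \sum_(c <- combed_words n') B c * monomial c u.
have dS n' (B : W -> rat) : degree_le n' (S n' B).
  move=> s os sz; rewrite /S big_seq big1 // => c cn.
  by rewrite (monomial_degree cn) ?mulr0.
apply: (@eq_decomp _ (shuffle_prod (S a bF) (S b bG))).
  by move=> s sn; apply/esym/(shuffle_prod_top dF (dS _ _) dG (dS _ _) eF eG sn).
apply: (@eq_decomp _ (fun s => \sum_(c <- combed_words a) bF c *
    \sum_(e <- combed_words b) bG e * shuffle_prod (monomial c) (monomial e) s)).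
  move=> s _; rewrite shuffle_prod_suml; apply: eq_bigr => c _; congr (_ * _).
  by rewrite shuffle_prodC shuffle_prod_suml; apply: eq_bigr => e _; rewrite shuffle_prodC.
apply: decomp_sum_in => c ca; apply: decomp_sum_in => e eb.
move: ca eb; rewrite !mem_combed_words => /andP[/eqP sc oc] /andP[/eqP se oe].
have nil0 m (r : W) : size r = m -> (0 < m)%N -> r != [::] by move=> <-; rewrite lt0n size_eq0.
have [x [ox sx nlx E]] := monomial_mul oc oe (nil0 _ _ sc a0) (nil0 _ _ se b0).
apply: (eq_decomp (F := monomial x)); first by move=> s _; rewrite E.
by apply: decomp_monomial nlx; rewrite mem_combed_words ox sx sc se eqxx.
Qed.

End LyndonMonomials.

(** * The space of indecomposable invariants *)

Section Indecomposables.
Variable k : nat.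
Local Notation letter := ('I_k *l 'I_k)%type.
Local Notation W := (seqlexi letter).
Local Notation inv := (pure_braid k -> rat^o).
Implicit Types (u v : inv).

Lemma weight_ext_lin a b u v s :
  weight (ext (a *: u + b *: v)) s = a * weight (ext u) s + b * weight (ext v) s.
Proof.
rewrite -weight_lin; congr (weight _ _); apply/funext => x.
by rewrite -(ext_lin a b u v).
Qed.

Lemma weight_degree n v : finite_type k n v -> degree_le n (weight (ext v)).
Proof.
move=> /finite_typeP ft s /andP[vs _] sz.
exact: weight_vanish vs (leq_vanish sz ft).
Qed.

Lemma finite_type_lin n a b u v : finite_type k n u -> finite_type k n v ->
  finite_type k n (a *: u + b *: v).
Proof.
move=> /finite_typeP fu /finite_typeP fv; apply/finite_typeP.
apply: eq_vanish (vanish_lin a b fu fv) => x; exact/esym/ext_lin.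
Qed.

Lemma finite_type0 n : finite_type k n (0 : inv).
Proof. by move=> w _ _; rewrite /linear_extension big1 // => x _; rewrite mulr0. Qed.

Lemma finite_type_sum n (I : Type) (r : seq I) (F : I -> inv) :
  (forall i, finite_type k n (F i)) -> finite_type k n (\sum_(i <- r) F i).
Proof.
move=> fF; elim/big_ind: _ => // [|u v fu fv]; first exact: finite_type0.
by have := finite_type_lin 1 1 fu fv; rewrite !scale1r.
Qed.

Lemma finite_typeM a b u v : finite_type k a u -> finite_type k b v ->
  finite_type k (a + b)%N (u * v).
Proof.
move=> /finite_typeP fu /finite_typeP fv; apply/finite_typeP.
have vv := vanishM fu fv; rewrite addSn addnS in vv.
by apply: (eq_vanish _ vv) => x; apply/esym/extM.
Qed.

Lemma finite_type_pred_sub n v : finite_type_pred k n v -> finite_type k n v.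
Proof. by move/finite_type_predP => vv; apply/finite_typeP/vanishS. Qed.

Lemma weightM a b u v (s : W) : finite_type k a u -> finite_type k b v ->
  s \in combed_words k (a + b)%N ->
  weight (ext (u * v)) s = shuffle_prod (weight (ext u)) (weight (ext v)) s.
Proof.
move=> /finite_typeP fu /finite_typeP fv.
rewrite mem_combed_words => /andP[/eqP sz /andP[vs _]].
rewrite -(weight_mul vs fu fv) ?sz ?addSn ?addnS //.
by congr (weight _ _); apply/funext => x; apply: extM.
Qed.

Lemma finite_type_detect n v : finite_type k n v ->
  (forall s : W, s \in combed_words k n -> weight (ext v) s = 0) ->
  finite_type_pred k n v.
Proof.
move=> /finite_typeP fv w0; apply/finite_type_predP.
apply: weight_detect fv _ _ => [x|s sz os]; first exact: ext_npure.
by apply: w0; rewrite mem_combed_words sz eqxx.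
Qed.

(** Combine the invariants dual to the single combed words. *)
Lemma invariant_realize n (F : W -> rat) : exists2 v : inv, finite_type k n v &
  forall s : W, s \in combed_words k n -> weight (ext v) s = F s.
Proof.
have dual (t : W) : exists v : inv, t \in combed_words k n ->
    finite_type k n v /\
    forall s : W, s \in combed_words k n -> weight (ext v) s = (s == t)%:R.
  have [tn|tn] := boolP (t \in combed_words k n); last by exists 0.
  move: tn; rewrite mem_combed_words => /andP[/eqP sz ot].
  have [v ftv wv] := invariant_dual ot; exists v => _; split; first by rewrite -sz.
  by move=> s; rewrite mem_combed_words => /andP[/eqP sn os]; rewrite wv // sn sz.
have [g gP] := choice dual.
suff [v [ftv wv]] : exists v : inv, finite_type k n v /\ forall s : W,
    s \in combed_words k n ->
      weight (ext v) s = \sum_(t <- combed_words k n) F t * (s == t)%:R.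
  exists v => // s sn; rewrite wv // (bigD1_seq s) ?combed_words_uniq //=.
  rewrite eqxx mulr1 big1 ?addr0 // => t /negPf ts.
  by rewrite eq_sym ts mulr0.
have : {subset combed_words k n <= combed_words k n} by [].
elim: {1 4}(combed_words k n) => [|t r IH] sub.
  exists 0; split=> [|s _]; first exact: finite_type0.
  by have := weight_ext_lin 0 0 0 0 s; rewrite !scale0r addr0 big_nil !mul0r addr0.
have [|v [ftv wv]] := IH; first by move=> x xr; apply: sub; rewrite inE xr orbT.
have [ftt wt] := gP t (sub t (mem_head _ _)).
exists (F t *: g t + 1 *: v); split; first exact: finite_type_lin.
by move=> s sn; rewrite weight_ext_lin wt // wv // big_cons mul1r.
Qed.

Lemma decomposable_decomp n v : (0 < n)%N -> decomposable k n v ->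
  finite_type k n v /\ decomp n (weight (ext v)).
Proof.
move=> n0.
pose P v := finite_type k n v /\ decomp n (weight (ext v)).
have PD u1 u2 : P u1 -> P u2 -> P (u1 + u2).
  move=> [f1 d1] [f2 d2]; split.
    by have := finite_type_lin 1 1 f1 f2; rewrite !scale1r.
  apply: (eq_decomp _ (decomp_lin 1 1 d1 d2)) => s _.
  by rewrite -weight_ext_lin !scale1r.
have P0 : P 0.
  split; first exact: finite_type0.
  by apply: decomp0 => s _; have := weight_ext_lin 0 0 0 0 s;
    rewrite !scale0r addr0 !mul0r addr0.
case=> u fu [p [m [x [y [gx gy ->]]]] <-]; apply: (PD u).
  split; first exact: finite_type_pred_sub.
  apply: decomp0 => s; rewrite mem_combed_words => /andP[/eqP sz /andP[vs _]].
  by apply: (weight_vanish vs); rewrite sz; apply/finite_type_predP.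
rewrite coef_sum; elim/big_ind: _ => // j _; rewrite coefM.
elim/big_ind: _ => // i _.
have [x0 fx] := gx j; have [y0 fy] := gy j.
case: (posnP i) => [->|i0]; first by rewrite x0 mul0r.
case: (posnP (n - i)) => [->|ni0]; first by rewrite y0 mulr0.
have def_n : (i + (n - i))%N = n by rewrite subnKC // -ltnS ltn_ord.
split; first by rewrite -[X in finite_type k X]def_n; apply: finite_typeM.
rewrite -[X in decomp X]def_n.
apply: (eq_decomp (F := shuffle_prod (weight (ext (x j)`_i)) (weight (ext (y j)`_(n - i))))).
  by move=> s sn; rewrite (weightM (fx _) (fy _)).
by apply: decomp_shuffle_prod => //; apply: weight_degree.
Qed.

(** Split off the last Lyndon factor and realize both parts by invariants of
    lower type. *)
Lemma monomial_product n (c : W) a : c \in combed_words k n -> c != [::] -> ~~ lyndon c ->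
  exists x y : {poly (pure_braid k -> rat)}, [/\ gr_positive k x, gr_positive k y,
    finite_type k n (x * y)`_n &
    forall s : W, s \in combed_words k n ->
      weight (ext (x * y)`_n) s = a * monomial c s].
Proof.
rewrite mem_combed_words => /andP[/eqP sz oc] c0 nlc.
case E : (factors c) (factors_lyndon c) (factorsK c) => [|l ll] good cE.
  by rewrite -cE in c0.
have lyl : lyndon l by case/andP: good => /andP[].
have ll0 : ll != [::].
  by apply: contraNneq nlc => ll0; rewrite -cE ll0 /=.
have good' : lyndon_seq ll.
  by case/andP: good => /= /andP[_ p] /path_sorted q; rewrite /lyndon_seq p.
pose p := size (lcat ll); pose q := size (l : seq letter).
have q0 : (0 < q)%N by rewrite lt0n size_eq0; case/lyndonP: lyl.
have p0 : (0 < p)%N.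
  rewrite lt0n size_eq0; apply: contra ll0 => /eqP e.
  by rewrite -(factors_lcat good') e -[[::]]/(lcat [::]) (@factors_lcat k [::]).
have pq : (p + q)%N = n by rewrite -sz -cE /= size_cat.
have [f ff wf] := invariant_realize p (fun s => a * lyndon_prod ll s).
have [g fg wg] := invariant_realize q (dirac l).
pose x : {poly (pure_braid k -> rat)} := (f : pure_braid k -> rat) *: 'X^p.
pose y : {poly (pure_braid k -> rat)} := (g : pure_braid k -> rat) *: 'X^q.
have pos m (h : inv) : (0 < m)%N -> finite_type k m h ->
    gr_positive k ((h : pure_braid k -> rat) *: 'X^m).
  move=> m0 fh; split; first by rewrite coefZ coefXn eq_sym gtn_eqF // mulr0.
  move=> i; rewrite coefZ coefXn; case: eqP => [->|_]; first by rewrite mulr1.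
  by rewrite mulr0; apply: finite_type0.
have xyn : (x * y)`_n = f * g.
  rewrite -scalerAl coefZ coefXnM -pq ltnNge leq_addr /= addKn.
  by rewrite coefZ coefXn eqxx mulr1.
exists x, y; rewrite xyn; split; [exact: pos|exact: pos| |].
  by rewrite -pq; apply: finite_typeM.
move=> s; rewrite -{1}pq => sn; rewrite (weightM ff fg sn).
rewrite /monomial E /= -shuffle_prodZl; apply: (shuffle_prod_top _ _ _ _ wf wg sn).
- exact: weight_degree.
- move=> r _ pr; rewrite [lyndon_prod ll r](_ : _ = 0) ?mulr0 //.
  by apply: contraTeq pr => /lyndon_prod_size ->; rewrite ltnn.
- exact: weight_degree.
- by move=> r _ qr; rewrite /dirac; case: eqP qr => // ->; rewrite ltnn.
Qed.

Lemma ext_sum_weight (I : Type) (r : seq I) (F : I -> inv) s :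
  weight (ext (\sum_(i <- r) F i)) s = \sum_(i <- r) weight (ext (F i)) s.
Proof.
elim: r => [|i r IH].
  by rewrite !big_nil; have := weight_ext_lin 0 0 0 0 s; rewrite !scale0r addr0 !mul0r addr0.
by rewrite !big_cons -IH; have := weight_ext_lin 1 1 (F i) (\sum_(j <- r) F j) s;
  rewrite !scale1r !mul1r.
Qed.

Lemma decomp_decomposable n v : (0 < n)%N -> finite_type k n v ->
  decomp n (weight (ext v)) -> decomposable k n v.
Proof.
move=> n0 fv [b Eb].
pose S := [seq c <- combed_words k n | ~~ lyndon c].
have factor (c : W) : exists xy : {poly (pure_braid k -> rat)} * {poly (pure_braid k -> rat)},
    [/\ gr_positive k xy.1, gr_positive k xy.2,
    finite_type k n (xy.1 * xy.2)`_n & c \in S ->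
    forall s : W, s \in combed_words k n ->
      weight (ext (xy.1 * xy.2)`_n) s = b c * monomial c s].
  have [cS|ncS] := boolP (c \in S); last first.
    exists (0, 0); rewrite /= mul0r coef0.
    have pos0 : gr_positive k 0 by split=> [|i]; rewrite coef0 //; apply: finite_type0.
    by split=> //; apply: finite_type0.
  move: cS; rewrite mem_filter => /andP[nlc cn].
  have c0 : c != [::].
    by apply: contraTneq cn => ->; rewrite mem_combed_words /= eq_sym gtn_eqF.
  have [x [y [gx gy fxy wxy]]] := monomial_product (b c) cn c0 nlc.
  by exists (x, y).
have [xy xyP] := choice factor.
pose p := \sum_(c <- S) (xy c).1 * (xy c).2.
have pn : p`_n = \sum_(c <- S) ((xy c).1 * (xy c).2)`_n by rewrite coef_sum.
exists (v - p`_n : inv); last first.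
  exists p; last by rewrite subrK.
  exists (size S), (fun j => (xy (tnth (in_tuple S) j)).1), (fun j => (xy (tnth (in_tuple S)
    j)).2).
  split=> [j|j|]; [by case: (xyP (tnth (in_tuple S) j))|by case: (xyP (tnth (in_tuple S) j))|].
  by rewrite /p big_tnth.
have fp : finite_type k n p`_n.
  by rewrite pn; apply: finite_type_sum => c; case: (xyP c).
apply: finite_type_detect.
  by have := finite_type_lin 1 (-1) fv fp; rewrite scale1r scaleN1r.
move=> s sn; have := weight_ext_lin 1 (-1) v p`_n s; rewrite scale1r scaleN1r => ->.
rewrite pn ext_sum_weight mul1r mulN1r Eb // -[X in X - _]big_filter.
rewrite -sumrB big_seq big1 // => c cS.
by case: (xyP c) => _ _ _ /(_ cS s sn) ->; rewrite subrr.
Qed.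

Lemma decomposableP n v : (0 < n)%N ->
  decomposable k n v <-> finite_type k n v /\ decomp n (weight (ext v)).
Proof.
move=> n0; split; first exact: decomposable_decomp.
by case; apply: decomp_decomposable.
Qed.

(** Monomials with a single factor are the delta functions of combed Lyndon
    words; the others span the decomposable part. *)
Lemma indecomposable_dim_lyndon n : (0 < n)%N ->
  indecomposable_dim k n (size [seq l <- combed_words k n | lyndon l]).
Proof.
move=> n0; set L := [seq l <- _ | _]; set d := size L.
have dual (l : W) : exists v : inv, finite_type k n v /\
    forall s : W, s \in combed_words k n -> weight (ext v) s = dirac l s.
  by have [v fv wv] := invariant_realize n (dirac l); exists v.
have [e eP] := choice dual.
pose Li (i : 'I_d) : W := tnth (in_tuple L) i.
have uL : uniq L by exact/filter_uniq/combed_words_uniq.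
have Li_inj : injective Li by move=> i j; apply/tuple_uniqP.
have lynL i : lyndon (Li i) /\ Li i \in combed_words k n.
  by have := mem_tnth i (in_tuple L); rewrite mem_filter => /andP[].
exists (fun i => e (Li i)); split=> [i|u fu]; first by case: (eP (Li i)).
have wsum (c : 'I_d -> rat) (s : W) : s \in combed_words k n ->
    weight (ext (u - \sum_(i < d) c i *: e (Li i))) s
      = weight (ext u) s - \sum_(i < d) c i * dirac (Li i) s.
  move=> sn; have := weight_ext_lin 1 (-1) u (\sum_(i < d) c i *: e (Li i)) s.
  rewrite scale1r scaleN1r mul1r mulN1r ext_sum_weight => ->.
  congr (_ - _); apply: eq_bigr => i _.
  have := weight_ext_lin (c i) 0 (e (Li i)) 0 s.
  by rewrite scale0r addr0 mul0r addr0 => ->; rewrite (eP (Li i)).2.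
have fsum (c : 'I_d -> rat) : finite_type k n (u - \sum_(i < d) c i *: e (Li i)).
  have fs : finite_type k n (\sum_(i < d) c i *: e (Li i)).
    apply: finite_type_sum => i.
    have := finite_type_lin (c i) 0 (eP (Li i)).1 (@finite_type0 n).
    by rewrite scale0r addr0.
  by have := finite_type_lin 1 (-1) fu fs; rewrite scale1r scaleN1r.
have sum_lyndon (B : W -> rat) (s : W) :
    \sum_(c <- combed_words k n | lyndon c) B c * monomial c s
      = \sum_(i < d) B (Li i) * dirac (Li i) s.
  rewrite -big_filter big_tnth; apply: eq_bigr => i _.
  by rewrite -(monomial_lyndon (lynL i).1).
have [basis uniq_basis] := monomial_basis k n.
have [B EB] := basis (weight (ext u)).
exists [ffun i => B (Li i)]; split.
  apply/(decomposableP _ n0); split; first exact: fsum.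
  exists B => s sn; rewrite wsum // EB // (bigID (@lyndon _ letter)) /= sum_lyndon.
  by under [X in _ - X]eq_bigr => i _ do rewrite ffunE; rewrite addrAC subrr add0r.
move=> c /(decomposableP _ n0)[_ [B' EB']].
pose C (x : W) := if lyndon x then \sum_(i < d) (x == Li i)%:R * c i else B' x.
have CL i : C (Li i) = c i.
  rewrite /C (lynL i).1 (bigD1 i) //= eqxx mul1r big1 ?addr0 // => j ji.
  by rewrite (inj_eq Li_inj) eq_sym (negPf ji) mul0r.
apply/ffunP => i; rewrite ffunE -CL; apply/eqP; rewrite -subr_eq0; apply/eqP.
apply: (uniq_basis (fun x => B x - C x)); last exact: (lynL i).2.
move=> s sn; under eq_bigr => x _ do rewrite mulrBl.
rewrite sumrB -EB //; apply/eqP; rewrite subr_eq0; apply/eqP.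
have := EB' s sn; rewrite wsum // => /eqP; rewrite subr_eq => /eqP ->.
rewrite [RHS](bigID (@lyndon _ letter)) /= sum_lyndon addrC; congr (_ + _).
  by apply: eq_bigr => x nlx; rewrite /C (negPf nlx).
by apply: eq_bigr => j _; rewrite CL.
Qed.

End Indecomposables.

(** * The dimension *)

Section Dimension.
Variable k : nat.
Local Notation letter := ('I_k *l 'I_k)%type.
Local Notation W := (seqlexi letter).

Definition strand_letters (j : 'I_k) : seq letter :=
  [seq (j, a) | a : 'I_k <- enum 'I_k & (a < j)%N].

Lemma strand_letters_uniq j : uniq (strand_letters j).
Proof.
rewrite map_inj_uniq; first by apply: filter_uniq; exact: enum_uniq.
by move=> a b [].
Qed.

Lemma size_strand_letters j : size (strand_letters j) = j.
Proof.
rewrite size_map size_filter -sum1_count big_enum_cond /=.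
rewrite (eq_bigl (fun a : 'I_k => (a < j)%N)) // -(big_ord_widen k (fun=> 1%N)) ?sum1_card
  ?card_ord //.
exact/ltnW/ltn_ord.
Qed.

Lemma mem_strand_letters j (c : letter) :
  (c \in strand_letters j) = is_chord c && (c.1 == j).
Proof.
case: c => x a; rewrite /is_chord /=; apply/mapP/andP => [[b]|[ax /eqP <-]].
  by rewrite mem_filter => /andP[bj _] [-> ->].
by exists a; rewrite // mem_filter ax mem_enum.
Qed.

(** Sort the combed Lyndon words by their strand. *)
Lemma size_combed_lyndon n : (0 < n)%N ->
  size [seq l <- combed_words k n | lyndon l]
    = (\sum_(j < k) size (lyndon_words (strand_letters j) n))%N.
Proof.
move=> n0.
pose L : seq W := [seq l | j <- enum 'I_k, l <- lyndon_words (strand_letters j) n].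
have strandP j (l : W) : all (mem (strand_letters j)) l ->
    all (@is_chord k) l /\ forall c, c \in l -> c.1 = j.
  move=> /allP lj; split=> [|c cl]; first apply/allP => c cl.
    by have := lj c cl; rewrite /= mem_strand_letters => /andP[].
  by have := lj c cl; rewrite /= mem_strand_letters => /andP[_ /eqP].
have perm : perm_eq [seq l <- combed_words k n | lyndon l] L.
  apply: uniq_perm; first exact/filter_uniq/combed_words_uniq.
    apply: allpairs_uniq_dep; first exact: enum_uniq.
      by move=> j _; apply/filter_uniq/words_uniq/strand_letters_uniq.
    move=> [j l] [j' l'] /allpairsPdep[x [y [_ ylyn E1]]] /allpairsPdep[x' [y' [_ ylyn' E2]]]
      /= e.
    move: e; case: E1 => -> ->; case: E2 => -> -> /= e; rewrite -e in ylyn' *.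
    move: ylyn ylyn'; rewrite !mem_lyndon_words => /and3P[_ /eqP sz xy] /and3P[_ _ xy'].
    case: y sz xy xy' {e} => [sz|c y _ /strandP[_ h] /strandP[_ h']].
      by rewrite -sz in n0.
    by rewrite -(h c (mem_head _ _)) -(h' c (mem_head _ _)).
  move=> l; rewrite mem_filter mem_combed_words; apply/and3P/allpairsPdep.
    case=> lyl sz ol; case: l lyl sz ol => // c l lyl sz ol.
    exists c.1, (c :: l); split=> //; rewrite ?mem_enum // mem_lyndon_words lyl sz.
    apply/allP => c' c'l; rewrite /= mem_strand_letters.
    have := lyndon_combed_strand c lyl ol; move/allP => /(_ _ c'l) /= ->.
    by case/andP: ol => /allP /(_ _ c'l) ->.
  case=> j [l' [_ + ->]]; rewrite mem_lyndon_words => /and3P[lyl sz lj].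
  have [vl lj'] := strandP _ _ lj; split=> //; apply/andP; split=> //.
  case: (l') lj' => // c t ct; apply/(pathP c) => i it.
  have e1 : (nth c t i).1 = j by apply: ct; rewrite inE mem_nth ?orbT.
  have e2 : (nth c (c :: t) i).1 = j by apply: ct; rewrite mem_nth // ltnW.
  by rewrite /combed_rel e1 e2.
by rewrite (perm_size perm) size_allpairs_dep sumnE big_map big_enum.
Qed.

Lemma lyndon_formula n (j : 'I_k) : (0 < n)%N ->
  (n%:R : rat) * (size (lyndon_words (strand_letters j) n))%:R
    = \sum_(m <- divisors n) (moebius (n %/ m))%:~R * j%:R ^+ m.
Proof.
move=> n0; pose g m : rat := m%:R * (size (lyndon_words (strand_letters j) m))%:R.
apply: (moebius_inversion (g := g) (f := fun m => j%:R ^+ m) n0) => m m0.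
rewrite -natrX -{1}(size_strand_letters j).
rewrite -(sum_lyndon_words (strand_letters_uniq j) m0) natr_sum.
by apply: eq_bigr => i _; rewrite natrM.
Qed.

End Dimension.

Theorem theorem8 (k n : nat) (hk : (1 <= k)%N) (hn : (1 <= n)%N) :
  exists phi : nat,
    indecomposable_dim k n phi /\
    (phi%:R : rat) =
      n%:R^-1 * \sum_(m <- divisors n)
        (moebius (n %/ m)%N)%:~R * \sum_(1 <= i < k) i%:R ^+ m.
Proof.
exists (size [seq l <- combed_words k n | lyndon l]); split.
  exact: indecomposable_dim_lyndon.
have n0 : (n%:R : rat) != 0 by rewrite pnatr_eq0 -lt0n.
apply: (mulfI n0); rewrite mulrA divff // mul1r size_combed_lyndon // natr_sum mulr_sumr.
under eq_bigr => j _ do rewrite lyndon_formula //.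
rewrite exchange_big /=; apply: eq_big_seq => m mn.
have m0 : (0 < m)%N by move: mn; rewrite -dvdn_divisors //; apply: dvdn_gt0.
rewrite -mulr_sumr; congr (_ * _).
rewrite -(big_mkord xpredT (fun j : nat => j%:R ^+ m : rat)) big_ltn //.
by rewrite expr0n gtn_eqF // add0r.
Qed.
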